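(* Let $s\in(0,1)\setminus\{\frac12\}$, let $\Omega\subset\mathbb R$ be bounded, open and Lipschitz, and let $q\in L^\infty(\Omega)$ be real-valued and such that $0\notin\tilde\Sigma^s_{0;q}$. Assume that $u\in H^s(\Omega+\mathbb R_+)$ satisfies (weakly) $$(A^s_0(D)+q)u=0\quad\text{in }\Omega,$$ and that $u=0$ in some open, non-empty set $U\subset\Omega$. Then $u\equiv0$ in $\mathbb R_++\Omega$.
   Context: $\mathbb R_+=(0,\infty)$. $A^s_0(D)$ is the one-dimensional operator $$A^s_0(D)f(x)=\int_0^\infty\frac{f(x)-f(x+y)}{y^{1+2s}}\,dy\ \ (0<s<\tfrac12),\qquad A^s_0(D)f(x)=\int_0^\infty\frac{f(x)-f(x+y)+yf'(x)}{y^{1+2s}}\,dy\ \ (\tfrac12<s<1).$$ Sobolev spaces: for open $V$, $H^s(V)$ is the space of restrictions to $V$ of elements of $H^s(\mathbb R)$; $\widetilde H^s(V)$ is the closure of $C_c^\infty(V)$ in $H^s(\mathbb R)$; $H^{-s}(V)=(\widetilde H^s(V))^*$. The associated bilinear form on $H^s(\mathbb R)$ is $$\tilde B(u,v)=\frac{1}{2-2^{2s}}\int_{\mathbb R}\int_0^\infty\big(u(x)-u(x+y)\big)\big(v(x)-v(x-y)\big)\frac{dy\,dx}{y^{1+2s}}+\int_\Omega quv\,dx .$$ The equation $(A^s_0(D)+q)u=0$ in $\Omega$ means $\tilde B(\tilde u,v)=0$ for all $v\in\widetilde H^s(\Omega)$ and any $\tilde u\in H^s(\mathbb R)$ with $\tilde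 u|_{\Omega+\mathbb R_+}=u$ (the value does not depend on the extension). The condition $0\notin\tilde\Sigma^s_{0;q}$ means that for every $g\in H^{-s}(\Omega)$ there is a unique $w\in\widetilde H^s(\Omega)$ with $\tilde B(w,v)=\langle g,v\rangle$ for all $v\in\widetilde H^s(\Omega)$.
   Formalization: The claim fails for some disconnected Ω, e.g. Ω=(0,1)∪(2,3), U=(2,3), q=0; the theorem adds that every point of Ω+R_+ outside Ω lies to the right of some point of U, which is automatic when Ω is connected; functions are taken real-valued. *)

(* Defs.v *)
(* MathComp-Analysis. *)
From HB Require Import structures.
From mathcomp Require Import all_boot all_order all_algebra.
From mathcomp Require Import all_classical all_reals all_analysis.

Set Implicit Arguments.
Unset Strict Implicit.
Unset Printing Implicit Defensive.
Import Order.TTheory GRing.Theory Num.Theory.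
Import numFieldNormedType.Exports.

Local Open Scope classical_set_scope.
Local Open Scope ring_scope.

(* Functions are real-valued, defined on all of R and taken up to Lebesgue-null
   sets; a function on a subset V of R is a function on R whose values outside V
   are never used. *)

Section sobolev.
Context {R : realType}.
Implicit Types (s : R) (u v w q : R -> R) (V Om : set R).

Notation mu := (@lebesgue_measure R).

Definition ae_eq_on V u v : Prop := {ae mu, forall x, V x -> u x = v x}.

(* A + R_+, where R_+ = (0, +oo). *)
Definition add_pos (A : set R) : set R :=
  [set a + t | a in A & t in [set t | 0 < t]].

(* In dimension one, a Lipschitz graph over R^0 is a point: locally near each
   boundary point, the set lies on exactly one side of that point. *)
Definition lipschitz_set Om : Prop :=
  forall x, (closure Om `\` interior Om) x ->
  exists2 r, 0 < r &
    (forall y, `|y - x| < r -> (Om y <-> y < x)) \/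
    (forall y, `|y - x| < r -> (Om y <-> x < y)).

Definition essentially_bounded_on Om q : Prop := (q \_ Om) \in Lfun mu +oo%E.

(* The integrand vanishes on the diagonal, since 0 `^ (1 + 2 * s) = 0 and
   0^-1 = 0. *)
Definition gagliardo s u : \bar R :=
  (\int[mu]_x \int[mu]_y
     ((u x - u y) ^+ 2 / `|x - y| `^ (1 + 2 * s))%:E)%E.

(* H^s(R) for 0 < s < 1, as a Sobolev-Slobodeckij space. *)
Definition Hs s u : Prop :=
  u \in Lfun mu 2%:E /\ (gagliardo s u < +oo)%E.

Definition Hs_norm s u : R :=
  Num.sqrt (fine (\int[mu]_x ((u x) ^+ 2)%:E + gagliardo s u)%E).

Definition Hs_on s V u : Prop := exists2 w, Hs s w & ae_eq_on V w u.

Definition test_function V (phi : R -> R) : Prop :=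
  [/\ forall n x, derivable (derive1n n phi) x 1,
      compact (closure [set x | phi x != 0]) &
      closure [set x | phi x != 0] `<=` V].

(* The closure of C_c^oo(V) in H^s(R). *)
Definition Hs_tilde s V u : Prop :=
  Hs s u /\
  forall e, 0 < e ->
    exists2 phi, test_function V phi & Hs_norm s (u \- phi) < e.

(* H^{-s}(V), the dual of the space above. Boundedness and linearity imply that
   g takes the same value on almost everywhere equal functions. *)
Definition Hs_dual s V (g : (R -> R) -> R) : Prop :=
  (forall a v w, Hs_tilde s V v -> Hs_tilde s V w ->
     g (fun x => a * v x + w x) = a * g v + g w) /\
  exists C, forall v, Hs_tilde s V v -> `|g v| <= C * Hs_norm s v.

Definition Bform s Om q u v : R :=
  (2 - 2 `^ (2 * s))^-1 *
  (\int[mu]_x \int[mu]_(y in `]0, +oo[)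
     ((u x - u (x + y)) * (v x - v (x - y)) / y `^ (1 + 2 * s)))%R
  + (\int[mu]_(x in Om) (q x * u x * v x))%R.

(* (A^s_0(D) + q) u = 0 in Om, for u given on Om + R_+. *)
Definition weak_solution s Om q u : Prop :=
  forall ut, Hs s ut -> ae_eq_on (add_pos Om) ut u ->
  forall v, Hs_tilde s Om v -> Bform s Om q ut v = 0.

Definition zero_not_in_spectrum s Om q : Prop :=
  forall g, Hs_dual s Om g ->
  exists w,
    [/\ Hs_tilde s Om w,
        forall v, Hs_tilde s Om v -> Bform s Om q w v = g v &
        forall w', Hs_tilde s Om w' ->
          (forall v, Hs_tilde s Om v -> Bform s Om q w' v = g v) ->
          ae_eq_on setT w' w].

(* Every point of Om + R_+ outside Om lies to the right of some point of U.
   This holds for every nonempty U in Om when Om is connected (see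
   no_gap_connected). In general it says that U meets the leftmost component of
   Om, and unique continuation from U to Om + R_+ fails without it. Take for
   instance Om = (0, 1) U (2, 3), U = (2, 3), q = 0 and u the Weyl integral
     u(x) = \int_x^oo (z - x)^(2s - 1) g(z) dz,  0 <> g in C_c^oo((1, 2)).
   A^s_0(D) u is a multiple of g, hence vanishes on Om, and u = 0 on U, but u is
   not zero on (1, 2). Moreover 0 is not in the spectrum, since the form for
   q = 0 is, up to sign, coercive on the closure of C_c^oo(Om). *)
Definition no_gap Om U : Prop := add_pos Om `<=` Om `|` add_pos U.

Lemma no_gap_connected Om U :
  connected Om -> U !=set0 -> U `<=` Om -> no_gap Om U.
Proof.
move=> /connected_intervalP itvOm [b Ub] UOm _ [a Oma [t /= t0 <-]].
have [bat|atb] := ltP b (a + t).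
  right; exists b => //; exists (a + t - b) => /=; first by rewrite subr_gt0.
  by rewrite addrC subrK.
left; apply: (itvOm a b Oma (UOm _ Ub)).
by rewrite lerDl (ltW t0) atb.
Qed.

End sobolev.

(* Main.v *)
(* Let w in H^s(R) extend u, let W be the mollification of w at a small scale r,
   and let k(y) = y^(-1-2s). Testing the equation with a bump centred at x in Om
   gives, up to a nonzero factor,
     int_0^oo k(y) (W(x) - 2 W(x + y) + W(x + 2y)) dy = - (q w)_r (x).
   To the right: if w = 0 on an interval (a, b) in Om, then near its points x the
   right hand side vanishes and the left hand side is a multiple of
   int_b^oo W(z) (z - x)^(-1-2s) dz. Differentiating in x, all the moments of W
   against powers of 1 / (z - x) vanish, hence w = 0 on (b, +oo).
   To the left: once w = 0 on (a, +oo), with (alpha, b) in Om and a < b, inverting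
   the one-sided operator by a Weyl integral gives the Volterra inequality
     |W(x)| <= C int_0^oo t^(2s-1) |w|_r (x + t) dt   for x > alpha + r,
   and Gronwall's argument gives w = 0 on (alpha, +oo). *)
Require Import Defs.
From HB Require Import structures.
From mathcomp Require Import all_boot all_order all_algebra.
From mathcomp Require Import all_classical all_reals all_analysis.
From mathcomp Require Import measurable_realfun ess_sup_inf ring lra.

Set Implicit Arguments.
Unset Strict Implicit.
Unset Printing Implicit Defensive.
Import Order.TTheory GRing.Theory Num.Theory.
Import numFieldNormedType.Exports.

Local Open Scope classical_set_scope.
Local Open Scope ring_scope.

(** * Changes of variables and Fubini *)

(** There the shift in v can be moved onto w, and the two factors 1 - T_y compose to 1 - 2 T_y +
    T_(2y), with T_y w = w (. + y). When the function vanishes near the base point, the dilation y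
    -> 2 y merges the two remaining terms into 2^(2s) - 2 times one integral. This is, up to sign,
    the constant of the form, and it is nonzero because s <> 1/2. The inversion rests on W = I^2
    W'': a second difference of I^2 g is the pairing of g with a hat function, hats integrated
    against k leave a multiple of I^(2-2s), and I^(2s) composed with that returns I^2. Nothing is
    differentiated under a singular kernel, and of each constant only finiteness and positivity
    matter. The obstacle on the left is that q multiplies w before mollification: |W| is bounded
    through |w|_r, so the inequality cannot be iterated at fixed r. It is integrated against a
    weight instead, and r tends to 0 in L^1. *)

Section affine.
Context {R : realType}.
Local Notation mu := (@lebesgue_measure R).

Lemma measurable_affine (k a : R) :
  measurable_fun setT (fun x : measurableTypeR R => k * x + a : measurableTypeR R).
Proof.
by apply: measurable_funD => //; apply: measurable_funM.
Qed.

(** Rescaled by |k|, the pushforward gives every half-open interval its length, and this determines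
    Lebesgue measure. For k < 0 the preimage of []x, y]] is closed on the left instead, with the
    same length. *)
Lemma lebesgue_measure_affine (k a : R) (A : set R) : k != 0 -> measurable A ->
  pushforward mu (fun x => k * x + a : measurableTypeR R) A =
  ((`|k|^-1)%:E * mu A)%E.
Proof.
move=> k0 mA.
have k'0 : 0 < `|k| by rewrite normr_gt0.
pose k' := NngNum (ltW k'0).
pose phi := (fun x : measurableTypeR R => k * x + a : measurableTypeR R).
pose nu : {measure set (measurableTypeR R) -> \bar R} :=
  mscale k' (pushforward mu phi).
have -> : mu A = nu (measurable_affine k a) A.
  apply: (@lebesgue_measure_unique _ (nu (measurable_affine k a))) => //= _ [[x y]] _ <-.
  rewrite /nu /mscale/= /pushforward/=.
  have [kp|kn|k00] := ltgtP 0 k; last by rewrite -k00 eqxx in k0.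
  - have -> : phi @^-1` `]x, y]%classic = `](x - a) / k, (y - a) / k]%classic.
      apply/seteqP; split => z /=; rewrite !in_itv/= /phi => /andP[h1 h2].
        rewrite ltr_pdivrMr// ler_pdivlMr//; lra.
      by move: h1 h2; rewrite ltr_pdivrMr// ler_pdivlMr// => h1 h2; lra.
    rewrite !lebesgue_measure_itv/= !lte_fin ltr_pM2r ?invr_gt0// ltrD2r.
    case: ifP => _; last by rewrite mule0.
    by rewrite -!EFinD -EFinM -mulrBl; congr (_%:E); rewrite gtr0_norm//; field.
  - have -> : phi @^-1` `]x, y]%classic = `[(y - a) / k, (x - a) / k[%classic.
      apply/seteqP; split => z /=; rewrite !in_itv/= /phi => /andP[h1 h2].
        rewrite ler_ndivrMr// ltr_ndivlMr//; lra.
      by move: h1 h2; rewrite ler_ndivrMr// ltr_ndivlMr// => h1 h2; lra.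
    rewrite !lebesgue_measure_itv/= !lte_fin ltr_nM2r ?invr_lt0// ltrD2r.
    case: ifP => _; last by rewrite mule0.
    by rewrite -!EFinD -EFinM -mulrBl; congr (_%:E); rewrite ltr0_norm//; field.
by rewrite /nu /mscale/= muleA -EFinM mulVf ?mul1e// normr_eq0.
Qed.

Lemma ge0_integral_affine (k a : R) (f : R -> \bar R) : k != 0 ->
  measurable_fun setT f -> (forall x, (0 <= f x)%E) ->
  (\int[mu]_x f (k * x + a)%R = (`|k|^-1)%:E * \int[mu]_x f x)%E.
Proof.
move=> k0 mf f0.
have k'0 : 0 <= `|k|^-1 by rewrite invr_ge0.
pose k' := NngNum k'0.
have H := ge0_integral_pushforward (@measurable_affine k a) mu measurableT mf
  (fun x _ => f0 x).
rewrite preimage_setT in H.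
rewrite (_ : (`|k|^-1)%:E = (k'%:num)%:E)// -ge0_integral_mscale// -[LHS]H.
apply: eq_measure_integral => [|mphi A mA _]; first exact: measurable_affine.
exact: (lebesgue_measure_affine a k0 mA).
Qed.

Lemma integrable_affine (k a : R) (f : R -> R) : k != 0 ->
  mu.-integrable setT (EFin \o f) ->
  mu.-integrable setT (EFin \o (fun x => f (k * x + a))).
Proof.
move=> k0 /integrableP[mf foo]; apply/integrableP; split.
  exact: (measurableT_comp mf (measurable_affine k a)).
have mfa : measurable_fun setT (fun x => `|(f x)%:E|%E) by exact: measurableT_comp.
rewrite [ltLHS](@ge0_integral_affine k a _ k0 mfa)//.
by rewrite lte_mul_pinfty// lee_fin invr_ge0.
Qed.

Lemma Rintegral_affine (k a : R) (f : R -> R) : k != 0 ->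
  mu.-integrable setT (EFin \o f) ->
  \int[mu]_x f (k * x + a) = `|k|^-1 * \int[mu]_x f x.
Proof.
move=> k0 fi; have mf := measurable_int _ fi.
rewrite /Rintegral [in LHS]integralE [in RHS]integralE.
have mp : measurable_fun setT (EFin \o f)^\+%E by apply: measurable_funepos.
have mn : measurable_fun setT (EFin \o f)^\-%E by apply: measurable_funeneg.
have hp := @ge0_integral_affine k a _ k0 mp (fun x => funepos_ge0 _ x).
have hn := @ge0_integral_affine k a _ k0 mn (fun x => funeneg_ge0 _ x).
rewrite (_ : (\int[mu]_x (fun x0 => (f (k * x0 + a))%:E)^\+ x =
  \int[mu]_x (EFin \o f)^\+ (k * x + a)%R)%E); last first.
  by apply: eq_integral => x _; rewrite !funeposE.
rewrite (_ : (\int[mu]_x (fun x0 => (f (k * x0 + a))%:E)^\- x =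
  \int[mu]_x (EFin \o f)^\- (k * x + a)%R)%E); last first.
  by apply: eq_integral => x _; rewrite !funenegE.
rewrite hp hn.
rewrite -muleBr//; last by apply: integrable_add_def.
rewrite fineM//.
have := integrable_fin_num measurableT fi.
by rewrite integralE.
Qed.

End affine.

Lemma ae_eq_integrable d (T : measurableType d) (R : realType)
    (m : {measure set T -> \bar R}) (f g : T -> \bar R) :
  measurable_fun setT g -> ae_eq m setT f g ->
  m.-integrable setT f -> m.-integrable setT g.
Proof.
move=> mg fg /integrableP[mf foo]; apply/integrableP; split=> //.
rewrite (ae_eq_integral (fun x => `|f x|%E))//.
- exact: measurableT_comp.
- exact: measurableT_comp.
- by apply: filterS fg => x /= fgx xT; rewrite fgx.
Qed.

Section Rfubini.
Context d1 d2 (T1 : measurableType d1) (T2 : measurableType d2) (R : realType).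
Variable m1 : {sigma_finite_measure set T1 -> \bar R}.
Variable m2 : {sigma_finite_measure set T2 -> \bar R}.
Variable f : T1 * T2 -> R.
Hypothesis imf : (m1 \x m2)%E.-integrable setT (EFin \o f).

Let mF : measurable_fun setT (fun x => \int[m2]_y (f (x, y))%:E)%E.
Proof. exact: (measurable_fubini_F imf). Qed.

Let mG : measurable_fun setT (fun y => \int[m1]_x (f (x, y))%:E)%E.
Proof. exact: (measurable_fubini_G imf). Qed.

(** The extended inner integral may be infinite on a null set, where [fine] replaces it by 0.
    Integrability and the value of the outer integral pass to the real-valued version through this
    almost everywhere equality. *)
Let aeF : ae_eq m1 setT (fun x => \int[m2]_y (f (x, y))%:E)%E
  (EFin \o (fun x => \int[m2]_y (f (x, y)))).
Proof.
apply: filterS (ae_integrable1 imf) => x /= ix _.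
by rewrite fineK//; exact: integrable_fin_num ix.
Qed.

Let aeG : ae_eq m2 setT (fun y => \int[m1]_x (f (x, y))%:E)%E
  (EFin \o (fun y => \int[m1]_x (f (x, y)))).
Proof.
apply: filterS (ae_integrable2 imf) => x /= ix _.
by rewrite fineK//; exact: integrable_fin_num ix.
Qed.

Let mRF : measurable_fun setT (EFin \o (fun x => \int[m2]_y (f (x, y)))).
Proof. by apply: measurableT_comp => //; exact: measurableT_comp. Qed.

Let mRG : measurable_fun setT (EFin \o (fun y => \int[m1]_x (f (x, y)))).
Proof. by apply: measurableT_comp => //; exact: measurableT_comp. Qed.

Lemma integrable_Rfubini_F :
  m1.-integrable setT (EFin \o (fun x => \int[m2]_y (f (x, y)))).
Proof. exact: (ae_eq_integrable mRF aeF (integrable_fubini_F imf)). Qed.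

Lemma Rintegral12_prod :
  \int[m1]_x \int[m2]_y f (x, y) = \int[(m1 \x m2)%E]_z f z.
Proof.
congr fine; rewrite -(ae_eq_integral _ _ measurableT mF mRF aeF)//.
exact: (integral12_prod_meas1 imf).
Qed.

Lemma Rintegral21_prod :
  \int[m2]_y \int[m1]_x f (x, y) = \int[(m1 \x m2)%E]_z f z.
Proof.
congr fine; rewrite -(ae_eq_integral _ _ measurableT mG mRG aeG)//.
exact: (integral21_prod_meas1 imf).
Qed.

Lemma RFubini :
  \int[m1]_x \int[m2]_y f (x, y) = \int[m2]_y \int[m1]_x f (x, y).
Proof. by rewrite Rintegral12_prod Rintegral21_prod. Qed.

End Rfubini.

Section shift.
Context {R : realType}.
Local Notation mu := (@lebesgue_measure R).
Local Notation Int f := (mu.-integrable setT (EFin \o f)).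

Lemma ge0_integral_shift (a : R) (f : R -> \bar R) :
  measurable_fun setT f -> (forall x, (0 <= f x)%E) ->
  (\int[mu]_x f (x + a)%R = \int[mu]_x f x)%E.
Proof.
move=> mf f0; have := @ge0_integral_affine R 1 a f (oner_neq0 _) mf f0.
by rewrite normr1 invr1 mul1e; under eq_integral do rewrite mul1r.
Qed.

Lemma integrable_shift (a : R) (f : R -> R) : Int f -> Int (fun x => f (x + a)).
Proof.
move=> /(@integrable_affine R 1 a f (oner_neq0 _)).
by apply: eq_integrable => // x _; rewrite /= mul1r.
Qed.

Lemma Rintegral_shift (a : R) (f : R -> R) : Int f ->
  \int[mu]_x f (x + a) = \int[mu]_x f x.
Proof.
move=> /(@Rintegral_affine R 1 a f (oner_neq0 _)).
by rewrite normr1 invr1 mul1r; under eq_Rintegral do rewrite mul1r.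
Qed.

End shift.

(** * Composition of the two first differences of the form *)

Section second_difference.
Context {R : realType}.
Local Notation mu := (@lebesgue_measure R).
Local Notation Int f := (mu.-integrable setT (EFin \o f)).

Lemma le_Int d (T : measurableType d) (m : {measure set T -> \bar R})
    (f g : T -> R) : measurable_fun setT f -> (forall x, `|f x| <= g x) ->
  m.-integrable setT (EFin \o g) -> m.-integrable setT (EFin \o f).
Proof.
move=> mf fg; apply: le_integrable => //; first exact/measurable_EFinP.
by move=> x _ /=; rewrite lee_fin (le_trans (fg x))// ler_norm.
Qed.

Lemma le_Int1 (f g : R -> R) : measurable_fun setT f ->
  (forall x, `|f x| <= g x) -> Int g -> Int f.
Proof. by move=> mf; exact: (@le_Int _ (measurableTypeR R)). Qed.

Lemma IntD d (T : measurableType d) (m : {measure set T -> \bar R})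
    (f g : T -> R) :
  m.-integrable setT (EFin \o f) -> m.-integrable setT (EFin \o g) ->
  m.-integrable setT (EFin \o (fun x => f x + g x)).
Proof.
by move=> fi gi; apply: eq_integrable (integrableD measurableT fi gi).
Qed.

Lemma IntB d (T : measurableType d) (m : {measure set T -> \bar R})
    (f g : T -> R) :
  m.-integrable setT (EFin \o f) -> m.-integrable setT (EFin \o g) ->
  m.-integrable setT (EFin \o (fun x => f x - g x)).
Proof.
by move=> fi gi; apply: eq_integrable (integrableB measurableT fi gi).
Qed.

Lemma IntZ d (T : measurableType d) (m : {measure set T -> \bar R})
    (k : R) (f : T -> R) : m.-integrable setT (EFin \o f) ->
  m.-integrable setT (EFin \o (fun x => k * f x)).
Proof.
by move=> fi; apply: eq_integrable (integrableZl measurableT k fi).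
Qed.

Variables (k w v : R -> R).
Hypotheses (mk : measurable_fun setT k) (k0 : forall y, 0 <= k y).
Hypotheses (mw : measurable_fun setT w) (mv : measurable_fun setT v).
Hypotheses (w2 : Int (fun x => w x ^+ 2)) (v2 : Int (fun x => v x ^+ 2)).
Hypothesis wk : (\int[mu]_y \int[mu]_x ((w x - w (x + y)) ^+ 2 * k y)%:E < +oo)%E.
Hypothesis vk : (\int[mu]_y \int[mu]_x ((v x - v (x + y)) ^+ 2 * k y)%:E < +oo)%E.

Let F (p : R * R) := (w p.1 - w (p.1 + p.2)) * (v p.1 - v (p.1 - p.2)) * k p.2.

Let msub (u : R -> R) : measurable_fun setT u ->
  measurable_fun setT (fun p : R * R => u (p.1 - p.2)).
Proof.
move=> mu'; apply: measurableT_comp => //.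
exact: measurable_funB.
Qed.

Let madd (u : R -> R) : measurable_fun setT u ->
  measurable_fun setT (fun p : R * R => u (p.1 + p.2)).
Proof.
move=> mu'; apply: measurableT_comp => //.
exact: measurable_funD.
Qed.

Let mfst (u : R -> R) : measurable_fun setT u ->
  measurable_fun setT (fun p : R * R => u p.1).
Proof. by move=> mu'; exact: measurableT_comp. Qed.

Let msnd (u : R -> R) : measurable_fun setT u ->
  measurable_fun setT (fun p : R * R => u p.2).
Proof. by move=> mu'; exact: measurableT_comp. Qed.

Let mF : measurable_fun setT F.
Proof.
apply: measurable_funM; last exact: msnd.
by apply: measurable_funM; apply: measurable_funB;
  [exact: mfst|exact: madd|exact: mfst|exact: msub].
Qed.

(** From |a b| <= a^2 + b^2, the integrand is dominated by the two Gagliardo integrands. The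
    translation x -> x + y turns the backward difference of v into the forward one of the
    hypothesis. *)
Let iF : (mu \x mu)%E.-integrable setT (EFin \o F).
Proof.
pose A (p : R * R) := (w p.1 - w (p.1 + p.2)) ^+ 2 * k p.2.
pose B (p : R * R) := (v p.1 - v (p.1 - p.2)) ^+ 2 * k p.2.
have mA : measurable_fun setT A.
  apply: measurable_funM; last exact: msnd.
  by apply: measurable_funX; apply: measurable_funB; [exact: mfst|exact: madd].
have mB : measurable_fun setT B.
  apply: measurable_funM; last exact: msnd.
  by apply: measurable_funX; apply: measurable_funB; [exact: mfst|exact: msub].
have A0 p : 0 <= A p by rewrite mulr_ge0// sqr_ge0.
have B0 p : 0 <= B p by rewrite mulr_ge0// sqr_ge0.
apply: (@le_Int _ (measurableTypeR R * measurableTypeR R)%type (mu \x mu)%E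
  F (fun p => A p + B p) mF).
  move=> p; rewrite /F normrM (ger0_norm (k0 _)) /A /B -mulrDl ler_wpM2r//.
  set a := w _ - _; set b := v _ - _; rewrite ler_norml; apply/andP; split; nra.
apply: IntD; apply/integrable21ltyP.
- exact/measurable_EFinP.
- under eq_integral => y _ do under eq_integral => x _ do
    rewrite /= ger0_norm//.
  exact: wk.
- exact/measurable_EFinP.
- under eq_integral => y _ do under eq_integral => x _ do
    rewrite /= ger0_norm//.
  suff -> : (\int[mu]_y \int[mu]_x (B (x, y))%:E =
      \int[mu]_y \int[mu]_x ((v x - v (x + y)) ^+ 2 * k y)%:E)%E by exact: vk.
  apply: eq_integral => y _.
  have mBy : measurable_fun setT (fun x => (B (x, y))%:E).
    apply/measurable_EFinP; rewrite /B/=; apply: measurable_funM => //.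
    apply: measurable_funX; apply: measurable_funB => //.
    by apply: (measurableT_comp mv); exact: measurable_funB.
  rewrite -(ge0_integral_shift y mBy)//.
    by apply: eq_integral => x _; rewrite /B/= addrK -sqrrN opprB.
  by move=> x; rewrite lee_fin.
Qed.

Let iwv (a b : R) : Int (fun x => w (x + a) * v (x + b)).
Proof.
apply: (@le_Int1 _ (fun x => w (x + a) ^+ 2 + v (x + b) ^+ 2)).
- by apply: measurable_funM; [apply: (measurableT_comp mw)|
    apply: (measurableT_comp mv)]; exact: measurable_funD.
- move=> x; rewrite ler_norml; apply/andP; split; nra.
- by apply: IntD; [exact: (integrable_shift a w2)|exact: (integrable_shift b v2)].
Qed.

Let corr (y : R) := \int[mu]_x (w x * v (x - y)).

(** By translation invariance only the difference of the two shifts matters; [corr] is the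
    cross-correlation of w and v. *)
Let wvE a b : \int[mu]_x (w (x + a) * v (x + b)) = corr (a - b).
Proof.
have := iwv 0 (b - a); under [X in _.-integrable _ X]eq_fun do rewrite /= addr0.
move=> h; have := @Rintegral_shift R a (fun x => w x * v (x + (b - a))) h.
rewrite /corr; under [X in _ = X -> _]eq_Rintegral do rewrite -opprB.
by move=> <-; apply: eq_Rintegral => x _; congr (_ * v _); ring.
Qed.

Let innerE y : \int[mu]_x F (x, y) = k y * (corr 0 - 2 * corr y + corr (2 * y)).
Proof.
rewrite -[corr y](_ : \int[mu]_x (w (x + 0) * v (x + (- y))) = _); last first.
  by rewrite wvE; congr corr; ring.
rewrite -[corr 0](_ : \int[mu]_x (w (x + 0) * v (x + 0)) = _); last first.
  by rewrite wvE; congr corr; ring.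
rewrite -[corr (2 * y)](_ : \int[mu]_x (w (x + y) * v (x + (- y))) = _); last first.
  by rewrite wvE; congr corr; ring.
(* [corr y] arises from two pairs of shifts, (0, -y) and (y, 0). Writing it as their average
   reproduces both mixed terms of F. *)
have -> : \int[mu]_x (w (x + 0) * v (x - y)) =
   2^-1 * (\int[mu]_x (w (x + 0) * v (x - y)) + \int[mu]_x (w (x + y) * v (x + 0))).
  by rewrite !wvE sub0r opprK subr0; field.
rewrite mulVKf// -RintegralD//.
rewrite -RintegralB//; last exact: IntD.
rewrite -RintegralD//; last by apply: IntB => //; exact: IntD.
rewrite -RintegralZl//; last first.
  by apply: IntD => //; apply: IntB => //; exact: IntD.
by apply: eq_Rintegral => x _; rewrite /F/= !addr0; ring.
Qed.

(* Integrating in x first leaves only correlations of w with translates of v,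
   on which the two first differences compose to a second difference. *)
Lemma Rintegral_second_difference :
  \int[mu]_x \int[mu]_y ((w x - w (x + y)) * (v x - v (x - y)) * k y) =
  \int[mu]_y (k y * (corr 0 - 2 * corr y + corr (2 * y))).
Proof.
rewrite (RFubini iF); apply: eq_Rintegral => y _; exact: innerE.
Qed.

End second_difference.

(** * Smooth bumps and their derivatives *)

Section expinv.
Context {R : realType}.
Implicit Types (D P Q : {poly R}) (n : nat).

(* Every derivative of exp (-1 / D), extended by 0 to the set D <= 0, has the
   form expinv D P n. *)
Definition expinv D P n (x : R) : R :=
  if 0 < D.[x] then P.[x] / D.[x] ^+ n * expR (- D.[x]^-1) else 0.

(** The numerator over D^(n+2) of the derivative of P D^-n exp (-1 / D), whose three terms come from
    P, from D^-n and from the exponential. *)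
Definition expinv_next D P n : {poly R} :=
  P^`() * D ^+ 2 - n%:R *: (P * D * D^`()) + P * D^`().

(** Serves at the points where D <= 0, in particular on the boundary of the support, where the
    quotient rule does not apply. *)
Lemma is_derive_quadratic_bound (f : R -> R) (x C : R) : f x = 0 ->
  (\forall y \near x, `|f y| <= C * (y - x) ^+ 2) -> is_derive x 1 f 0.
Proof.
move=> fx0 fC.
have : h^-1 *: ((f \o shift x) (h *: (1 : R^o)) - f x) @[h --> (0 : R^o)^'] --> (0 : R^o).
  have fC' : \forall h \near (0 : R), `|f (h + x)| <= C * h ^+ 2.
    move: fC; rewrite (near_shift 0 x) /= => fC.
    by apply: filterS fC => h /=; rewrite subr0 addrK.
  apply/cvgrPdist_le => e e0.
  have : \forall h \near (0 : R), `|C| * `|h| <= e.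
    have [->|C0] := eqVneq C 0.
      by near=> h; rewrite normr0 mul0r ltW.
    have Ce0 : 0 < `|C|^-1 * e by rewrite mulr_gt0// invr_gt0 normr_gt0.
    have := @nbhs0_le R R^o _ Ce0; apply: filterS => h.
    by rewrite ler_pdivlMl ?normr_gt0.
  move=> he; apply: nbhs_dnbhs; near=> h.
  rewrite sub0r normrN /= fx0 subr0 normrZ normfV /shift/= [h *: _]mulr1.
  have [->|h0] := eqVneq h 0; first by rewrite normr0 invr0 mul0r ltW.
  rewrite mulrC ler_pdivrMr ?normr_gt0//.
  apply: (@le_trans _ _ (C * h ^+ 2)); first by near: h.
  rewrite -(@ger0_norm _ (h ^+ 2)) ?sqr_ge0// normrX expr2 mulrA ler_wpM2r//.
  apply: (@le_trans _ _ (`|C| * `|h|)); last by near: h.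
  by rewrite ler_wpM2r// ler_norm.
move=> H; apply: DeriveDef.
  by apply/cvg_ex; exists 0.
by apply/cvg_lim.
Unshelve. all: by end_near. Qed.

Lemma poly_near_bounded P (x : R) : \forall y \near x, `|P.[y]| <= `|P.[x]| + 1.
Proof.
have := @continuous_horner R P x; move=> /cvgrPdist_le/(_ 1 ltr01).
apply: filterS => y; rewrite distrC => h.
by rewrite -lerBlDl (le_trans _ h)// lerB_dist.
Qed.

(** With y = 1 / t this is y^(n+2) / (n+2)! <= e^y. The two spare powers of t are what the quadratic
    bound at a zero of D asks for. *)
Lemma expinv_le (t : R) n : 0 < t ->
  t ^- n * expR (- t^-1) <= (n.+2)`!%:R * t ^+ 2.
Proof.
move=> t0; have t'0 : 0 <= t^-1 by rewrite invr_ge0 ltW.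
have := @expR_ge1Dxn R _ n.+1 t'0.
rewrite expRN => h.
have {}h : t^-1 ^+ n.+2 / (n.+2)`!%:R <= expR t^-1.
  by apply: le_trans h; rewrite lerDr.
rewrite ler_pdivrMr ?expR_gt0//.
have f0 : 0 < (n.+2)`!%:R :> R by rewrite ltr0n fact_gt0.
rewrite -ler_pdivrMl; last by rewrite mulr_gt0// exprn_gt0.
apply: le_trans h; rewrite le_eqVlt; apply/orP; left; apply/eqP.
rewrite -!exprVn !exprS; field.
by rewrite ?gt_eqF ?t0 ?f0.
Qed.

Lemma is_derive_expinv D P n (x : R) :
  is_derive x 1 (expinv D P n) (expinv D (expinv_next D P n) n.+2 x).
Proof.
have [Dx|Dx] := ltP 0 D.[x]; last first.
  have fx0 : expinv D P n x = 0 by rewrite /expinv ltNge Dx.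
  rewrite {2}/expinv ltNge Dx /=.
  (* Since D (x) <= 0, the factorisation gives D (y) <= Q (y) (y - x), so that D (y)^2 is O ((y -
     x)^2) wherever D (y) > 0. *)
  have [Q DQ] : exists Q, D - D.[x]%:P = Q * ('X - x%:P).
    by apply/factor_theorem; rewrite /root !hornerE subrr.
  apply: (@is_derive_quadratic_bound _ _
    ((`|P.[x]| + 1) * (n.+2)`!%:R * (`|Q.[x]| + 1) ^+ 2)) => //.
  near=> y; rewrite /expinv; case: ifPn => [Dy|_]; last first.
    by rewrite normr0 mulr_ge0 ?sqr_ge0// mulr_ge0 ?sqr_ge0// mulr_ge0// addr_ge0.
  rewrite -mulrA normrM -!mulrA ler_pM//.
    by near: y; exact: poly_near_bounded.
  rewrite ger0_norm ?mulr_ge0 ?expR_ge0 ?invr_ge0 ?exprn_ge0 ?(ltW Dy)//.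
  apply: le_trans (expinv_le n Dy) _; rewrite ler_wpM2l//.
  have -> : (`|Q.[x]| + 1) * ((`|Q.[x]| + 1) * (y - x) ^+ 2) =
    ((`|Q.[x]| + 1) * (y - x)) ^+ 2 by ring.
  rewrite -(@ger0_norm _ (D.[y] ^+ 2)) ?sqr_ge0// normrX.
  have := congr1 (fun p => p.[y]) DQ; rewrite !hornerE => DQy.
  have Qy : `|Q.[y]| <= `|Q.[x]| + 1 by near: y; exact: poly_near_bounded.
  rewrite -(@ger0_norm _ (((_ + 1) * _) ^+ 2)) ?sqr_ge0// [leRHS]normrX.
  rewrite lerXn2r ?nnegrE// normrM (ger0_norm (_ : 0 <= `|Q.[x]| + 1)) ?addr_ge0//.
  apply: le_trans (_ : `|Q.[y] * (y - x)| <= _).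
    rewrite -DQy (ger0_norm (ltW Dy)); apply: le_trans (ler_norm _).
    by rewrite lerDl oppr_ge0.
  by rewrite normrM ler_wpM2r.
rewrite {2}/expinv Dx.
have near_D : \forall y \near x, 0 < D.[y].
  have := @continuous_horner R D x; move=> /cvgr_gt; exact.
have D0 : D.[x] != 0 by rewrite gt_eqF.
have Dn0 : D.[x] ^+ n != 0 by rewrite expf_neq0.
pose Q y := (D.[y] ^+ n)^-1; pose E y := expR (- (D.[y]^-1)).
apply: (@near_eq_is_derive _ _ _ (fun y => horner P y * (Q y * E y))).
  by near=> y; rewrite /expinv ifT ?mulrA//; near: y.
have dP := is_derive_poly P x.
have dD := is_derive_poly D x.
have dQ : is_derive x 1 Q (- (D.[x] ^+ n) ^- 2 * (n%:R * D.[x] ^+ n / D.[x] * D^`().[x])).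
  rewrite (_ : Q = fun y => ((D ^+ n).[y])^-1); last first.
    by apply/funext => y; rewrite horner_exp.
  have Dn0' : (D ^+ n).[x] != 0 by rewrite horner_exp.
  have := @is_deriveV _ _ _ _ _ Dn0' (is_derive_poly (D ^+ n) x).
  move=> H; apply: (is_derive_eq H).
  rewrite /GRing.scale/= deriv_exp hornerMn hornerM !horner_exp.
  rewrite -mulr_natl.
  case: (n) => [|m]; first by rewrite !mul0r.
  by rewrite !exprS /=; field; rewrite D0 expf_neq0.
have dE : is_derive x 1 E (E x * (D.[x] ^- 2 * D^`().[x])).
  have dV : is_derive x 1 (fun y => - (D.[y])^-1) (D.[x] ^- 2 * D^`().[x]).
    have H := is_deriveN (@is_deriveV _ _ _ _ _ D0 dD).
    by apply: (is_derive_eq H); rewrite /GRing.scale/= mulNr opprK.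
  have H := @is_derive1_comp _ expR (fun y => - (D.[y])^-1) x _ _ (is_derive_expR _) dV.
  exact: H.
have H := is_deriveM dP (is_deriveM dQ dE).
apply: (is_derive_eq H).
rewrite /GRing.scale/= /expinv_next !(hornerD, hornerN, hornerM, hornerZ, horner_exp).
rewrite mulrfctE /Q /E [_ ^+ n.+2]exprS [_ ^+ n.+1]exprS. field.
by rewrite D0 Dn0.
Unshelve. all: by end_near. Qed.

End expinv.

Section rbump.
Context {R : realType}.
Implicit Types (r t x : R) (m : nat).

Definition rbump_den r : {poly R} := 1 - (r^-1 *: 'X) ^+ 2.

Fixpoint rbump_num r m : {poly R} :=
  if m is m'.+1 then expinv_next (rbump_den r) (rbump_num r m') m'.*2 else 1.

(* The m-th derivative in t of exp (-1 / (1 - (t / r)^2)), supported in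
   [-r, r]. *)
Definition rbump r m t : R := expinv (rbump_den r) (rbump_num r m) m.*2 t.

Lemma rbump_denE r t : (rbump_den r).[t] = 1 - (t / r) ^+ 2.
Proof.
by rewrite /rbump_den !(hornerD, hornerN, hornerC, horner_exp, hornerZ, hornerX) mulrC.
Qed.

Lemma rbump_den_gt0 r t : 0 < r -> (0 < (rbump_den r).[t]) = (`|t| < r).
Proof.
move=> r0; rewrite rbump_denE subr_gt0 -real_normK ?num_real// expr_lt1//.
by rewrite normf_div (gtr0_norm r0) ltr_pdivrMr// mul1r.
Qed.

Global Instance is_derive_rbump r m t :
  is_derive t 1 (rbump r m) (rbump r m.+1 t).
Proof. exact: is_derive_expinv. Qed.

Lemma rbump_eq0 r m t : 0 < r -> r <= `|t| -> rbump r m t = 0.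
Proof. by move=> r0 rt; rewrite /rbump /expinv rbump_den_gt0// ltNge rt. Qed.

Lemma rbumpE r t : 0 < r -> `|t| < r ->
  rbump r 0 t = expR (- (1 - (t / r) ^+ 2)^-1).
Proof.
move=> r0 tr; rewrite /rbump /expinv rbump_den_gt0// tr/= hornerC expr0 invr1.
by rewrite !mul1r rbump_denE.
Qed.

Lemma rbump_ge0 r t : 0 < r -> 0 <= rbump r 0 t.
Proof.
move=> r0; have [tr|tr] := ltP `|t| r; first by rewrite rbumpE// expR_ge0.
by rewrite rbump_eq0.
Qed.

Lemma rbump_le1 r t : 0 < r -> rbump r 0 t <= 1.
Proof.
move=> r0; have [tr|tr] := ltP `|t| r; last by rewrite rbump_eq0.
rewrite rbumpE// -(expR0 R) ler_expR oppr_le0 invr_ge0 expR0.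
by have := rbump_den_gt0 t r0; rewrite tr rbump_denE => /ltW.
Qed.

Lemma rbump_scale r t : 0 < r -> rbump r 0 t = rbump 1 0 (t / r).
Proof.
move=> r0; have trE : (`|t / r| < 1) = (`|t| < r).
  by rewrite normf_div (gtr0_norm r0) ltr_pdivrMr// mul1r.
have [tr|tr] := ltP `|t| r.
  by rewrite !rbumpE ?trE// divr1.
by rewrite !rbump_eq0// leNgt trE -leNgt.
Qed.

(** The number 4 / 3 is the value of 1 / (1 - (t / r)^2) at |t| = r / 2. *)
Lemma rbump_ge r t : 0 < r -> `|t| <= r / 2 -> expR (- 4 / 3) <= rbump r 0 t.
Proof.
move=> r0 tr; rewrite rbumpE//; last by rewrite (le_lt_trans tr)// ltr_pdivrMr// ltr_pMr// ltr1n.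
rewrite ler_expR mulNr lerN2.
have h : (t / r) ^+ 2 <= 1 / 4.
  have : `|t / r| <= 2^-1 by rewrite normf_div (gtr0_norm r0) ler_pdivrMr// mulrC.
  rewrite ler_norml => /andP[h1 h2]; nra.
rewrite -[leRHS]invrK lef_pV2 ?posrE; lra.
Qed.

Lemma continuous_rbump r m : continuous (rbump r m).
Proof.
move=> t; apply/differentiable_continuous/derivable1_diffP.
exact: (@ex_derive _ _ _ _ _ _ _ (is_derive_rbump r m t)).
Qed.

Lemma measurable_rbump r m : measurable_fun setT (rbump r m).
Proof. by apply: continuous_measurable_fun => t; exact: continuous_rbump. Qed.

Lemma bounded_rbump r m : 0 < r ->
  exists2 M : R, 0 < M & forall t, `|rbump r m t| <= M.
Proof.
move=> r0; have rr : - r <= r by rewrite ge0_cp ?ltW.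
have cb : {within `[- r, r], continuous (fun t => `|rbump r m t|)}.
  apply: continuous_subspaceT => t.
  by apply: continuous_comp; [exact: continuous_rbump|exact: norm_continuous].
have [c _ hc] := EVT_max rr cb.
exists (`|rbump r m c| + 1) => [|t]; first by rewrite ltr_wpDl.
have [rt|tr] := leP r `|t|; first by rewrite rbump_eq0// normr0 addr_ge0.
rewrite (le_trans (hc t _)) ?lerDl//.
by rewrite in_itv/= -ler_norml ltW.
Qed.

Lemma is_derive_rbump_shift r x m t :
  is_derive t 1 (fun t => rbump r m (t - x)) (rbump r m.+1 (t - x)).
Proof.
have ds : is_derive t 1 (fun t => t - x) 1.
  by apply: is_derive_eq; rewrite subr0.
have H := @is_derive1_comp _ (rbump r m) (fun t => t - x) t _ _ (is_derive_rbump r m _) ds.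
by apply: (is_derive_eq H); rewrite mulr1.
Qed.

Lemma derive1n_rbump_shift r x m :
  derive1n m (fun t => rbump r 0 (t - x)) = (fun t => rbump r m (t - x)).
Proof.
elim: m => [//|m IH]; rewrite derive1nS IH; apply/funext => t.
rewrite derive1E; exact: (@derive_val _ _ _ _ _ _ _ (is_derive_rbump_shift r x m t)).
Qed.

Lemma is_derive_rbump_oppr r z m t :
  is_derive t 1 (fun t => rbump r m (z - t)) (- rbump r m.+1 (z - t)).
Proof.
have ds : is_derive t 1 (fun t => z - t) (- 1).
  by apply: is_derive_eq; rewrite add0r mul1r.
have H := @is_derive1_comp _ (rbump r m) (fun t => z - t) t _ _ (is_derive_rbump r m _) ds.
by apply: (is_derive_eq H); rewrite mulrN1.
Qed.

Lemma test_function_rbump (V : set R) r x : 0 < r ->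
  `[x - r, x + r] `<=` V -> test_function V (fun t => rbump r 0 (t - x)).
Proof.
move=> r0 V'.
have clV : closure [set t | rbump r 0 (t - x) != 0] `<=` `[x - r, x + r].
  rewrite (closure_id `[x - r, x + r]).1; last exact: itv_closed.
  apply: closure_subset => t /=; apply: contraR; rewrite in_itv/= => h.
  apply/eqP/rbump_eq0 => //; rewrite leNgt; apply: contra h.
  by rewrite ltr_distl => /andP[h1 h2]; rewrite !ltW.
split.
- move=> n t; rewrite derive1n_rbump_shift.
  exact: (@ex_derive _ _ _ _ _ _ _ (is_derive_rbump_shift r x n t)).
- apply: (subclosed_compact _ _ clV); first exact: closed_closure.
  exact: segment_compact.
- exact: subset_trans V'.
Qed.

End rbump.

(** * Integrals of powers near 0 and at infinity *)

Section power_integrals.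
Context {R : realType}.
Local Notation mu := (@lebesgue_measure R).

Lemma within_continuous_powR (i : interval R) (q : R) :
  (forall x : R, x \in i -> 0 < x) -> {within [set` i], continuous (@powR R ^~ q)}.
Proof.
move=> i0; apply: derivable_within_continuous => x /i0 xp.
by apply: derivable_powR; rewrite in_itv/= xp.
Qed.

Lemma powRN_cvgy (p : R) : 0 < p -> x `^ (- p) @[x --> +oo] --> (0 : R).
Proof.
move=> p0; apply/cvgrPdist_le => e e0.
near=> x; rewrite sub0r normrN ger0_norm ?powR_ge0//.
have x0 : 0 < x by near: x; exact: nbhs_pinfty_gt.
have h : e `^ (- p^-1) <= x by near: x; exact: nbhs_pinfty_ge.
have : (e `^ (- p^-1)) `^ p <= x `^ p.
  by rewrite ge0_ler_powR// ?nnegrE ?powR_ge0 ?ltW.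
rewrite -powRrM mulNr mulVf ?gt_eqF// !powRN powRr1 ?(ltW e0)//.
by rewrite -[leRHS]invrK lef_pV2 ?posrE ?invr_gt0// powR_gt0.
Unshelve. all: by end_near. Qed.

Lemma integral_powRN_itvcy (p d : R) : 0 < p -> 0 < d ->
  (\int[mu]_(x in `[d, +oo[) (x `^ (- (1 + p)))%:E = (d `^ (- p) / p)%:E)%E.
Proof.
move=> p0 d0; pose F (x : R) := - p^-1 * x `^ (- p).
have dF (x : R) : 0 < x -> is_derive x 1 F (x `^ (- (1 + p))).
  move=> x0; have H := is_deriveZ (- p^-1) (is_derive1_powR (- p) x0).
  apply: (is_derive_eq H); rewrite /GRing.scale/= mulrA mulrNN mulVf ?gt_eqF//.
  by rewrite mul1r opprD addrC.
rewrite (@ge0_continuous_FTC2y _ _ F d 0).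
- by rewrite /F -EFinB sub0r mulNr opprK mulrC.
- by move=> x _; exact: powR_ge0.
- by apply: within_continuous_powR => x; rewrite in_itv/= andbT => /(lt_le_trans d0).
- rewrite -(mulr0 (- p^-1)); apply: cvgM; first exact: cvg_cst.
  exact: powRN_cvgy.
- by move=> x dx; exact: (@ex_derive _ _ _ _ _ _ _ (dF x (lt_trans d0 dx))).
- apply: cvg_at_right_filter; apply/differentiable_continuous/derivable1_diffP.
  exact: (@ex_derive _ _ _ _ _ _ _ (dF d d0)).
- move=> x; rewrite in_itv/= andbT => dx; rewrite derive1E.
  exact: (@derive_val _ _ _ _ _ _ _ (dF x (lt_trans d0 dx))).
Qed.

Lemma integral_powR_itvcc (p a b : R) : 0 < p -> 0 < a -> a < b ->
  (\int[mu]_(x in `[a, b]) (x `^ (p - 1))%:E = ((b `^ p - a `^ p) / p)%:E)%E.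
Proof.
move=> p0 a0 ab; pose F (x : R) := p^-1 * x `^ p.
have dF (x : R) : 0 < x -> is_derive x 1 F (x `^ (p - 1)).
  move=> x0; have H := is_deriveZ p^-1 (is_derive1_powR p x0).
  apply: (is_derive_eq H); rewrite /GRing.scale/= mulrA mulVf ?gt_eqF//.
  by rewrite mul1r.
have cF (x : R) : 0 < x -> {for x, continuous F}.
  move=> x0; apply/differentiable_continuous/derivable1_diffP.
  exact: (@ex_derive _ _ _ _ _ _ _ (dF x x0)).
rewrite (@continuous_FTC2 _ _ F a b ab).
- by rewrite /F -EFinB -mulrBr mulrC.
- by apply: within_continuous_powR => x; rewrite in_itv/= => /andP[/(lt_le_trans a0)].
- split.
  + move=> x; rewrite in_itv/= => /andP[ax _].
    exact: (@ex_derive _ _ _ _ _ _ _ (dF x (lt_trans a0 ax))).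
  + by apply: cvg_at_right_filter; exact: cF.
  + by apply: cvg_at_left_filter; apply: cF; exact: lt_trans ab.
- move=> x; rewrite in_itv/= => /andP[ax _]; rewrite derive1E.
  exact: (@derive_val _ _ _ _ _ _ _ (dF x (lt_trans a0 ax))).
Qed.

(** For p < 1 the integrand is singular at 0, so the interval is exhausted by compact intervals that
    stay away from 0. The index [i.+2] keeps each of them nondegenerate. *)
Lemma integral_powR_itvoc (p d : R) : 0 < p -> 0 < d ->
  (\int[mu]_(x in `]0%R, d]) (x `^ (p - 1))%:E <= (d `^ p / p)%:E)%E.
Proof.
move=> p0 d0.
pose F i : set R := `[d / i.+2%:R, d]%classic.
have di0 i : 0 < d / i.+2%:R :> R by rewrite divr_gt0.
have FE : `]0%R, d]%classic = \bigcup_i F i.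
  apply/seteqP; split => x /=; rewrite in_itv/=.
    move=> /andP[x0 xd].
    exists (Num.truncn (d / x)) => //=; rewrite /F/= in_itv/= xd andbT.
    rewrite ler_pdivrMr// mulrC -ler_pdivrMr//.
    apply: ltW; apply: lt_le_trans (truncnS_gt _) _.
    by rewrite ler_nat.
  by move=> [i _]; rewrite /F/= in_itv/= => /andP[ix ->]; rewrite (lt_le_trans _ ix).
rewrite FE.
have hc : (\int[mu]_(x in F i) (x `^ (p - 1))%:E)%E @[i --> \oo] -->
    (\int[mu]_(x in \bigcup_i F i) (x `^ (p - 1))%:E)%E.
  apply: ge0_nondecreasing_set_cvg_integral.
  - move=> m n mn; apply/subsetPset => x; rewrite /F/= !in_itv/= => /andP[h1 ->].
    rewrite andbT (le_trans _ h1)// ler_pM2l// lef_pV2 ?posrE// ler_nat.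
    by rewrite !ltnS.
  - by move=> i; exact: measurable_itv.
  - by move=> i; apply/measurable_EFinP; apply: measurable_funTS.
  - by move=> i x _; rewrite lee_fin powR_ge0.
rewrite -(cvg_lim _ hc)//; apply: lime_le; first exact: cvgP hc.
apply: nearW => i /=; rewrite integral_powR_itvcc//; last first.
  by rewrite ltr_pdivrMr// ltr_pMr// ltr1n.
by rewrite lee_fin ler_pM2r ?invr_gt0// gerBl powR_ge0.
Qed.

End power_integrals.

Lemma ge0_le_integralT d (T : measurableType d) (R : realType)
    (m : {measure set T -> \bar R}) (f g : T -> \bar R) :
  measurable_fun setT f -> measurable_fun setT g ->
  (forall x, (0 <= f x)%E) -> (forall x, (f x <= g x)%E) ->
  (\int[m]_x f x <= \int[m]_x g x)%E.
Proof.
move=> mf mg f0 fg; by apply: ge0_le_integral.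
Qed.

Lemma Int_bounded_support (R : realType) (f : R -> R) (M a b : R) :
  measurable_fun setT f -> (forall x, `|f x| <= M) ->
  (forall x, ~~ (a <= x <= b) -> f x = 0) ->
  (@lebesgue_measure R).-integrable setT (EFin \o f).
Proof.
move=> mf fM f0.
apply: (@le_Int1 _ _ (fun x => M * \1_(`[a, b] : set R) x)) => //.
  move=> x; rewrite indicE mem_setE in_itv/=.
  by case: (boolP (a <= x <= b)) => [_|/f0 ->]; rewrite ?mulr1 ?normr0 ?mulr0.
by apply: IntZ; exact: integrable_indic_itv.
Qed.

Lemma Lfun2_of_integrable_sqr (R : realType) (f : R -> R) :
  measurable_fun setT f ->
  (@lebesgue_measure R).-integrable setT (EFin \o (fun x => f x ^+ 2)) ->
  f \in Lfun (@lebesgue_measure R) 2%:E.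
Proof.
move=> mf f2; rewrite inE; apply/andP; split; rewrite inE//=.
rewrite /finite_norm unlock; apply: poweR_lty.
under eq_integral do rewrite /= powR_mulrn// -normrX ger0_norm ?sqr_ge0//.
exact: integrable_lty f2.
Qed.

(** * The kernel and the Gagliardo seminorm; bumps lie in H^s *)

Section fractional.
Context {R : realType}.
Local Notation mu := (@lebesgue_measure R).
Local Notation Int f := (mu.-integrable setT (EFin \o f)).
Variable s : R.
Hypotheses (s0 : 0 < s) (s1 : s < 1).

(** Up to a Gamma factor, [kern (1 - a)] is the kernel of the Weyl integral I^a for a > 0. The
    exponents 1 - 2 s, 2 s - 1 and -1 below correspond to the orders 2 s, 2 - 2 s and 2, and 1 + 2 s
    to the formal order -2 s. Extension by 0 lets every integral run over the whole line. *)
Definition kern (p y : R) : R := if 0 < y then y `^ (- p) else 0.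

Lemma kern_ge0 p y : 0 <= kern p y.
Proof. by rewrite /kern; case: ifP => // _; exact: powR_ge0. Qed.

Lemma measurable_kern p : measurable_fun setT (kern p).
Proof.
apply: measurable_fun_ifT => //.
by apply: measurable_fun_ltr.
Qed.

Lemma gagliardoE (u : R -> R) : measurable_fun setT u ->
  gagliardo s u =
  (\int[mu]_h \int[mu]_x ((u x - u (x + h)) ^+ 2 / `|h| `^ (1 + 2 * s))%:E)%E.
Proof.
move=> mu'.
pose G (p : measurableTypeR R * measurableTypeR R) : \bar R :=
  ((u p.1 - u (p.1 + p.2)) ^+ 2 / `|p.2| `^ (1 + 2 * s))%:E.
have mG : measurable_fun setT G.
  apply/measurable_EFinP; apply: measurable_funM.
    apply: measurable_funX; apply: measurable_funB.
      exact: measurableT_comp.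
    by apply: (measurableT_comp mu'); exact: measurable_funD.
  under eq_fun do rewrite -powRN.
  apply: (measurableT_comp (measurable_powR _)).
  by apply: measurableT_comp => //; exact: measurableT_comp.
have G0 p : (0 <= G p)%E by rewrite lee_fin divr_ge0 ?sqr_ge0 ?powR_ge0.
rewrite -(@fubini_tonelli _ _ _ _ _ mu mu G mG G0).
apply: eq_integral => x _.
have mGx : measurable_fun setT (fun y => ((u x - u y) ^+ 2 / `|x - y| `^ (1 + 2 * s))%:E).
  apply/measurable_EFinP; apply: measurable_funM.
    by apply: measurable_funX; exact: measurable_funB.
  under eq_fun do rewrite -powRN.
  apply: (measurableT_comp (measurable_powR _)).
  by apply: measurableT_comp => //; exact: measurable_funB.
rewrite -(ge0_integral_shift x mGx); last first.
  by move=> y; rewrite lee_fin divr_ge0 ?sqr_ge0 ?powR_ge0.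
apply: eq_integral => h _; rewrite /G/= [h + x]addrC; congr (_ / _ `^ _)%:E.
by rewrite opprD addNKr normrN.
Qed.

Lemma gagliardo_kern (u : R -> R) : measurable_fun setT u ->
  (gagliardo s u < +oo)%E ->
  (\int[mu]_y \int[mu]_x ((u x - u (x + y)) ^+ 2 * kern (1 + 2 * s) y)%:E
    < +oo)%E.
Proof.
move=> mu'; rewrite (gagliardoE mu') => h; apply: le_lt_trans h.
have mS : measurable_fun setT
   (fun p : measurableTypeR R * measurableTypeR R => (u p.2 - u (p.2 + p.1)) ^+ 2).
  apply: measurable_funX; apply: measurable_funB; first exact: measurableT_comp.
  by apply: (measurableT_comp mu'); exact: measurable_funD.
apply: ge0_le_integralT.
- apply: (measurable_fun_fubini_tonelli_F
    (fun p : measurableTypeR R * measurableTypeR R =>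
     ((u p.2 - u (p.2 + p.1)) ^+ 2 * kern (1 + 2 * s) p.1)%:E)).
    apply/measurable_EFinP; apply: measurable_funM => //.
    by apply: (measurableT_comp (measurable_kern _)).
  by move=> p; rewrite lee_fin mulr_ge0 ?sqr_ge0// kern_ge0.
- apply: (measurable_fun_fubini_tonelli_F
    (fun p : measurableTypeR R * measurableTypeR R =>
     ((u p.2 - u (p.2 + p.1)) ^+ 2 / `|p.1| `^ (1 + 2 * s))%:E)).
    apply/measurable_EFinP; apply: measurable_funM => //.
    under eq_fun do rewrite -powRN.
    apply: (measurableT_comp (measurable_powR _)).
    by apply: measurableT_comp => //; exact: measurableT_comp.
  by move=> p; rewrite lee_fin divr_ge0 ?sqr_ge0 ?powR_ge0.
- move=> y; apply: integral_ge0 => x _.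
  by rewrite lee_fin mulr_ge0 ?sqr_ge0// kern_ge0.
- move=> y; apply: ge0_le_integralT.
  + apply/measurable_EFinP; apply: measurable_funM => //.
    by apply: measurable_funX; apply: measurable_funB => //;
      apply: (measurableT_comp mu'); exact: measurable_funD.
  + apply/measurable_EFinP; apply: measurable_funM => //.
    by apply: measurable_funX; apply: measurable_funB => //;
      apply: (measurableT_comp mu'); exact: measurable_funD.
  + by move=> x; rewrite lee_fin mulr_ge0 ?sqr_ge0// kern_ge0.
  + move=> x; rewrite lee_fin ler_wpM2l ?sqr_ge0// /kern.
    case: ifPn => [y0|_]; last by rewrite invr_ge0 powR_ge0.
    by rewrite powRN gtr0_norm.
Qed.

(** For small h the Lipschitz bound gives h^2 / h^(1+2s), integrable at 0 because s < 1; for large h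
    boundedness gives h^-(1+2s), integrable at infinity because s > 0. *)
Definition hs_weight (h : R) : R :=
  if 0 < h then if h <= 1 then h `^ (2 - 2 * s - 1) else h `^ (- (1 + 2 * s)) else 0.

Lemma hs_weight_ge0 h : 0 <= hs_weight h.
Proof. by rewrite /hs_weight; case: ifP => // _; case: ifP => _; exact: powR_ge0. Qed.

Lemma measurable_hs_weight : measurable_fun setT hs_weight.
Proof.
apply: measurable_fun_ifT => //; first by apply: measurable_fun_ltr.
by apply: measurable_fun_ifT => //; apply: measurable_fun_ler.
Qed.

Lemma integral_hs_weight_lty : (\int[mu]_h (hs_weight h)%:E < +oo)%E.
Proof.
have p1 : 0 < 2 - 2 * s by move: s1; lra.
have p2 : 0 < 2 * s by move: s0; lra.
pose a := (fun h : R => (h `^ (2 - 2 * s - 1))%:E) \_ `]0%R, 1].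
pose b := (fun h : R => (h `^ (- (1 + 2 * s)))%:E) \_ `[1%R, +oo[.
have a0 h : (0 <= a h)%E by rewrite /a patchE; case: ifP => // _; rewrite lee_fin powR_ge0.
have b0 h : (0 <= b h)%E by rewrite /b patchE; case: ifP => // _; rewrite lee_fin powR_ge0.
have ma : measurable_fun setT a.
  by apply/measurable_restrict => //; apply/measurable_EFinP; exact: measurable_funTS.
have mb : measurable_fun setT b.
  by apply/measurable_restrict => //; apply/measurable_EFinP; exact: measurable_funTS.
apply: (@le_lt_trans _ _ (\int[mu]_h (a h + b h))%E).
  apply: ge0_le_integralT.
  - by apply/measurable_EFinP; exact: measurable_hs_weight.
  - exact: emeasurable_funD.
  - by move=> h; rewrite lee_fin hs_weight_ge0.
  - move=> h; rewrite /hs_weight; case: ifPn => [h0|_]; last by rewrite adde_ge0.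
    have [h1|h1] := leP h 1.
      by rewrite /a patchE mem_set/= ?in_itv/= ?h0// leeDl.
    by rewrite addeC /b patchE mem_set/= ?in_itv/= ?andbT ?(ltW h1)// leeDl.
rewrite ge0_integralD// /a /b -!integral_mkcond.
apply: lte_add_pinfty.
  by apply: le_lt_trans (integral_powR_itvoc p1 ltr01) _; rewrite ltry.
by rewrite integral_powRN_itvcy// ltry.
Qed.

(** A difference v x - v (x + h) vanishes unless x or x + h lies in the supporting interval. The
    factor J x + J (x + h) records this and integrates to 2 (r + r) in x, which leaves [hs_weight]
    to be integrated in h. *)
Lemma Lipschitz_gagliardo (v : R -> R) (c r M L : R) :
  measurable_fun setT v -> 0 < r -> (forall x, `|v x| <= M) ->
  (forall x y, `|v x - v y| <= L * `|x - y|) ->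
  (forall x, r <= `|x - c| -> v x = 0) -> (gagliardo s v < +oo)%E.
Proof.
move=> mv r0 vM vL vr; rewrite gagliardoE//.
have M0 : 0 <= M by exact: le_trans (normr_ge0 _) (vM 0).
pose C := Num.max (L ^+ 2) ((2 * M) ^+ 2).
have C0 : 0 <= C by rewrite le_max sqr_ge0.
pose J (x : R) : R := \1_(`[c - r, c + r] : set R) x.
have J1 x : J x = ((c - r <= x <= c + r)%R)%:R.
  by rewrite /J indicE; congr (_%:R); rewrite mem_setE in_itv.
have mJ : measurable_fun setT J by exact: measurable_indic.
have J0 x : 0 <= J x by rewrite J1.
have intJ : (\int[mu]_x (J x)%:E = (r + r)%:E)%E.
  rewrite /J integral_indic// setIT; transitivity (mu `[c - r, c + r]); first by [].
  rewrite lebesgue_measure_itv/= lte_fin.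
  by rewrite ifT ?EFinN -?EFinD; [congr _%:E; ring|lra].
have key x h : (v x - v (x + h)) ^+ 2 / `|h| `^ (1 + 2 * s) <=
    C * (hs_weight h + hs_weight (- h)) * (J x + J (x + h)).
  have J01 : 0 <= J x + J (x + h) by rewrite addr_ge0.
  have R0 : 0 <= C * (hs_weight h + hs_weight (- h)) * (J x + J (x + h)).
    by rewrite !mulr_ge0// addr_ge0// hs_weight_ge0.
  have [h0|h0] := eqVneq h 0.
    by apply: le_trans R0; rewrite h0 addr0 subrr expr0n mul0r.
  have psiE : hs_weight h + hs_weight (- h) =
      if `|h| <= 1 then `|h| `^ (2 - 2 * s - 1) else `|h| `^ (- (1 + 2 * s)).
    rewrite /hs_weight; move: h0; rewrite neq_lt => /orP[h0|h0].
      by rewrite oppr_gt0 h0 ltNge (ltW h0)/= add0r ltr0_norm.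
    by rewrite h0 oppr_gt0 [h < 0]ltNge (ltW h0)/= addr0 gtr0_norm.
  have hp : 0 < `|h| by rewrite normr_gt0.
  have [Jx|Jx] := boolP ((c - r <= x <= c + r) || (c - r <= x + h <= c + r)); last first.
    move: Jx; rewrite negb_or => /andP[Jx Jxh].
    have vo y : ~~ (c - r <= y <= c + r) -> v y = 0.
      move=> hy; apply: vr; rewrite leNgt; apply: contra hy.
      by rewrite ltr_distl => /andP[? ?]; rewrite !ltW.
    by apply: le_trans R0; rewrite !vo// subrr expr0n mul0r.
  have J1' : 1 <= J x + J (x + h).
    by rewrite !J1; move: Jx => /orP[] ->; rewrite ?lerDl ?lerDr.
  rewrite -[leLHS]mulr1 ler_pM// ?divr_ge0 ?sqr_ge0 ?powR_ge0//.
  rewrite psiE; case: ifPn => h1.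
    apply: (@le_trans _ _ (L ^+ 2 * `|h| ^+ 2 / `|h| `^ (1 + 2 * s))).
      rewrite ler_wpM2r ?invr_ge0 ?powR_ge0// -exprMn.
      have := vL x (x + h); rewrite opprD addNKr normrN => hL.
      by rewrite -real_normK ?num_real// lerXn2r ?nnegrE ?(le_trans _ hL).
    have -> : L ^+ 2 * `|h| ^+ 2 / `|h| `^ (1 + 2 * s) =
        L ^+ 2 * `|h| `^ (2 - 2 * s - 1).
      rewrite -mulrA -[`|h| ^+ 2]powR_mulrn// -powRB ?(gt_eqF hp) ?implybT//.
      by congr (_ * _ `^ _); ring.
    by rewrite ler_wpM2r ?powR_ge0// le_max lexx.
  rewrite -powRN ler_wpM2r ?powR_ge0//.
  apply: (@le_trans _ _ ((2 * M) ^+ 2)); last by rewrite le_max lexx orbT.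
  rewrite -real_normK ?num_real// lerXn2r ?nnegrE ?mulr_ge0//.
  rewrite (le_trans (ler_normB _ _))//.
  by have := vM x; have := vM (x + h); lra.
pose B h := 2 * (r + r) * C * (hs_weight h + hs_weight (- h)).
have iB : Int B.
  have iw : Int hs_weight.
    apply/integrableP; split.
      by apply/measurable_EFinP; exact: measurable_hs_weight.
    under eq_integral => h _ do rewrite /= ger0_norm ?hs_weight_ge0//.
    exact: integral_hs_weight_lty.
  apply: IntZ; apply: IntD => //.
  have := @integrable_affine _ (-1) 0 _ _ iw; rewrite oppr_eq0 oner_eq0 => /(_ isT).
  by apply: eq_integrable => // h _ /=; rewrite addr0 mulN1r.
apply: le_lt_trans (integrable_lty measurableT iB).
have mSS : measurable_fun setT (fun p : measurableTypeR R * measurableTypeR R =>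
    ((v p.2 - v (p.2 + p.1)) ^+ 2 / `|p.1| `^ (1 + 2 * s))%:E).
  apply/measurable_EFinP; apply: measurable_funM.
    apply: measurable_funX; apply: measurable_funB; first exact: measurableT_comp.
    by apply: (measurableT_comp mv); exact: measurable_funD.
  under eq_fun do rewrite -powRN.
  apply: (measurableT_comp (measurable_powR _)).
  by apply: measurableT_comp => //; exact: measurableT_comp.
have G0 x h : 0 <= (v x - v (x + h)) ^+ 2 / `|h| `^ (1 + 2 * s).
  by rewrite divr_ge0 ?sqr_ge0 ?powR_ge0.
apply: ge0_le_integralT.
- apply: (measurable_fun_fubini_tonelli_F _ mSS) => p.
  by rewrite lee_fin G0.
- exact: (measurable_int _ iB).
- by move=> h; apply: integral_ge0 => x _; rewrite lee_fin G0.
- move=> h; have h2 : measurable_fun setT (fun x => J x + J (x + h)).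
    apply: measurable_funD => //; apply: (measurableT_comp mJ).
    exact: measurable_funD.
  apply: (@le_trans _ _ (\int[mu]_x
      (C * (hs_weight h + hs_weight (- h)) * (J x + J (x + h)))%:E)%E).
    apply: ge0_le_integralT.
    + exact: (measurableT_comp mSS (measurable_pair1 _)).
    + by apply/measurable_EFinP; apply: measurable_funM.
    + by move=> x; rewrite lee_fin G0.
    + by move=> x; rewrite lee_fin key.
  under eq_integral do rewrite EFinM.
  rewrite ge0_integralZl_EFin//; last 3 first.
  - by move=> x _; rewrite lee_fin addr_ge0.
  - exact/measurable_EFinP.
  - by rewrite mulr_ge0// addr_ge0// hs_weight_ge0.
  under eq_integral do rewrite EFinD.
  have mJE : measurable_fun setT (fun x => (J x)%:E) by exact/measurable_EFinP.
  have J0E x : (0 <= (J x)%:E)%E by rewrite lee_fin.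
  rewrite ge0_integralD//; last first.
    by apply/measurable_EFinP; apply: (measurableT_comp mJ); exact: measurable_funD.
  rewrite (ge0_integral_shift h mJE J0E) !intJ -EFinD -EFinM lee_fin /B.
  by rewrite le_eqVlt; apply/orP; left; apply/eqP; ring.
Qed.

Lemma rbump_Hs (r c : R) : 0 < r -> Hs s (fun t => rbump r 0 (t - c)).
Proof.
move=> r0; have [M M0 bM] := bounded_rbump 0 r0.
have [L L0 bL] := bounded_rbump 1 r0.
have mv : measurable_fun setT (fun t : R => rbump r 0 (t - c)).
  by apply: (measurableT_comp (@measurable_rbump _ r 0)); exact: measurable_funB.
have v0 x : r <= `|x - c| -> rbump r 0 (x - c) = 0 by exact: rbump_eq0.
split.
  apply: Lfun2_of_integrable_sqr => //.
  apply: (@Int_bounded_support _ _ 1 (c - r) (c + r)).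
  - exact: measurable_funX.
  - by move=> x; rewrite normrX expr_le1// ger0_norm ?rbump_ge0// rbump_le1.
  - move=> x hx; rewrite v0 ?expr0n// leNgt; apply: contra hx.
    by rewrite ltr_distl => /andP[? ?]; rewrite !ltW.
apply: (@Lipschitz_gagliardo _ c r M L) => // x y.
have H a b : a < b -> `|rbump r 0 (a - c) - rbump r 0 (b - c)| <= L * `|a - b|.
  move=> ab.
  have cv : {within `[a, b], continuous (fun t : R => rbump r 0 (t - c))}.
    apply: derivable_within_continuous => t _.
    exact: (@ex_derive _ _ _ _ _ _ _ (is_derive_rbump_shift r c 0 t)).
  have [z _ hz] := MVT ab (fun t _ => is_derive_rbump_shift r c 0 t) cv.
  by rewrite distrC hz normrM [`|a - b|]distrC ler_wpM2r.
have [xy|xy|->] := ltgtP x y.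
- exact: H.
- by rewrite distrC [`|x - y|]distrC; exact: H.
- by rewrite !subrr normr0 mulr0.
Qed.

Lemma rbump_Hs_tilde (V : set R) (r c : R) : 0 < r -> `[c - r, c + r] `<=` V ->
  Hs_tilde s V (fun t => rbump r 0 (t - c)).
Proof.
move=> r0 rV; split; first exact: rbump_Hs.
move=> e e0; exists (fun t => rbump r 0 (t - c)); first exact: test_function_rbump.
rewrite /Hs_norm /gagliardo.
under eq_integral do rewrite /= subrr expr0n.
rewrite integral0 add0e.
under eq_integral do under eq_integral do rewrite /= !subrr expr0n mul0r.
under eq_integral do rewrite integral0.
by rewrite integral0 /= sqrtr0.
Qed.

End fractional.

(** * Mollification of the equation *)

Section mollification.
Context {R : realType}.
Local Notation mu := (@lebesgue_measure R).
Local Notation Int f := (mu.-integrable setT (EFin \o f)).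

(** Formally (-1)^m times the m-th derivative of the mollification, as the bump depends on z - x.
    There is no division by the mass of the bump: the equation is linear, and the mass matters only
    in the limit of small r. *)
Definition mollify (m : nat) (r : R) (w : R -> R) (x : R) : R :=
  \int[mu]_z (w z * rbump r m (z - x)).

Lemma aeS (P Q : R -> Prop) : {ae mu, forall x, P x} ->
  (forall x, P x -> Q x) -> {ae mu, forall x, Q x}.
Proof.
by move=> aP PQ; apply: (@filterS _ _ (ae_filter_ringOfSetsType mu) _ _ PQ aP).
Qed.

Lemma aeI (P Q : R -> Prop) : {ae mu, forall x, P x} -> {ae mu, forall x, Q x} ->
  {ae mu, forall x, P x /\ Q x}.
Proof. exact: (@filterI _ _ (ae_filter_ringOfSetsType mu)). Qed.

Lemma ae_eq_Rintegral (f g : R -> R) : measurable_fun setT f ->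
  measurable_fun setT g -> {ae mu, forall x, f x = g x} ->
  \int[mu]_x f x = \int[mu]_x g x.
Proof.
move=> mf mg fg; congr fine.
apply: (@ae_eq_integral _ (measurableTypeR R) _ mu setT) => //.
- exact/measurable_EFinP.
- exact/measurable_EFinP.
- by apply: (aeS fg) => x ->.
Qed.

Lemma measurable_of_integrable (w : R -> R) : Int w -> measurable_fun setT w.
Proof. by move=> /measurable_int /measurable_EFinP. Qed.

Lemma Rintegral_itv_indic (a b : R) : a <= b ->
  \int[mu]_x (\1_(`[a, b] : set R) x) = b - a.
Proof.
move=> ab; rewrite /Rintegral integral_indic// setIT.
transitivity (fine (mu `[a, b])); first by [].
rewrite lebesgue_measure_itv/= lte_fin; move: ab; rewrite le_eqVlt.
by move=> /predU1P[->|ab]; rewrite ?ltxx ?subrr// ab -EFinD.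
Qed.

Section pairing.
Variables (w phi : R -> R) (B a b : R).
Hypotheses (mw : measurable_fun setT w) (w2 : Int (fun z => w z ^+ 2)).
Hypotheses (mphi : measurable_fun setT phi) (phiB : forall z, `|phi z| <= B).
Hypotheses (ab : a <= b) (phi0 : forall z, ~~ (a <= z <= b) -> phi z = 0).

(** On [a, b], |w| <= w^2 + 1 takes the place of the Cauchy-Schwarz inequality. The resulting bound
    depends only on the length of [a, b], hence is uniform over translates of a bump. *)
Let bound z := B * (w z ^+ 2 + \1_(`[a, b] : set R) z).

Let ibound : Int bound.
Proof. by apply: IntZ; apply: IntD => //; exact: integrable_indic_itv. Qed.

Let B0 : 0 <= B. Proof. exact: le_trans (normr_ge0 _) (phiB 0). Qed.

Let le_bound z : `|w z * phi z| <= bound z.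
Proof.
rewrite /bound indicE mem_setE in_itv/= normrM.
case: (boolP (a <= z <= b)) => [_|/phi0 ->]; last first.
  by rewrite normr0 mulr0 addr0 mulr_ge0// sqr_ge0.
rewrite mulrC ler_pM//.
have : 0 <= (`|w z| - 1) ^+ 2 by exact: sqr_ge0.
rewrite -[w z ^+ 2]real_normK ?num_real//.
by move: (`|w z|) (normr_ge0 (w z)) => t t0 ht /=; rewrite mulr1n; nra.
Qed.

Lemma integrable_pairing : Int (fun z => w z * phi z).
Proof. by apply: le_Int1 ibound; [exact: measurable_funM|exact: le_bound]. Qed.

Lemma le_pairing :
  `|\int[mu]_z (w z * phi z)| <= B * (\int[mu]_z (w z ^+ 2) + (b - a)).
Proof.
have iw := integrable_pairing.
apply: (le_trans (le_normr_Rintegral measurableT iw)).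
rewrite -Rintegral_itv_indic// -RintegralD//; last exact: integrable_indic_itv.
rewrite -RintegralZl//; last by apply: IntD => //; exact: integrable_indic_itv.
apply: le_Rintegral => //; first exact: integrable_norm.
Qed.

End pairing.

Lemma measurable_rbump_shift r m (x : R) :
  measurable_fun setT (fun z : R => rbump r m (z - x)).
Proof.
by apply: (measurableT_comp (@measurable_rbump _ r m)); exact: measurable_funB.
Qed.

Lemma rbump_shift_eq0 (r x z : R) m : 0 < r -> ~~ (x - r <= z <= x + r) ->
  rbump r m (z - x) = 0.
Proof.
move=> r0 hz; rewrite rbump_eq0// leNgt; apply: contra hz.
by rewrite ltr_distl => /andP[? ?]; rewrite !ltW.
Qed.

Lemma rbump_Lipschitz (r : R) m : 0 < r ->
  exists2 L : R, 0 < L & forall x y, `|rbump r m x - rbump r m y| <= L * `|x - y|.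
Proof.
move=> r0; have [L L0 bL] := bounded_rbump m.+1 r0.
exists L => // x y.
have H (a b : R) : a < b -> `|rbump r m a - rbump r m b| <= L * `|a - b|.
  move=> ab.
  have cv : {within `[a, b], continuous (rbump r m)}.
    by apply: continuous_subspaceT => t; exact: continuous_rbump.
  have [z _ hz] := MVT ab (fun t _ => is_derive_rbump r m t) cv.
  by rewrite distrC hz normrM [`|a - b|]distrC ler_wpM2r.
have [xy|xy|->] := ltgtP x y.
- exact: H.
- by rewrite distrC [`|x - y|]distrC; exact: H.
- by rewrite !subrr normr0 mulr0.
Qed.

Section mollify_square_integrable.
Variables (r : R) (w : R -> R).
Hypotheses (r0 : 0 < r) (mw : measurable_fun setT w).
Hypothesis (w2 : Int (fun z => w z ^+ 2)).

Lemma integrable_mollify m x : Int (fun z => w z * rbump r m (z - x)).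
Proof.
have [M M0 bM] := bounded_rbump m r0.
apply: (@integrable_pairing _ _ M (x - r) (x + r)) => //.
- exact: measurable_rbump_shift.
- by move=> z; exact: rbump_shift_eq0.
Qed.

Lemma mollify_bounded m : exists2 C : R, 0 < C & forall x, `|mollify m r w x| <= C.
Proof.
have [M M0 bM] := bounded_rbump m r0.
exists (M * (\int[mu]_z (w z ^+ 2) + (r + r)) + 1).
  rewrite ltr_wpDl// mulr_ge0 ?ltW// ltr_wpDl// ?addr_gt0//.
  by apply: Rintegral_ge0 => z _; exact: sqr_ge0.
move=> x; apply: (@le_trans _ _ (M * (\int[mu]_z (w z ^+ 2) + (x + r - (x - r))))).
  apply: le_pairing => //.
  - exact: measurable_rbump_shift.
  - by move: r0; lra.
  - by move=> z; exact: rbump_shift_eq0.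
rewrite (_ : x + r - (x - r) = r + r); last by ring.
by rewrite lerDl.
Qed.

Lemma continuous_mollify m : continuous (mollify m r w).
Proof.
move=> x; have [L L0 hL] := rbump_Lipschitz m r0.
(* For |x - y| <= 1 both bumps are supported in [x - r - 1, x + r + 1], of length r + r + 1 + 1, and
   their difference is at most L |x - y|. *)
pose K := L * (\int[mu]_z (w z ^+ 2) + (r + r + 1 + 1)).
have i0 : 0 <= \int[mu]_z (w z ^+ 2) by apply: Rintegral_ge0 => z _; exact: sqr_ge0.
have K0 : 0 < K by rewrite mulr_gt0// ltr_wpDl//; move: r0; lra.
apply/cvgrPdist_le => e e0.
have eK0 : 0 < e / K by rewrite divr_gt0.
near=> y.
have xy1 : `|x - y| <= 1 by near: y; apply: cvgr_dist_le.
have xyK : `|x - y| <= e / K by near: y; apply: cvgr_dist_le.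
rewrite /mollify -RintegralB//; [|exact: integrable_mollify..].
under eq_Rintegral do rewrite -mulrBr.
apply: (@le_trans _ _ (L * `|x - y| * (\int[mu]_z (w z ^+ 2) + (x + r + 1 - (x - r - 1))))).
  apply: le_pairing => //.
  - by apply: measurable_funB; exact: measurable_rbump_shift.
  - move=> z; apply: le_trans (hL _ _) _; rewrite distrC.
    by rewrite (_ : z - y - (z - x) = x - y)//; ring.
  - by move: r0; lra.
  - move=> z hz; rewrite !rbump_shift_eq0// ?subrr//.
      apply: contra hz => /andP[h1 h2].
      move: xy1; rewrite ler_norml => /andP[h3 h4].
      by apply/andP; split; lra.
    apply: contra hz => /andP[h1 h2]; apply/andP; split; lra.
rewrite (_ : x + r + 1 - (x - r - 1) = r + r + 1 + 1); last by ring.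
by rewrite -mulrA mulrCA -/K -ler_pdivlMr.
Unshelve. all: by end_near. Qed.

Lemma measurable_mollify m : measurable_fun setT (mollify m r w).
Proof. by apply: continuous_measurable_fun => x; exact: continuous_mollify. Qed.

End mollify_square_integrable.

Lemma mollify_eq0 (r : R) (w : R -> R) m x : 0 < r -> measurable_fun setT w ->
  ae_eq_on `]x - r, x + r[ w (cst 0) -> mollify m r w x = 0.
Proof.
move=> r0 mw w0; rewrite /mollify.
rewrite (@ae_eq_Rintegral _ (cst 0)).
- by rewrite /Rintegral integral0.
- by apply: measurable_funM => //; exact: measurable_rbump_shift.
- exact: measurable_cst.
- apply: (aeS w0) => z hz /=.
  have [zr|zr] := ltP `|z - x| r; last by rewrite rbump_eq0// mulr0.
  by rewrite hz ?mul0r//= in_itv/= -ltr_distl.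
Qed.

End mollification.

Section equation.
Context {R : realType}.
Local Notation mu := (@lebesgue_measure R).
Local Notation Int f := (mu.-integrable setT (EFin \o f)).
Variables (s : R) (Om : set R) (q u w : R -> R).
Hypotheses (s0 : 0 < s) (s1 : s < 1).
Hypothesis (wHs : Hs s w).
Hypotheses (wu : ae_eq_on (add_pos Om) w u) (u_sol : weak_solution s Om q u).

Let mw : measurable_fun setT w.
Proof. by case: wHs => /sub_Lfun_mfun + _; rewrite inE. Qed.

Let w2 : Int (fun z => w z ^+ 2).
Proof. by case: wHs => /Lfun2_integrable_sqr. Qed.

Variables (r x : R).
Hypotheses (r0 : 0 < r) (xOm : `[x - r, x + r] `<=` Om).

Let v t := rbump r 0 (t - x).

Let mv : measurable_fun setT v. Proof. exact: measurable_rbump_shift. Qed.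

Let vHs : Hs s v. Proof. exact: rbump_Hs. Qed.

(** Translating the test bump by y moves its centre to x + y, so the correlations of w with v are
    values of one mollification. *)
Let corrE y : \int[mu]_z (w z * v (z - y)) = mollify 0 r w (x + y).
Proof.
by apply: eq_Rintegral => z _; rewrite /v opprD addrA (addrAC z).
Qed.

Let gk (f : R -> R) : measurable_fun setT f -> Hs s f ->
  (\int[mu]_y \int[mu]_x ((f x - f (x + y)) ^+ 2 * kern (1 + 2 * s) y)%:E
    < +oo)%E.
Proof. by move=> mf [_ fs]; exact: gagliardo_kern. Qed.

Let v2 : Int (fun z => v z ^+ 2).
Proof. by case: vHs => /Lfun2_integrable_sqr. Qed.

Lemma mollified_equation : (2 - 2 `^ (2 * s))^-1 *
  \int[mu]_y (kern (1 + 2 * s) y *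
   (mollify 0 r w x - 2 * mollify 0 r w (x + y) + mollify 0 r w (x + 2 * y))) +
  mollify 0 r (fun z => (q \_ Om) z * w z) x = 0.
Proof.
have := u_sol wHs wu (rbump_Hs_tilde s0 s1 r0 xOm).
rewrite /Bform => <-; congr (_ * _ + _).
  have := Rintegral_second_difference (measurable_kern _)
    (kern_ge0 (1 + 2 * s)) mw mv w2 v2 (gk mw wHs) (gk mv vHs).
  under [in RHS]eq_Rintegral do rewrite !corrE addr0.
  move=> <-; apply: eq_Rintegral => z _; rewrite [RHS]Rintegral_mkcond.
  apply: eq_Rintegral => y _; rewrite patchE /kern.
  case: ifPn => y0; last by rewrite mulr0 memNset//= in_itv/= andbT; exact/negP.
  by rewrite mem_set ?powRN//= in_itv/= andbT.
rewrite [RHS]Rintegral_mkcond; apply: eq_Rintegral => z _.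
by rewrite !patchE; case: ifP => //; rewrite !mul0r.
Qed.

End equation.

(** * Unique continuation to the right *)

Section moments.
Context {R : realType}.
Local Notation mu := (@lebesgue_measure R).
Local Notation Int f := (mu.-integrable setT (EFin \o f)).

Lemma Int_restrict (D : set R) (g : R -> R) : measurable D -> Int g ->
  mu.-integrable D (EFin \o g).
Proof.
by move=> mD; exact: (@integrableS _ (measurableTypeR R) _ mu setT D _ measurableT mD).
Qed.

Lemma IntZ_on (D : set R) (k : R) (g : R -> R) : measurable D ->
  mu.-integrable D (EFin \o g) -> mu.-integrable D (EFin \o (fun x => k * g x)).
Proof.
move=> mD gi; have := @integrableZl _ (measurableTypeR R) _ mu D mD k _ gi.
by apply: eq_integrable.
Qed.

Lemma IntD_on (D : set R) (g h : R -> R) : measurable D ->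
  mu.-integrable D (EFin \o g) -> mu.-integrable D (EFin \o h) ->
  mu.-integrable D (EFin \o (fun x => g x + h x)).
Proof.
move=> mD gi hi; have := @integrableD _ (measurableTypeR R) _ mu D mD _ _ gi hi.
by apply: eq_integrable.
Qed.

Lemma le_Int_on (D : set R) (g h : R -> R) : measurable D ->
  measurable_fun D g -> (forall x, D x -> `|g x| <= h x) ->
  mu.-integrable D (EFin \o h) -> mu.-integrable D (EFin \o g).
Proof.
move=> mD mg gh; apply: (@le_integrable _ (measurableTypeR R) _ mu D mD).
  exact/measurable_EFinP.
by move=> x Dx; rewrite /= lee_fin (le_trans (gh x Dx))// ler_norm.
Qed.

Lemma integrable_powRN_itvoy (q x b : R) : 1 < q -> x < b ->
  mu.-integrable `]b, +oo[ (EFin \o (fun z => (z - x) `^ (- q))).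
Proof.
move=> q1 xb; have q0 : 0 < q - 1 by lra.
have d0 : 0 < b - x by lra.
pose g := (fun z : R => (z `^ (- q))) \_ `[b - x, +oo[.
have ig : Int g.
  apply/integrableP; split.
    apply/measurable_EFinP/measurable_restrict => //.
    exact: measurable_funTS.
  have -> : (\int[mu]_z `|(EFin \o g) z| =
      \int[mu]_(z in `[(b - x)%R, +oo[) (z `^ (- (1 + (q - 1))))%:E)%E.
    rewrite [RHS]integral_mkcond; apply: eq_integral => z _.
    rewrite /g /= !patchE; case: ifP => _; last by rewrite normr0.
    by rewrite ger0_norm ?powR_ge0// addrC subrK.
  by rewrite integral_powRN_itvcy// ltry.
have mB : measurable (`]b, +oo[ : set R) by exact: measurable_itv.
have iS := Int_restrict mB (integrable_shift (- x) ig).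
apply: eq_integrable iS => // z; rewrite inE/= in_itv/= andbT => bz.
by rewrite /g patchE mem_set//= in_itv/= andbT; lra.
Qed.

Section vanishing.
Variables (f : R -> R) (a b M : R).
Hypotheses (cf : continuous f) (fM : forall z, `|f z| <= M).

Let B : set R := `]b, +oo[.
Let mB : measurable B. Proof. exact: measurable_itv. Qed.
Let mf : measurable_fun B f.
Proof. by apply: measurable_funTS; exact: continuous_measurable_fun. Qed.
Let M0 : 0 <= M. Proof. exact: le_trans (normr_ge0 _) (fM 0). Qed.

Let mpow (x q : R) : measurable_fun B (fun z : R => (z - x) `^ (- q)).
Proof.
apply: measurable_funTS.
apply: (measurableT_comp (measurable_powR (- q))); exact: measurable_funB.
Qed.

Let ifpow (x q : R) : 1 < q -> x < b ->
  mu.-integrable B (EFin \o (fun z => f z * (z - x) `^ (- q))).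
Proof.
move=> q1 xb.
apply: (@le_Int_on _ _ (fun z => M * (z - x) `^ (- q))) => //.
- by apply: measurable_funM; [exact: mf|exact: mpow].
- move=> z _; rewrite !normrM (ger0_norm (powR_ge0 _ _)).
  by rewrite ler_wpM2r ?powR_ge0.
- exact: IntZ_on (integrable_powRN_itvoy q1 xb).
Qed.

Let is_derive_pow (z x q : R) : x < z ->
  is_derive x 1 (fun x => (z - x) `^ (- q)) (q * (z - x) `^ (- (q + 1))).
Proof.
move=> xz; have ds : is_derive x 1 (fun t : R => z - t) (- 1).
  by apply: is_derive_eq; rewrite add0r mul1r.
have zx : 0 < z - x by rewrite subr_gt0.
have H := @is_derive1_comp _ (fun t : R => t `^ (- q)) (fun t => z - t) x _ _
  (is_derive1_powR (- q) zx) ds.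
apply: (is_derive_eq H); rewrite mulrN1 mulNr opprK.
by rewrite opprD.
Qed.

Let vanishing_next (q : R) : 1 < q ->
  (forall x, a < x < b -> \int[mu]_(z in B) (f z * (z - x) `^ (- q)) = 0) ->
  (forall x, a < x < b -> \int[mu]_(z in B) (f z * (z - x) `^ (- (q + 1))) = 0).
Proof.
move=> q1 F0 x /andP[ax xb].
have q0 : 0 < q by lra.
(* Differentiation takes place on ]a, v[ with v strictly below b: the singularity stays away from B,
   and (z - v)^-(q+1) dominates for all base points at once. *)
pose v := (x + b) / 2; have xv : x < v by rewrite /v; lra.
have vb : v < b by rewrite /v; lra.
pose F x z := f z * (z - x) `^ (- q).
have dF (y z : R) : y < z -> is_derive y 1 (F^~ z) (f z * (q * (z - y) `^ (- (q + 1)))).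
  move=> yz; exact: (is_deriveZ (f z) (is_derive_pow q yz)).
have Iax : `]a, v[%classic x by rewrite /= in_itv/= ax.
pose G (z : R) := M * (q * (z - v) `^ (- (q + 1))).
have G0 z : 0 <= G z by rewrite !mulr_ge0 ?powR_ge0// ltW.
have iF y : `]a, v[%classic y -> mu.-integrable B (EFin \o F y).
  by rewrite /= in_itv/= => /andP[ay yv]; apply: ifpow => //; exact: lt_trans vb.
have derF y z : `]a, v[%classic y -> B z -> derivable (F^~ z) y 1.
  rewrite /B/= !in_itv/= andbT => /andP[ay yv] bz.
  have yz : y < z by lra.
  exact: (@ex_derive _ _ _ _ _ _ _ (dF y z yz)).
have iG : mu.-integrable B (EFin \o G).
  have q11 : 1 < q + 1 by lra.
  exact: IntZ_on (IntZ_on _ _ (integrable_powRN_itvoy q11 vb)).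
have pF y z : `]a, v[%classic y -> B z ->
    partial1of2 F y z = f z * (q * (z - y) `^ (- (q + 1))).
  rewrite /B/= !in_itv/= andbT => /andP[ay yv] bz.
  have yz : y < z by lra.
  rewrite partial1of2E; exact: (@derive_val _ _ _ _ _ _ _ (dF y z yz)).
have Gub y z : `]a, v[%classic y -> B z -> `|partial1of2 F y z| <= G z.
  move=> ay bz; rewrite pF// normrM.
  move: ay bz; rewrite /B/= !in_itv/= andbT => /andP[ay yv] bz.
  rewrite /G [`|q * _|]ger0_norm ?mulr_ge0 ?powR_ge0 ?(ltW q0)//.
  rewrite ler_pM// ?mulr_ge0 ?powR_ge0 ?(ltW q0)//.
  rewrite ler_pM2l// !powRN lef_pV2 ?posrE ?powR_gt0//; [|lra..].
  by apply: ge0_ler_powR; rewrite ?nnegrE; lra.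
have := @differentiation_under_integral R _ (measurableTypeR R) mu F B mB
  x a v Iax iF derF G G0 iG Gub.
have -> : derive1 (fun x' => \int[mu]_(y in B) F x' y) x = 0.
  rewrite derive1E.
  have n0 : \forall t \near x, cst 0 t = \int[mu]_(y in B) F t y.
    have : \forall t \near x, t \in `]a, b[.
      by apply: near_in_itvoo; rewrite in_itv/= ax.
    by apply: filterS => t; rewrite in_itv/= => /F0 ->.
  exact: (@derive_val _ _ _ _ _ _ _ (near_eq_is_derive n0 (is_derive_cst 0 x 1))).
move=> /esym H.
have : q * \int[mu]_(z in B) (f z * (z - x) `^ (- (q + 1))) = 0.
  rewrite -RintegralZl//; last by apply: ifpow => //; lra.
  rewrite -[RHS]H; apply: eq_Rintegral => z; rewrite inE => Bz.
  by rewrite pF// mulrCA.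
by move/eqP; rewrite mulf_eq0 gt_eqF//= => /eqP.
Qed.

Variable p : R.
Hypothesis p1 : 1 < p.
Hypothesis F0 : forall x, a < x < b ->
  \int[mu]_(z in B) (f z * (z - x) `^ (- p)) = 0.

Let vanishing_nat k x : a < x < b ->
  \int[mu]_(z in B) (f z * (z - x) `^ (- (p + k%:R))) = 0.
Proof.
elim: k x => [|k IH] x; first by rewrite addr0; exact: F0.
rewrite -natr1 addrA; apply: vanishing_next => //.
by rewrite (lt_le_trans p1)// lerDl.
Qed.

Variable x0 : R.
Hypothesis x0ab : a < x0 < b.
Let d := b - x0.
Let d0 : 0 < d. Proof. by rewrite subr_gt0; case/andP: x0ab. Qed.
Let x0b : x0 < b. Proof. by case/andP: x0ab. Qed.

(** A factor d / (z - x0) only raises the exponent by one, so the induction on P needs every k.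
    Integrability is carried along because linearity of the integral requires it. *)
Let vanishing_poly (P : {poly R}) k :
  mu.-integrable B (EFin \o (fun z => f z * (z - x0) `^ (- (p + k%:R)) * P.[d / (z - x0)])) /\
  \int[mu]_(z in B) (f z * (z - x0) `^ (- (p + k%:R)) * P.[d / (z - x0)]) = 0.
Proof.
have pk j : 1 < p + j%:R by rewrite (lt_le_trans p1)// lerDl.
elim/poly_ind: P k => [|P c IH] k.
  split.
    apply: eq_integrable (integrable0 _ _) => // z _.
    by rewrite /= horner0 mulr0.
  under eq_Rintegral do rewrite horner0 mulr0.
  by rewrite /Rintegral integral0.
have [i1 e1] := IH k.+1.
have E (z : R) : z \in B -> f z * (z - x0) `^ (- (p + k%:R)) * (P * 'X + c%:P).[d / (z - x0)] =
    d * (f z * (z - x0) `^ (- (p + k.+1%:R)) * P.[d / (z - x0)]) +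
    c * (f z * (z - x0) `^ (- (p + k%:R))).
  rewrite inE /B/= in_itv/= andbT => bz; have zx : 0 < z - x0 by move: x0b; lra.
  have -> : (z - x0) `^ (- (p + k.+1%:R)) = (z - x0) `^ (- (p + k%:R)) / (z - x0).
    rewrite -[X in _ / X]powRr1 ?(ltW zx)// -powRB; last by rewrite (gt_eqF zx) implybT.
    by congr (_ `^ _); rewrite -natr1; ring.
  by rewrite hornerD hornerM hornerX hornerC; ring.
have ip := ifpow (pk k) x0b.
have I1 := IntZ_on d mB i1.
have I2 := IntZ_on c mB ip.
split.
  by apply: eq_integrable (IntD_on mB I1 I2) => // z zB; rewrite /= E.
under eq_Rintegral => z zB do rewrite E//.
rewrite RintegralD// !RintegralZl//.
by rewrite e1 vanishing_nat// !mulr0 addr0.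
Qed.

(* In the variable tau = d / (z - x0), which ranges over (0, 1), all moments of
   f (z) (z - x0)^-p vanish. If f z1 <> 0, then test against
   (1 + om^2 - (tau - t1)^2)^n with om small: as n grows, this blows up near the
   image t1 of z1 and stays bounded away from it. *)
Lemma vanishing_of_moments z1 : b < z1 -> f z1 = 0.
Proof.
move=> bz1; apply/eqP; apply: contraT => fz1; exfalso.
pose t1 := d / (z1 - x0).
pose g z := f z * (z - x0) `^ (- p).
pose sg : R := Num.sg (f z1).
have hx0b := x0b; have hd0 := d0.
have fz1' : 0 < `|f z1| by rewrite normr_gt0.
have [e0 e00 he0] : exists2 e : R, 0 < e &
    forall z, `|z - z1| <= e -> b < z /\ `|f z1| / 2 <= sg * f z.
  have cz : f z @[z --> z1] --> f z1 by exact: cf.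
  have f2 : 0 < `|f z1| / 2 by rewrite divr_gt0.
  have /cvgrPdist_le/(_ _ f2) hh := cz.
  have [e /= e0 he] := (@nbhs_ballP _ _ _ _).1 hh.
  exists (Num.min (e / 2) ((z1 - b) / 2)).
    by rewrite lt_min !divr_gt0// subr_gt0.
  move=> z; rewrite le_min => /andP[h1 h2]; split.
    by move: h2; rewrite ler_norml => /andP[? ?]; lra.
  have : `|f z1 - f z| <= `|f z1| / 2.
    apply: he; rewrite /ball/= distrC (le_lt_trans h1)//.
    by rewrite ltr_pdivrMr// ltr_pMr// ltr1n.
  move=> h; have : sg * (f z1 - f z) <= `|f z1| / 2.
    apply: le_trans h; apply: le_trans (ler_norm _) _.
    by rewrite normrM /sg normr_sg (negbTE fz1) mul1r.
  by rewrite mulrBr /sg -normrEsg; lra.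
have zx1 : 0 < z1 - x0 by lra.
have zx2 : 0 < z1 + e0 - x0 by lra.
(* This is |tau - t1| at z = z1 + e0. On the left of z1 the denominator is smaller, so om bounds
   |tau - t1| from below whenever |z - z1| >= e0. *)
pose om := d * e0 / ((z1 + e0 - x0) * (z1 - x0)).
have om0 : 0 < om by rewrite !(divr_gt0, mulr_gt0).
(* A lower bound for sg * g on the window |z - z1| <= e0: f keeps half its size there, and the power
   is smallest at the right end. *)
pose c := `|f z1| / 2 * (z1 + e0 - x0) `^ (- p).
have c0 : 0 < c by rewrite mulr_gt0 ?powR_gt0// divr_gt0.
(* As d < z - x0, |tau - t1| <= |z - z1| / (z1 - x0), which is at most om / 2 when |z - z1| <=
   e1. *)
pose e1 := Num.min (e0 / 2) (om * (z1 - x0) / 2).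
have e10 : 0 < e1 by rewrite lt_min !(divr_gt0, mulr_gt0).
have e1e0 : e1 <= e0 by rewrite ge_min; apply/orP; left; lra.
have e1om : e1 <= om * (z1 - x0) / 2 by rewrite ge_min lexx orbT.
have tauE z : b < z -> d / (z - x0) - t1 = d * (z1 - z) / ((z - x0) * (z1 - x0)).
  by move=> bz; rewrite /t1; field; apply/andP; split; rewrite gt_eqF//; lra.
have tau1 z : b < z -> (d / (z - x0) - t1) ^+ 2 <= 1.
  move=> bz; have zx : 0 < z - x0 by lra.
  have h1 : 0 < d / (z - x0) <= 1.
    by rewrite divr_gt0//= ler_pdivrMr// mul1r /d; lra.
  have h2 : 0 < t1 <= 1.
    by rewrite divr_gt0//= ler_pdivrMr// mul1r /d; lra.
  have aux (y t : R) : 0 < y <= 1 -> 0 < t <= 1 -> (y - t) ^+ 2 <= 1.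
    by move=> /andP[? ?] /andP[? ?]; nra.
  exact: aux.
have tauin z : b < z -> `|z - z1| <= e1 -> (d / (z - x0) - t1) ^+ 2 <= om ^+ 2 / 4.
  move=> bz ze; have zx : 0 < z - x0 by lra.
  have : `|d / (z - x0) - t1| <= om / 2.
    rewrite tauE// normf_div normrM (gtr0_norm d0) distrC (gtr0_norm (mulr_gt0 zx zx1)).
    rewrite ler_pdivrMr ?mulr_gt0//.
    apply: (@le_trans _ _ ((z - x0) * (om * (z1 - x0) / 2))); last first.
      by rewrite le_eqVlt; apply/orP; left; apply/eqP; ring.
    by rewrite ler_pM ?(ltW d0)// ?(le_trans ze)// /d; lra.
  by rewrite ler_norml => /andP[h1 h2]; move: om0; nra.
have tauout z : b < z -> e0 < `|z - z1| -> om ^+ 2 <= (d / (z - x0) - t1) ^+ 2.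
  move=> bz ze; have zx : 0 < z - x0 by lra.
  have : om <= `|d / (z - x0) - t1|.
    rewrite tauE// normf_div normrM (gtr0_norm d0) distrC (gtr0_norm (mulr_gt0 zx zx1)).
    rewrite /om -!mulrA ler_pM2l// !invfM !mulrA ler_pM2r ?invr_gt0//.
    rewrite ler_pdivrMr// mulrAC ler_pdivlMr//.
    move: ze; have [hz|hz] := leP z1 z.
      by rewrite ger0_norm ?subr_ge0// => ze; nra.
    by rewrite ltr0_norm ?subr_lt0// => ze; nra.
  by move=> h; rewrite -[leRHS]real_normK ?num_real// lerXn2r ?nnegrE// ltW.
(* Q is nonnegative on B because |tau - t1| <= 1, is at most 1 outside the window, and is at least 1
   + om^2 / 2 on J. In the rest of the window the sign of g alone suffices. *)
pose Q : {poly R} := (1 + om ^+ 2)%:P - ('X - t1%:P) ^+ 2.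
have QE z : Q.[d / (z - x0)] = 1 + om ^+ 2 - (d / (z - x0) - t1) ^+ 2.
  by rewrite /Q !(hornerD, hornerN, hornerC, horner_exp, hornerX).
pose J : set R := `[z1 - e1, z1 + e1]%classic.
have JP z : J z <-> `|z - z1| <= e1 by rewrite /J/= in_itv/= ler_distl.
have key n z : B z -> c * (1 + om ^+ 2 / 2) ^+ n * \1_J z - `|g z| <=
    sg * (g z * (Q ^+ n).[d / (z - x0)]).
  rewrite /B/= in_itv/= andbT => bz; have zx : 0 < z - x0 by lra.
  rewrite horner_exp QE; set Qz := 1 + om ^+ 2 - _.
  have Q0 : 0 <= Qz by have := tau1 z bz; rewrite /Qz; have := sqr_ge0 om; lra.
  have [hout|hin] := ltP e0 `|z - z1|.
    have -> : \1_J z = 0 :> R.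
      rewrite indicE memNset// => /JP; move: e1e0 hout; lra.
    rewrite mulr0 sub0r.
    have : `|sg * (g z * Qz ^+ n)| <= `|g z|.
      rewrite normrM /sg normr_sg (negbTE fz1) mul1r normrM ler_piMr//.
      rewrite ger0_norm ?exprn_ge0// exprn_ile1//.
      by have := tauout z bz hout; rewrite /Qz; lra.
    by rewrite ler_norml => /andP[].
  have [_ fz] := he0 z hin.
  have gz : c <= sg * g z.
    rewrite /g mulrA /c ler_pM ?powR_ge0 ?divr_ge0//.
    rewrite !powRN lef_pV2 ?posrE ?powR_gt0//.
    apply: ge0_ler_powR; rewrite ?nnegrE ?(ltW zx) ?(ltW zx2)//; first by move: p1; lra.
    by move: hin; rewrite ler_norml => /andP[? ?]; lra.
  rewrite mulrA; apply: (@le_trans _ _ (c * (1 + om ^+ 2 / 2) ^+ n * \1_J z)).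
    by rewrite gerBl.
  rewrite indicE; case: (boolP (z \in J)) => [|_]; last first.
    by rewrite mulr0 mulr_ge0 ?exprn_ge0// (le_trans (ltW c0)).
  rewrite inE => /JP zJ; rewrite mulr1 ler_pM ?(ltW c0)//.
    by rewrite exprn_ge0// addr_ge0// divr_ge0// sqr_ge0.
  rewrite lerXn2r ?nnegrE//; first by rewrite addr_ge0// divr_ge0// sqr_ge0.
  by have := tauin z bz zJ; rewrite /Qz; have := sqr_ge0 om; lra.
have ig : mu.-integrable B (EFin \o g) by apply: ifpow.
have ing : mu.-integrable B (EFin \o (fun z => `|g z|)) by exact: integrable_norm.
have iJ : mu.-integrable B (EFin \o \1_J).
  by apply: Int_restrict => //; exact: integrable_indic_itv.
have JB : J `<=` B.
  by move=> z /JP zJ; rewrite /B/= in_itv/= andbT; have [] := he0 z (le_trans zJ e1e0).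
have intJ : \int[mu]_(z in B) (\1_J z) = e1 + e1.
  rewrite Rintegral_mkcond; transitivity (\int[mu]_z (\1_J z : R)).
    apply: eq_Rintegral => z _; rewrite patchE; case: ifPn => //.
    rewrite notin_setE => Bz; rewrite indicE memNset//; exact: contra_not (JB z) Bz.
  by rewrite Rintegral_itv_indic; [ring|lra].
have main n : c * (1 + om ^+ 2 / 2) ^+ n * (e1 + e1) <= \int[mu]_(z in B) `|g z|.
  have [iP eP] := vanishing_poly (Q ^+ n) 0.
  rewrite addr0 in iP eP.
  have i2 := IntZ_on sg mB iP.
  have i1 : mu.-integrable B (EFin \o (fun z => c * (1 + om ^+ 2 / 2) ^+ n * \1_J z - `|g z|)).
    have := IntD_on mB (IntZ_on (c * (1 + om ^+ 2 / 2) ^+ n) mB iJ) (IntZ_on (-1) mB ing).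
    by apply: eq_integrable => // z _; rewrite /= mulN1r.
  have := @le_Rintegral _ _ _ mu B _ _ mB i1 i2 (key n).
  rewrite RintegralZl// eP mulr0 RintegralB//; last exact: IntZ_on.
  by rewrite RintegralZl// intJ subr_le0.
(* Linear growth in n is enough to exceed the fixed integral of |g|. *)
have bern (h : R) n : 0 <= h -> 1 + n%:R * h <= (1 + h) ^+ n.
  move=> h0; elim: n => [|n IH]; first by rewrite mul0r addr0 expr0.
  have aux (m : R) : 0 <= m -> 1 + (m + 1) * h <= (1 + h) * (1 + m * h).
    by move=> ?; nra.
  rewrite exprS -natr1; apply: le_trans (aux _ (ler0n _ n)) _.
  by rewrite ler_pM2l// ltr_wpDr.
have [n hn] : exists n : nat, \int[mu]_(z in B) `|g z| / (c * (e1 + e1) * (om ^+ 2 / 2)) < n%:R.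
  exists (Num.truncn (\int[mu]_(z in B) `|g z| / (c * (e1 + e1) * (om ^+ 2 / 2)))).+1.
  exact: truncnS_gt.
have cpos : 0 < c * (e1 + e1) by rewrite mulr_gt0// addr_gt0.
rewrite ltr_pdivrMr in hn; last by rewrite mulr_gt0// divr_gt0// exprn_gt0.
have := main n; rewrite leNgt => /negP; apply.
apply: lt_le_trans hn _.
rewrite (_ : c * _ * (e1 + e1) = c * (e1 + e1) * (1 + om ^+ 2 / 2) ^+ n); last by ring.
rewrite mulrCA ler_pM2l// (le_trans _ (bern _ n _)) ?lerDr//.
by rewrite divr_ge0// sqr_ge0.
Qed.

End vanishing.
End moments.

(** * Almost everywhere convergence of the mollifications *)

Section mollify_limit.
Context {R : realType}.
Local Notation mu := (@lebesgue_measure R).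
Local Notation Int f := (mu.-integrable setT (EFin \o f)).

Definition rbump_mass : R := \int[mu]_z (rbump 1 0 z).

Lemma integrable_rbump (r : R) : 0 < r -> Int (rbump r 0).
Proof.
move=> r0; apply: (@Int_bounded_support _ _ 1 (- r) r).
- exact: measurable_rbump.
- by move=> x; rewrite ger0_norm ?rbump_ge0// rbump_le1.
- by move=> x; rewrite -ler_norml -ltNge => /ltW/rbump_eq0 ->.
Qed.

Lemma rbump_mass_gt0 : 0 < rbump_mass.
Proof.
have i1 : Int (\1_(`[- 2^-1, 2^-1] : set R)) by exact: integrable_indic_itv.
apply: (@lt_le_trans _ _ (expR (- 4 / 3) * (2^-1 - - 2^-1))).
  by rewrite mulr_gt0 ?expR_gt0// opprK addr_gt0// invr_gt0.
rewrite -Rintegral_itv_indic; last by lra.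
rewrite -RintegralZl//; apply: le_Rintegral => //; first exact: IntZ.
  exact: integrable_rbump.
move=> z _; rewrite indicE; case: (boolP (z \in _)) => [|_]; last first.
  by rewrite mulr0 rbump_ge0.
rewrite inE/= in_itv/= mulr1 => hz; apply: rbump_ge => //.
by rewrite ler_norml div1r.
Qed.

Lemma rbump_shift_mass (r x : R) : 0 < r ->
  \int[mu]_z rbump r 0 (z - x) = r * rbump_mass.
Proof.
move=> r0; have := Rintegral_shift (- x) (integrable_rbump r0) => ->.
have r'0 : r^-1 != 0 by rewrite invr_neq0// gt_eqF.
have := @Rintegral_affine _ r^-1 0 _ r'0 (integrable_rbump ltr01).
rewrite normfV invrK (gtr0_norm r0) => <-.
by apply: eq_Rintegral => z _; rewrite rbump_scale// addr0 mulrC.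
Qed.

Variable w : R -> R.
Hypotheses (mw : measurable_fun setT w) (w2 : Int (fun z => w z ^+ 2)).

Lemma locally_integrable_of_sqr : locally_integrable setT w.
Proof.
split => //; first exact: openT.
move=> K _ cK; have mK : measurable (K : set R) by exact: compact_measurable.
have iK : mu.-integrable K (EFin \o (fun z => w z ^+ 2 + 1)).
  apply: IntD_on => //; first exact: Int_restrict.
  apply: (@measurable_bounded_integrable _ _ _ mu) => //.
  - exact: compact_finite_measure.
  - exact: bounded_cst.
have : mu.-integrable K (EFin \o w).
  apply: le_Int_on iK => //; first exact: measurable_funTS.
  move=> z _; rewrite -[w z ^+ 2]real_normK ?num_real//.
  by move: (`|w z|) (normr_ge0 (w z)) => t t0; nra.
by move=> /integrableP[].
Qed.

(** The bump is at most 1 and lives on a ball of measure 2 r, so the error is at most 2 r / (r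
    [rbump_mass]) times the mean oscillation of w over that ball, which tends to 0 at Lebesgue
    points. *)
Lemma mollify_dist_le (x r : R) : 0 < r -> davg w x r \is a fin_num ->
  `|mollify 0 r w x / (r * rbump_mass) - w x| <= 2 / rbump_mass * fine (davg w x r).
Proof.
move=> r0 dfin; have N0 := rbump_mass_gt0.
have -> : mollify 0 r w x / (r * rbump_mass) - w x =
    (\int[mu]_z ((w z - w x) * rbump r 0 (z - x))) / (r * rbump_mass).
  under [in RHS]eq_Rintegral do rewrite mulrBl.
  have ib := integrable_shift (- x) (integrable_rbump r0).
  rewrite RintegralB//; [|exact: integrable_mollify|exact: IntZ].
  rewrite RintegralZl// rbump_shift_mass// -/(mollify _ _ _ _); field.
  by rewrite !gt_eqF.
have iw : Int (fun z => (w z - w x) * rbump r 0 (z - x)).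
  under [X in _.-integrable _ X]eq_fun do rewrite /= mulrBl.
  apply: IntB; first exact: integrable_mollify.
  by apply: IntZ; exact: (integrable_shift (- x) (integrable_rbump r0)).
rewrite normrM [`|(r * _)^-1|]gtr0_norm ?invr_gt0 ?mulr_gt0//.
rewrite ler_pdivrMr ?mulr_gt0//.
have -> : 2 / rbump_mass * fine (davg w x r) * (r * rbump_mass) =
    2 * r * fine (davg w x r) by field; rewrite gt_eqF.
have mbx : (mu (ball x r) = (2 * r)%:E)%E.
  rewrite (_ : (2 * r)%:E = (r *+ 2)%:E)%E; last by rewrite mulr_natl.
  exact: lebesgue_measure_ball (ltW r0).
have r20 : 0 < 2 * r by rewrite mulr_gt0.
have mball : measurable (ball x r : set R) by exact: measurable_ball.
have dE : ((2 * r)%:E * davg w x r =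
   \int[mu]_(z in ball x r) (`|w z - w x|)%:E)%E.
  rewrite /davg /iavg mbx inver gt_eqF// muleA -EFinM divff ?gt_eqF// mul1e.
  exact: eq_integral.
rewrite -[_ * fine _](_ : fine ((2 * r)%:E * davg w x r)%E = _); last first.
  by rewrite fineM.
rewrite -lee_fin fineK; last by rewrite fin_numM.
rewrite dE EFin_normr_Rintegral//.
apply: (le_trans (le_abse_integral _ measurableT _)).
  exact: (measurable_int _ iw).
rewrite [leRHS]integral_mkcond.
apply: ge0_le_integralT.
- exact: measurableT_comp (measurable_int _ iw).
- apply/measurable_restrict => //; apply/measurable_EFinP.
  apply: measurable_funTS; apply: measurableT_comp => //; exact: measurable_funB.
- by move=> z.
- move=> z; rewrite patchE; case: ifPn => [|].
    rewrite inE => zx; rewrite /= lee_fin normrM ler_piMr//.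
    by rewrite ger0_norm ?rbump_ge0// rbump_le1.
  rewrite notin_setE /ball/= => /negP; rewrite -leNgt distrC => zx.
  by rewrite rbump_eq0// mulr0 normr0.
Qed.

Lemma invS_cvg0r : (n.+1%:R^-1 : R) @[n --> \oo] --> (0 : R)^'+.
Proof.
move=> P [e /= e0 he].
suff : \forall n \near \oo, P (n.+1%:R^-1) by [].
have /cvgr0_norm_lt/(_ _ e0) := @cvg_harmonic R.
apply: filterS => n hn; apply: he => /=; last by rewrite invr_gt0.
by rewrite sub0r normrN.
Qed.

Lemma mollify_cvg : {ae mu, forall x,
  mollify 0 n.+1%:R^-1 w x / (n.+1%:R^-1 * rbump_mass) @[n --> \oo] --> w x}.
Proof.
have := lebesgue_differentiation locally_integrable_of_sqr.
move=> /aeS; apply => x; rewrite /lebesgue_pt => hx.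
have h0 : (davg w x (n.+1%:R^-1)) @[n --> \oo] --> 0%E.
  exact: cvg_comp invS_cvg0r hx.
have /fine_cvgP[dfin dcvg] := h0.
have N0 := rbump_mass_gt0.
apply/cvgrPdist_le => e e0.
have e1 : 0 < e * rbump_mass / 2 by rewrite divr_gt0// mulr_gt0.
have /cvgrPdist_le/(_ _ e1) := dcvg.
apply: filterS2 dfin => n dn; rewrite sub0r normrN /= => he.
rewrite distrC; apply: le_trans (mollify_dist_le _ dn) _; first by rewrite invr_gt0.
rewrite mulrAC ler_pdivrMr// mulrC -ler_pdivlMr//.
exact: le_trans (ler_norm _) he.
Qed.

End mollify_limit.

(** * Homogeneity of the kernel *)

Section kernel_facts.
Context {R : realType}.
Local Notation mu := (@lebesgue_measure R).
Local Notation Int f := (mu.-integrable setT (EFin \o f)).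

Lemma powR2_neq2 (s : R) : s != 2^-1 -> 2 - 2 `^ (2 * s) != 0.
Proof.
move=> s12; rewrite subr_eq0 eq_sym.
have : 2 `^ (1 + (2 * s - 1)) = 2 `^ 1 * 2 `^ (2 * s - 1) :> R.
  by apply: powRD; rewrite pnatr_eq0 implybT.
rewrite powRr1// (_ : 1 + (2 * s - 1) = 2 * s); last by ring.
move=> ->.
rewrite -[X in _ == X]mulr1 (inj_eq (mulfI _)) ?pnatr_eq0//.
rewrite powR_eq1; apply/negP => /or3P[/eqP h|h|/eqP h]; [lra|lra|].
by move/eqP: s12; apply; lra.
Qed.

Lemma powR2_neq0 (x : R) : 2 `^ x != 0 :> R.
Proof. by rewrite gt_eqF// powR_gt0. Qed.

Lemma kern_scale (p y : R) : kern p (2 * y) = 2 `^ (- p) * kern p y.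
Proof.
rewrite /kern pmulr_rgt0//; case: ifPn => [y0|_]; last by rewrite mulr0.
by rewrite powRM// ltW.
Qed.

Lemma integrable_kern_gap (p d C : R) (F : R -> R) : 1 < p -> 0 < d ->
  measurable_fun setT F -> (forall y, `|F y| <= C) -> (forall y, 0 < y < d -> F y = 0) ->
  Int (fun y => kern p y * F y).
Proof.
move=> p1 d0 mF FC F0; have p10 : 0 < p - 1 by lra.
pose g := (fun z : R => (z `^ (- p))) \_ `[d, +oo[.
have ig : Int g.
  apply/integrableP; split.
    apply/measurable_EFinP/measurable_restrict => //.
    exact: measurable_funTS.
  have -> : (\int[mu]_z `|(EFin \o g) z| =
      \int[mu]_(z in `[d, +oo[) (z `^ (- (1 + (p - 1))))%:E)%E.
    rewrite [RHS]integral_mkcond; apply: eq_integral => z _.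
    rewrite /g /= !patchE; case: ifP => _; last by rewrite normr0.
    by rewrite ger0_norm ?powR_ge0// addrC subrK.
  by rewrite integral_powRN_itvcy// ltry.
apply: (le_Int1 _ _ (IntZ C ig)).
  by apply: measurable_funM => //; exact: measurable_kern.
move=> y; have C0 : 0 <= C by exact: le_trans (normr_ge0 _) (FC 0).
rewrite /kern /g patchE; case: ifPn => y0; last first.
  by rewrite mul0r normr0 mulr_ge0//; case: ifP => // _; exact: powR_ge0.
have [dy|yd] := leP d y.
  rewrite mem_set/=; last by rewrite in_itv/= dy.
  by rewrite normrM ger0_norm ?powR_ge0// mulrC ler_wpM2r// powR_ge0.
rewrite F0 ?y0// mulr0 normr0 mulr_ge0//.
by case: ifP => // _; exact: powR_ge0.
Qed.

(** The gap near 0 makes the terms separately integrable, and homogeneity with the substitution y ->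
    y / 2 turns the integral of k (y) F (2 y) into 2^(p-1) times that of k F. For p = 1 + 2 s the
    factor is the opposite of the constant 2 - 2^(2s) of the form. *)
Lemma kern_second_difference_gap (p d C : R) (F : R -> R) : 1 < p -> 0 < d ->
  measurable_fun setT F -> (forall y, `|F y| <= C) -> F 0 = 0 ->
  (forall y, 0 < y < d -> F y = 0) ->
  \int[mu]_y (kern p y * (F 0 - 2 * F y + F (2 * y))) =
  (2 `^ (p - 1) - 2) * \int[mu]_y (kern p y * F y).
Proof.
move=> p1 d0 mF FC F00 F0.
have ih := integrable_kern_gap p1 d0 mF FC F0.
have [h hE] : exists h : R -> R, h = fun y => kern p y * F y by eexists.
rewrite -hE in ih *.
have ih2 : Int (fun y => h (2 * y)).
  have := integrable_affine 0 (negbT (@pnatr_eq0 _ 2)) ih.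
  by under [X in _.-integrable _ X]eq_fun do rewrite /= addr0.
have i1 := IntZ (2 `^ p) ih2; have i2 := IntZ 2 ih.
transitivity (\int[mu]_y (2 `^ p * h (2 * y) - 2 * h y)).
  apply: eq_Rintegral => y _; rewrite hE kern_scale powRN F00.
  by rewrite !mulrA mulfV ?powR2_neq0// mul1r; ring.
rewrite (@RintegralB _ (measurableTypeR R) _ mu setT _ _ measurableT i1 i2).
rewrite (@RintegralZl _ (measurableTypeR R) _ mu setT _ (2 `^ p) measurableT ih2).
rewrite (@RintegralZl _ (measurableTypeR R) _ mu setT _ 2 measurableT ih).
have -> : \int[mu]_y h (2 * y) = 2^-1 * \int[mu]_y h y.
  have := Rintegral_affine 0 (negbT (@pnatr_eq0 _ 2)) ih; rewrite gtr0_norm// => <-.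
  by under [RHS]eq_Rintegral do rewrite addr0.
have -> : 2 `^ (p - 1) = 2 `^ p / 2.
  by rewrite powRB ?powRr1// pnatr_eq0 implybT.
by field.
Qed.

End kernel_facts.

Section vanish_right.
Context {R : realType}.
Local Notation mu := (@lebesgue_measure R).
Local Notation Int f := (mu.-integrable setT (EFin \o f)).
Variables (s : R) (Om : set R) (q u w : R -> R).
Hypotheses (s0 : 0 < s) (s1 : s < 1) (s12 : s != 2^-1).
Hypothesis (mq : measurable_fun setT (q \_ Om)).
Hypotheses (wHs : Hs s w).
Hypotheses (wu : ae_eq_on (add_pos Om) w u) (u_sol : weak_solution s Om q u).

Let mw : measurable_fun setT w.
Proof. by case: wHs => /sub_Lfun_mfun + _; rewrite inE. Qed.

Let w2 : Int (fun z => w z ^+ 2).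
Proof. by case: wHs => /Lfun2_integrable_sqr. Qed.

Lemma mollify_vanish_right (a b r : R) : `]a, b[ `<=` Om ->
  ae_eq_on `]a, b[ w (cst 0) -> 0 < r -> r + r + r + r < b - a ->
  forall z, b - r < z -> mollify 0 r w z = 0.
Proof.
move=> abOm w0 r0 rab; pose W := mollify 0 r w.
have hs0 := s0.
have W0 x : a + r <= x <= b - r -> W x = 0.
  move=> /andP[ax xb]; apply: mollify_eq0 => //.
  apply: (aeS w0) => z hz; rewrite /= in_itv/= => /andP[h1 h2]; apply: hz.
  by rewrite /= in_itv/=; apply/andP; split; lra.
have [C C0 WC] := mollify_bounded r0 mw w2 0.
have cW : continuous W by exact: continuous_mollify.
have mW : measurable_fun setT W by exact: continuous_measurable_fun.
have p1 : 1 < 1 + 2 * s by lra.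
have ab' : a + r < b - r by lra.
have mid : a + r < (a + b) / 2 < b - r by apply/andP; split; lra.
apply: (@vanishing_of_moments _ W (a + r) (b - r) C cW WC (1 + 2 * s) p1 _
  _ mid) => x /andP[ax xb].
have Wx : W x = 0 by apply: W0; rewrite !ltW.
have d0 : 0 < b - r - x by lra.
have xrOm : `[x - r, x + r] `<=` Om.
  move=> z; rewrite /= in_itv/= => /andP[h1 h2]; apply: abOm.
  by rewrite /= in_itv/=; apply/andP; split; lra.
have qw0 : mollify 0 r (fun z => (q \_ Om) z * w z) x = 0.
  apply: mollify_eq0 => //; first exact: measurable_funM.
  apply: (aeS w0) => z hz; rewrite /= in_itv/= => /andP[h1 h2].
  rewrite hz ?mulr0//= in_itv/=; apply/andP; split; lra.
have Wr z : x < z -> z <= b - r -> W z = 0.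
  by move=> xz zb; apply: W0; apply/andP; split; lra.
have mWx : measurable_fun setT (fun y => W (x + y)).
  by apply: (measurableT_comp mW); exact: measurable_funD.
have W0d y : 0 < y < b - r - x -> W (x + y) = 0.
  by move=> /andP[y0 yd]; apply: W0; apply/andP; split; lra.
have WxC y : `|W (x + y)| <= C by exact: WC.
have Wx0 : W (x + 0) = 0 by rewrite addr0.
have ih := integrable_kern_gap p1 d0 mWx WxC W0d.
have hE := kern_second_difference_gap p1 d0 mWx WxC Wx0 W0d.
have := mollified_equation s0 s1 wHs wu u_sol r0 xrOm.
rewrite qw0 addr0 => /eqP; rewrite mulf_eq0 invr_eq0 (negbTE (powR2_neq2 s12)) /=.
rewrite addr0 in hE; rewrite hE (_ : 1 + 2 * s - 1 = 2 * s); last by ring.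
rewrite mulf_eq0 -opprB oppr_eq0 (negbTE (powR2_neq2 s12)) /= => /eqP h0.
(* With z = x + y the integral becomes the moment at x; the part over (x, b - r] drops out because W
   vanishes there. *)
rewrite -[RHS]h0 -(Rintegral_shift (- x) ih).
rewrite [LHS]Rintegral_mkcond.
apply: eq_Rintegral => z _; rewrite patchE /= [x + _]addrC subrK /kern subr_gt0.
case: ifPn => [|].
  rewrite inE/= in_itv/= andbT => bz.
  by rewrite (lt_trans xb bz) mulrC.
rewrite notin_setE/= in_itv/= andbT => /negP; rewrite -leNgt => zb.
by case: ifPn => xz; rewrite ?mul0r// -/W Wr ?mulr0.
Qed.

Lemma vanish_right (a b : R) : a < b -> `]a, b[ `<=` Om ->
  ae_eq_on `]a, b[ w (cst 0) -> ae_eq_on `]b, +oo[ w (cst 0).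
Proof.
move=> ab abOm w0; apply: (aeS (mollify_cvg mw w2)) => z hz.
rewrite /= in_itv/= andbT => bz.
apply: (cvg_unique _ hz) => //.
apply: cvg_near_cst.
have e0 : 0 < (b - a) / 4 by rewrite divr_gt0// subr_gt0.
have /cvgr0_norm_lt/(_ _ e0) := @cvg_harmonic R.
apply: filterS => n; rewrite /harmonic gtr0_norm ?invr_gt0// => hn.
pose r : R := n.+1%:R^-1; have n0 : 0 < r by rewrite invr_gt0.
have hr : r < (b - a) / 4 by exact: hn.
have hr1 : r + r + r + r < b - a by lra.
have hr2 : b - r < z by lra.
by rewrite (mollify_vanish_right abOm w0 n0 hr1 hr2) mul0r.
Qed.

End vanish_right.

(** * Inversion of the fractional operator *)

Section weighted_Fubini.
Context {R : realType}.
Local Notation mu := (@lebesgue_measure R).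
Local Notation Int f := (mu.-integrable setT (EFin \o f)).

Section positive_kernel.
Variables (phi : R -> R -> R) (kappa F : R -> R).
Hypothesis mphi : measurable_fun setT (fun p : R * R => phi p.1 p.2).
Hypothesis phi0 : forall t m, 0 <= phi t m.
Hypothesis phiE : forall m, (\int[mu]_t (phi t m)%:E = (kappa m)%:E)%E.
Hypotheses (mF : measurable_fun setT F) (iF : Int (fun m => kappa m * F m)).

Let mphi1 m : measurable_fun setT (phi^~ m).
Proof. exact: (measurableT_comp mphi (measurable_pair2 m)). Qed.

Let iG : (mu \x mu)%E.-integrable setT
  (EFin \o (fun p : measurableTypeR R * measurableTypeR R => phi p.1 p.2 * F p.2)).
Proof.
have k0 m : 0 <= kappa m.
  by rewrite -lee_fin -phiE; apply: integral_ge0 => t _; rewrite lee_fin.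
apply/(integrable21ltyP mu mu).
  apply/measurable_EFinP; apply: measurable_funM => //.
  exact: measurableT_comp.
have -> : (\int[mu]_m \int[mu]_t `|(phi t m * F m)%:E| =
           \int[mu]_m `|(kappa m * F m)%:E|)%E.
  apply: eq_integral => m _.
  under eq_integral do rewrite /= normrM (ger0_norm (phi0 _ _)) mulrC EFinM.
  rewrite ge0_integralZl_EFin//; last 2 first.
  - by move=> t _; rewrite lee_fin.
  - by apply/measurable_EFinP; exact: mphi1.
  by rewrite phiE -EFinM /= normrM (ger0_norm (k0 m)) mulrC.
by move/integrableP: iF => [_].
Qed.

Lemma integrable_weighted_Fubini : Int (fun t => \int[mu]_m (phi t m * F m)).
Proof. exact: (integrable_Rfubini_F iG). Qed.

(** As phi is nonnegative with explicit t-integral kappa, absolute integrability of the double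
    integral reduces to that of kappa F. This serves both for hats against the singular kernel and
    for the product of two Weyl kernels. *)
Lemma weighted_Fubini :
  \int[mu]_t \int[mu]_m (phi t m * F m) = \int[mu]_m (kappa m * F m).
Proof.
rewrite (RFubini iG); apply: eq_Rintegral => m _ /=.
have iphi : Int (phi^~ m).
  apply/integrableP; split; first by apply/measurable_EFinP; exact: mphi1.
  under eq_integral do rewrite /= ger0_norm//.
  by rewrite phiE ltry.
rewrite (@RintegralZr _ (measurableTypeR R) _ mu setT _ (F m) measurableT iphi).
by rewrite /Rintegral phiE.
Qed.

End positive_kernel.

Lemma kern_scaleM (p l y : R) : 0 < l -> kern p (l * y) = l `^ (- p) * kern p y.
Proof.
move=> l0; rewrite /kern pmulr_rgt0//; case: ifPn => [y0|_]; last by rewrite mulr0.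
by rewrite powRM// ltW.
Qed.

Lemma kern_le0 (p y : R) : y <= 0 -> kern p y = 0.
Proof. by rewrite /kern leNgt => /negbTE ->. Qed.

Lemma kern_gt0 (p y : R) : 0 < y -> kern p y = y `^ (- p).
Proof. by rewrite /kern => ->. Qed.

Lemma kernN1 (y : R) : 0 <= y -> kern (-1) y = y.
Proof.
rewrite le_eqVlt => /predU1P[<-|y0]; first by rewrite kern_le0.
by rewrite kern_gt0// opprK powRr1// ltW.
Qed.

(** A bound on the right is all that is asked of the support, since [kern] vanishes on the left
    half-line and its singularity at 0 is integrable for p < 1. *)
Lemma integrable_kern_bounded_support (p C L : R) (F : R -> R) : p < 1 ->
  measurable_fun setT F -> (forall y, `|F y| <= C) -> (forall y, L < y -> F y = 0) ->
  Int (fun y => kern p y * F y).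
Proof.
move=> p1 mF FC F0; have p10 : 0 < 1 - p by lra.
pose l := `|L| + 1.
have l0 : 0 < l by rewrite ltr_wpDl.
have Ll : L <= l by rewrite (le_trans (ler_norm _))// lerDl.
pose g := (fun z : R => (z `^ (- p))) \_ `]0, l].
have ig : Int g.
  apply/integrableP; split.
    apply/measurable_EFinP/measurable_restrict => //.
    exact: measurable_funTS.
  have -> : (\int[mu]_z `|(EFin \o g) z| =
      \int[mu]_(z in `]0%R, l]) (z `^ (1 - p - 1))%:E)%E.
    rewrite [RHS]integral_mkcond; apply: eq_integral => z _.
    rewrite /g /= !patchE; case: ifP => _; last by rewrite normr0.
    rewrite ger0_norm ?powR_ge0//; congr (_ `^ _)%:E; ring.
  by apply: le_lt_trans (integral_powR_itvoc p10 l0) _; rewrite ltry.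
apply: (le_Int1 _ _ (IntZ C ig)).
  by apply: measurable_funM => //; exact: measurable_kern.
move=> y; have C0 : 0 <= C by exact: le_trans (normr_ge0 _) (FC 0).
have g0 : 0 <= C * g y.
  by rewrite /g patchE mulr_ge0//; case: ifP => // _; exact: powR_ge0.
have [y0|y0] := leP y 0; first by rewrite kern_le0// mul0r normr0.
have [yl|ly] := leP y l.
  rewrite /g patchE mem_set/= ?in_itv/= ?y0// kern_gt0// normrM.
  by rewrite ger0_norm ?powR_ge0// mulrC ler_wpM2r ?powR_ge0.
by rewrite F0 ?mulr0 ?normr0// (le_lt_trans Ll).
Qed.

End weighted_Fubini.

Section fractional_constants.
Context {R : realType}.
Local Notation mu := (@lebesgue_measure R).
Local Notation Int f := (mu.-integrable setT (EFin \o f)).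
Variable s : R.
Hypotheses (s0 : 0 < s) (s1 : s < 1).

(* kern (-1) m is the positive part of m, so that tent y is the hat function on
   [0, 2 y] with its peak at y. *)
Definition tent (y m : R) : R := kern (-1) m - 2 * kern (-1) (m - y) + kern (-1) (m - 2 * y).

Lemma tentE (y m : R) : 0 < y -> tent y m =
  if m <= 0 then 0 else if m <= y then m else if m <= 2 * y then 2 * y - m else 0.
Proof.
move=> y0; rewrite /tent; case: leP => m0.
  have h1 : m - y <= 0 by lra.
  have h2 : m - 2 * y <= 0 by lra.
  by rewrite (kern_le0 _ m0) (kern_le0 _ h1) (kern_le0 _ h2); ring.
have h2' : m <= 2 * y -> m - 2 * y <= 0 by lra.
rewrite (kernN1 (ltW m0)); case: leP => my.
  have h1 : m - y <= 0 by lra.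
  have h2 : m - 2 * y <= 0 by lra.
  by rewrite (kern_le0 _ h1) (kern_le0 _ h2); ring.
have h1 : 0 <= m - y by lra.
rewrite (kernN1 h1); case: leP => m2y.
  by rewrite (kern_le0 _ (h2' m2y)); ring.
have h2 : 0 <= m - 2 * y by lra.
by rewrite (kernN1 h2); ring.
Qed.

Lemma tent_ge0 (y m : R) : 0 < y -> 0 <= tent y m.
Proof.
move=> y0; rewrite tentE//; case: (leP m 0) => // m0.
case: (leP m y) => ?; first exact: ltW.
by case: (leP m (2 * y)) => // ?; lra.
Qed.

Lemma tent_le (y m : R) : 0 < y -> 0 <= m -> tent y m <= m.
Proof.
move=> y0 m0; rewrite tentE//; case: (leP m 0) => // ?; case: (leP m y) => // ?.
by case: (leP m (2 * y)) => // ?; lra.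
Qed.

Lemma tent_scale (l y m : R) : 0 < l -> tent (l * y) (l * m) = l * tent y m.
Proof.
move=> l0; rewrite /tent (mulrCA 2) -!mulrBr !kern_scaleM// opprK powRr1 ?ltW//.
by ring.
Qed.

Lemma measurable_kern_comp d (T : measurableType d) (p : R) (f : T -> R) :
  measurable_fun setT f -> measurable_fun setT (fun x => kern p (f x)).
Proof. by move=> mf; apply: (measurableT_comp (measurable_kern p)). Qed.

Lemma measurable_tent : measurable_fun setT (fun p : R * R => tent p.1 p.2).
Proof.
apply: measurable_funD.
  apply: measurable_funB; first exact: measurable_kern_comp.
  by apply: measurable_funM => //; apply: measurable_kern_comp; exact: measurable_funB.
by apply: measurable_kern_comp; apply: measurable_funB => //; exact: measurable_funM.
Qed.

Let phi1 (y m : R) := kern (1 + 2 * s) y * tent y m.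

Let phi1_ge0 y m : 0 <= phi1 y m.
Proof.
rewrite /phi1; have [y0|y0] := leP y 0; first by rewrite kern_le0// mul0r.
by rewrite mulr_ge0 ?kern_ge0 ?tent_ge0.
Qed.

Let mphi1 : measurable_fun setT (fun p : R * R => phi1 p.1 p.2).
Proof.
by apply: measurable_funM; [exact: measurable_kern_comp|exact: measurable_tent].
Qed.

Let mphi1m m : measurable_fun setT (phi1^~ m).
Proof. exact: (measurableT_comp mphi1 (measurable_pair2 m)). Qed.

(* Both sides are homogeneous of the same degree in m, which reduces the claim
   to m = 1. *)
Lemma tent_constant : exists2 h1 : R, 0 < h1 & forall m,
  (\int[mu]_y (kern (1 + 2 * s) y * tent y m)%:E = (h1 * kern (2 * s - 1) m)%:E)%E.
Proof.
have s20 : 0 < 2 * s by move: s0; lra.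
pose I := (\int[mu]_y (phi1 y 1)%:E)%E.
have Ilty : (I < +oo)%E.
  (* At m = 1 the hat vanishes for y < 1 / 2 and never exceeds 1, which keeps the integral away from
     the singularity at y = 0. For positivity below, the hat equals 1 as soon as y >= 1. *)
  pose g := (fun z : R => (z `^ (- (1 + 2 * s)))%:E) \_ `[2^-1, +oo[.
  apply: (@le_lt_trans _ _ (\int[mu]_y g y)%E).
    apply: ge0_le_integralT.
    - by apply/measurable_EFinP; exact: mphi1m.
    - apply/measurable_restrict => //; apply/measurable_EFinP.
      exact: measurable_funTS.
    - by move=> y; rewrite lee_fin.
    - move=> y; rewrite /phi1 /g patchE.
      have [y0|y0] := leP y 0.
        by rewrite kern_le0// mul0r; case: ifP => // _; rewrite lee_fin powR_ge0.
      have [hy|hy] := leP 2^-1 y.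
        rewrite mem_set/= ?in_itv/= ?hy// lee_fin kern_gt0// ler_piMr ?powR_ge0//.
        exact: tent_le.
      have hy1 : (1 <= y) = false by apply/negbTE; rewrite -ltNge; lra.
      have hy2 : (1 <= 2 * y) = false by apply/negbTE; rewrite -ltNge; lra.
      rewrite tentE// hy1 hy2 ler10 mulr0.
      by case: ifP => // _; rewrite lee_fin powR_ge0.
  by rewrite /g -integral_mkcond integral_powRN_itvcy ?invr_gt0// ltry.
have Igt0 : (0 < I)%E.
  pose g := (fun z : R => (z `^ (- (1 + 2 * s)))%:E) \_ `[1, +oo[.
  apply: (@lt_le_trans _ _ (\int[mu]_y g y)%E).
    by rewrite /g -integral_mkcond integral_powRN_itvcy// lte_fin divr_gt0// powR_gt0.
  apply: ge0_le_integralT.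
  - apply/measurable_restrict => //; apply/measurable_EFinP.
    exact: measurable_funTS.
  - by apply/measurable_EFinP; exact: mphi1m.
  - by move=> y; rewrite /g patchE; case: ifP => // _; rewrite lee_fin powR_ge0.
  - move=> y; rewrite /g patchE; case: ifPn => [|_]; last by rewrite lee_fin.
    rewrite inE/= in_itv/= andbT => y1; have y0 : 0 < y by lra.
    by rewrite lee_fin /phi1 kern_gt0// tentE// y1 ler10 mulr1.
have IE : (fine I)%:E = I by rewrite fineK// ge0_fin_numE// ltW.
exists (fine I); first by rewrite -lte_fin IE.
move=> m; have [m0|m0] := leP m 0.
  rewrite (kern_le0 _ m0) mulr0; apply: integral0_eq => y _; congr (_%:E).
  have [y0|y0] := leP y 0; first by rewrite kern_le0// mul0r.
  by rewrite tentE// m0 mulr0.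
have m'0 : m^-1 != 0 by rewrite invr_neq0// gt_eqF.
transitivity (\int[mu]_y ((m `^ (- (2 * s)))%:E * (phi1 (m^-1 * y + 0) 1)%:E))%E.
  apply: eq_integral => y _; rewrite -EFinM; congr (_%:E).
  rewrite addr0 /phi1; set z := m^-1 * y.
  have -> : y = m * z by rewrite /z mulVKf// gt_eqF.
  rewrite kern_scaleM// -[X in tent _ X]mulr1 tent_scale//.
  have -> : m `^ (- (1 + 2 * s)) = m `^ (- (2 * s)) * m^-1.
    rewrite (_ : - (1 + 2 * s) = - (2 * s) + - 1); last by ring.
    by rewrite powRD ?(gt_eqF m0) ?implybT// powR_inv1// ltW.
  have := mulVf (negbT (gt_eqF m0)) => mm.
  transitivity (m `^ (- (2 * s)) * (m^-1 * m) * (kern (1 + 2 * s) z * tent z 1)).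
    by ring.
  by rewrite mm mulr1.
have mphi1' : measurable_fun setT (fun y => (phi1 y 1)%:E).
  by apply/measurable_EFinP; exact: mphi1m.
have phi1_ge0' y : (0 <= (phi1 y 1)%:E)%E by rewrite lee_fin.
rewrite ge0_integralZl_EFin ?powR_ge0//; last first.
  by apply: (measurableT_comp mphi1'); exact: measurable_affine.
rewrite (ge0_integral_affine 0 m'0 mphi1' phi1_ge0') -/I -IE -!EFinM.
rewrite normfV invrK gtr0_norm// kern_gt0// mulrA; congr (_%:E).
rewrite mulrC; congr (_ * _).
rewrite (_ : - (2 * s - 1) = - (2 * s) + 1); last by ring.
by rewrite powRD ?(gt_eqF m0) ?implybT// powRr1// ltW.
Qed.

Let phi2 (t m : R) := kern (1 - 2 * s) t * kern (2 * s - 1) (m - t).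

Let phi2_ge0 t m : 0 <= phi2 t m. Proof. by rewrite mulr_ge0 ?kern_ge0. Qed.

Let mphi2 : measurable_fun setT (fun p : R * R => phi2 p.1 p.2).
Proof.
apply: measurable_funM; apply: measurable_kern_comp => //.
exact: measurable_funB.
Qed.

Let mphi2m m : measurable_fun setT (phi2^~ m).
Proof. exact: (measurableT_comp mphi2 (measurable_pair2 m)). Qed.

Lemma powR_unit_interval (a x : R) : 0 < a <= 1 -> -1 <= x <= 1 ->
  a <= a `^ x <= a^-1.
Proof.
move=> /andP[a0 a1] /andP[x1 x2]; apply/andP; split.
  by apply: ger1_powR => //; rewrite a0.
have a01 : 0 < a <= 1 by rewrite a0.
by rewrite -powR_inv1 ?(ltW a0)//; exact: (ger_powR a01 x1).
Qed.

(** The semigroup law I^(2s) I^(2-2s) = I^2 for the kernels. The constant is the Beta value B (2 s,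
    2 - 2 s); the integral is homogeneous of degree 1 in m, so it suffices to show that it is finite
    and positive at m = 1. *)
Lemma beta_constant : exists2 b1 : R, 0 < b1 & forall m,
  (\int[mu]_t (kern (1 - 2 * s) t * kern (2 * s - 1) (m - t))%:E =
   (b1 * kern (-1) m)%:E)%E.
Proof.
have s20 : 0 < 2 * s by move: s0; lra.
have s22 : 0 < 2 - 2 * s by move: s1; lra.
have sI : -1 <= 2 * s - 1 <= 1 by apply/andP; split; move: s0 s1; lra.
have sI' : -1 <= 1 - 2 * s <= 1 by apply/andP; split; move: s0 s1; lra.
pose I := (\int[mu]_t (phi2 t 1)%:E)%E.
have phi2E t : 0 < t < 1 -> phi2 t 1 = t `^ (2 * s - 1) * (1 - t) `^ (1 - 2 * s).
  move=> /andP[t0 t1]; rewrite /phi2 !kern_gt0 ?subr_gt0//.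
  by congr (_ `^ _ * _ `^ _); ring.
have phi20 t : ~~ (0 < t < 1) -> phi2 t 1 = 0.
  rewrite negb_and -!leNgt /phi2 => /orP[t0|t1].
    by rewrite kern_le0// mul0r.
  by rewrite [kern (2 * s - 1) _]kern_le0 ?mulr0// subr_le0.
have Ilty : (I < +oo)%E.
  pose g p := (fun z : R => z `^ (p - 1)) \_ `]0, 1].
  have g0 p z : 0 <= g p z.
    by rewrite /g patchE; case: ifP => // _; exact: powR_ge0.
  have ig p : 0 < p -> Int (g p).
    move=> p0; apply/integrableP; split.
      apply/measurable_EFinP/measurable_restrict => //.
      exact: measurable_funTS.
    have -> : (\int[mu]_z `|(EFin \o g p) z| =
        \int[mu]_(z in `]0%R, 1%R]) (z `^ (p - 1))%:E)%E.
      rewrite [RHS]integral_mkcond; apply: eq_integral => z _.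
      rewrite /g /= !patchE; case: ifP => _; last by rewrite normr0.
      by rewrite ger0_norm ?powR_ge0.
    by apply: le_lt_trans (integral_powR_itvoc p0 ltr01) _; rewrite ltry.
  have m10 : -1 != 0 :> R by rewrite oppr_eq0 oner_eq0.
  have i2 : Int (fun t => 2 * (g (2 * s) t + g (2 - 2 * s) (-1 * t + 1))).
    by apply: IntZ; apply: IntD; [exact: ig|apply: integrable_affine => //; exact: ig].
  apply: le_lt_trans (integrable_lty measurableT i2).
  apply: ge0_le_integralT.
  - by apply/measurable_EFinP; exact: mphi2m.
  - exact: (measurable_int _ i2).
  - by move=> t; rewrite lee_fin.
  - move=> t; rewrite lee_fin.
    have [t01|t01] := boolP (0 < t < 1); last by rewrite phi20// mulr_ge0 ?addr_ge0.
    rewrite phi2E//; move: t01 => /andP[t0 t1].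
    have t1' : 0 < 1 - t by lra.
    have -> : g (2 * s) t = t `^ (2 * s - 1).
      by rewrite /g patchE mem_set//= in_itv/= t0 ltW.
    have -> : g (2 - 2 * s) (-1 * t + 1) = (1 - t) `^ (1 - 2 * s).
      rewrite /g patchE mem_set/=; last by rewrite in_itv/=; apply/andP; split; lra.
      by congr (_ `^ _); ring.
    have ta : 0 < t <= 1 by rewrite t0 ltW.
    have tb : 0 < 1 - t <= 1 by rewrite t1'; lra.
    have /andP[_ h1] := powR_unit_interval ta sI.
    have /andP[_ h2] := powR_unit_interval tb sI'.
    have p1 := powR_ge0 t (2 * s - 1).
    have p2 := powR_ge0 (1 - t) (1 - 2 * s).
    move: h1 h2 p1 p2; set A := t `^ _; set B := (1 - t) `^ _ => h1 h2 A0 B0.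
    (* At most one of the two factors is singular: the one whose base is at least 1 / 2 is bounded
       by 2, so the product is at most twice the sum. *)
    have [th|th] := leP t 2^-1.
      have : (1 - t)^-1 <= 2 by rewrite -[leRHS]invrK lef_pV2 ?posrE ?invr_gt0//; lra.
      by nra.
    have : t^-1 <= 2 by rewrite -[leRHS]invrK lef_pV2 ?posrE ?invr_gt0//; lra.
    by nra.
have Igt0 : (0 < I)%E.
  (* On [1 / 4, 3 / 4] both exponents lie in [-1, 1], so each factor is at least its base, hence at
     least 1 / 4. *)
  have i4 : Int (fun t => (1 / 16) * \1_(`[1 / 4, 3 / 4] : set R) t).
    by apply: IntZ; exact: integrable_indic_itv.
  apply: (@lt_le_trans _ _ (\int[mu]_t ((1 / 16) * \1_(`[(1 / 4)%R, (3 / 4)%R] : set R) t)%:E)%E).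
    have i5 : Int (\1_(`[1 / 4, 3 / 4] : set R)) by exact: integrable_indic_itv.
    have h : \int[mu]_t ((1 / 16) * \1_(`[1 / 4, 3 / 4] : set R) t) = 1 / 16 * (3 / 4 - 1 / 4).
      rewrite (@RintegralZl _ (measurableTypeR R) _ mu setT _ (1 / 16) measurableT i5).
      by rewrite Rintegral_itv_indic//; lra.
    rewrite -[X in (_ < X)%E]fineK; last exact: (integrable_fin_num measurableT i4).
    rewrite lte_fin [X in 0 < X]h; lra.
  apply: ge0_le_integralT.
  - exact: (measurable_int _ i4).
  - by apply/measurable_EFinP; exact: mphi2m.
  - by move=> t; rewrite lee_fin mulr_ge0.
  - move=> t; rewrite lee_fin indicE; case: (boolP (t \in _)) => [|_]; last by rewrite mulr0.
    rewrite inE/= in_itv/= => /andP[t0 t1].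
    have ta : 0 < t <= 1 by apply/andP; split; lra.
    have tb : 0 < 1 - t <= 1 by apply/andP; split; lra.
    rewrite phi2E; last by apply/andP; split; lra.
    have /andP[h1 _] := powR_unit_interval ta sI.
    have /andP[h2 _] := powR_unit_interval tb sI'.
    rewrite mulr1; apply: (@le_trans _ _ (t * (1 - t))); first by nra.
    by apply: ler_pM => //; lra.
have IE : (fine I)%:E = I by rewrite fineK// ge0_fin_numE// ltW.
exists (fine I); first by rewrite -lte_fin IE.
move=> m; have [m0|m0] := leP m 0.
  rewrite (kern_le0 _ m0) mulr0; apply: integral0_eq => t _; congr (_%:E).
  have [t0|t0] := leP t 0; first by rewrite kern_le0// mul0r.
  by rewrite [kern (2 * s - 1) _]kern_le0 ?mulr0//; lra.
have m'0 : m^-1 != 0 by rewrite invr_neq0// gt_eqF.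
transitivity (\int[mu]_t ((phi2 (m^-1 * t + 0) 1)%:E))%E.
  apply: eq_integral => t _; congr (_%:E).
  have tz : t = m * (m^-1 * t) by rewrite mulVKf// gt_eqF.
  rewrite addr0 /phi2; move: (m^-1 * t) tz => z ->.
  rewrite -[X in X - _]mulr1 -mulrBr !kern_scaleM//.
  have mm : m `^ (- (1 - 2 * s)) * m `^ (- (2 * s - 1)) = 1.
    rewrite -powRD ?(gt_eqF m0) ?implybT// (_ : _ + _ = 0) ?powRr0//; ring.
  transitivity (m `^ (- (1 - 2 * s)) * m `^ (- (2 * s - 1)) *
    (kern (1 - 2 * s) z * kern (2 * s - 1) (1 - z))); first by ring.
  by rewrite mm mul1r.
have mphi2' : measurable_fun setT (fun t => (phi2 t 1)%:E).
  by apply/measurable_EFinP; exact: mphi2m.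
have phi2_ge0' t : (0 <= (phi2 t 1)%:E)%E by rewrite lee_fin.
rewrite (ge0_integral_affine 0 m'0 mphi2' phi2_ge0') -/I -IE -!EFinM.
by rewrite normfV invrK gtr0_norm// (kernN1 (ltW m0)) mulrC.
Qed.

End fractional_constants.

Section inversion.
Context {R : realType}.
Local Notation mu := (@lebesgue_measure R).
Local Notation Int f := (mu.-integrable setT (EFin \o f)).

(** The Weyl integral I^2 g. For g vanishing far to the right it is the second antiderivative of g
    that vanishes there too. *)
Definition second_primitive (g : R -> R) (x : R) : R :=
  \int[mu]_m (kern (-1) m * g (x + m)).

Section bounded_support.
Variables (g : R -> R) (C A : R).
Hypotheses (mg : measurable_fun setT g) (gC : forall m, `|g m| <= C).
Hypothesis (g0 : forall m, A < m -> g m = 0).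

Let mgD (c : R) : measurable_fun setT (fun m => g (c + m)).
Proof. by apply: (measurableT_comp mg); exact: measurable_funD. Qed.

Let ig p c : p < 1 -> Int (fun m => kern p m * g (c + m)).
Proof.
move=> p1; apply: (@integrable_kern_bounded_support _ p C (A - c)) => // y hy.
by apply: g0; lra.
Qed.

Let igS p c y : p < 1 -> Int (fun m => kern p (m - y) * g (c + m)).
Proof.
move=> p1; have := integrable_shift (- y) (ig (c + y) p1).
by apply: eq_integrable => // m _ /=; congr (_ * g _)%:E; ring.
Qed.

Let intS p c y : p < 1 ->
  \int[mu]_m (kern p (m - y) * g (c + m)) = \int[mu]_m (kern p m * g (c + y + m)).
Proof.
move=> p1; rewrite -(Rintegral_shift (- y) (ig (c + y) p1)).
by apply: eq_Rintegral => m _; congr (_ * g _); ring.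
Qed.

(** The hat is itself a second difference of the kernel of I^2; translation carries its shifts over
    to g. *)
Lemma tent_pairing (c y : R) : \int[mu]_m (tent y m * g (c + m)) =
  second_primitive g c - 2 * second_primitive g (c + y) +
  second_primitive g (c + 2 * y).
Proof.
have N1 : -1 < 1 :> R by lra.
rewrite /second_primitive -!(intS _ _ N1).
have i0 := ig c N1; have i1 := igS c y N1; have i2 := igS c (2 * y) N1.
have i1' := IntZ 2 i1.
rewrite -(@RintegralZl _ (measurableTypeR R) _ mu setT _ 2 measurableT i1).
rewrite -(@RintegralB _ (measurableTypeR R) _ mu setT _ _ measurableT i0 i1').
rewrite -(@RintegralD _ (measurableTypeR R) _ mu setT _ _ measurableT (IntB i0 i1') i2).
by apply: eq_Rintegral => m _; rewrite /tent; ring.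
Qed.

Lemma integrable_tent_pairing (c y : R) : Int (fun m => tent y m * g (c + m)).
Proof.
have N1 : -1 < 1 :> R by lra.
have i0 := ig c N1; have i1 := igS c y N1; have i2 := igS c (2 * y) N1.
apply: eq_integrable (IntD (IntB i0 (IntZ 2 i1)) i2) => // m _ /=.
by congr (_%:E); rewrite /tent; ring.
Qed.

Variable s : R.
Hypotheses (s0 : 0 < s) (s1 : s < 1).

Let p1 : 2 * s - 1 < 1. Proof. by move: s1; lra. Qed.

(** The second difference of I^2 g is g paired with a hat. Exchanging the integrals lets the
    singular kernel act on hats alone, where the integrand is nonnegative and the result is
    known. *)
Lemma caputo (h1 z : R) :
  (forall m, (\int[mu]_y (kern (1 + 2 * s) y * tent y m)%:E =
    (h1 * kern (2 * s - 1) m)%:E)%E) ->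
  \int[mu]_y (kern (1 + 2 * s) y *
    (second_primitive g z - 2 * second_primitive g (z + y) +
     second_primitive g (z + 2 * y))) =
  h1 * \int[mu]_m (kern (2 * s - 1) m * g (z + m)).
Proof.
move=> hE.
rewrite -(@RintegralZl _ (measurableTypeR R) _ mu setT _ h1 measurableT (ig z p1)).
transitivity (\int[mu]_m (h1 * kern (2 * s - 1) m * g (z + m))); last first.
  by apply: eq_Rintegral => m _; rewrite mulrA.
have mphi : measurable_fun setT (fun p : R * R => kern (1 + 2 * s) p.1 * tent p.1 p.2).
  by apply: measurable_funM; [exact: measurable_kern_comp|exact: measurable_tent].
have phi0 y m : 0 <= kern (1 + 2 * s) y * tent y m.
  have [y0|y0] := leP y 0; first by rewrite kern_le0// mul0r.
  by rewrite mulr_ge0 ?kern_ge0 ?tent_ge0.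
have iF : Int (fun m => h1 * kern (2 * s - 1) m * g (z + m)).
  apply: eq_integrable (IntZ h1 (ig z p1)) => // m _ /=.
  by rewrite mulrA.
rewrite -(weighted_Fubini mphi phi0 hE (mgD z) iF).
apply: eq_Rintegral => y _; rewrite -tent_pairing.
rewrite -(@RintegralZl _ (measurableTypeR R) _ mu setT _ _ measurableT
  (integrable_tent_pairing z y)).
by apply: eq_Rintegral => m _; rewrite mulrA.
Qed.

Section abel.
Variables (b1 x : R).
Hypothesis bE : forall m,
  (\int[mu]_t (kern (1 - 2 * s) t * kern (2 * s - 1) (m - t))%:E =
   (b1 * kern (-1) m)%:E)%E.

Let N1 : -1 < 1 :> R. Proof. by lra. Qed.

Let mphi : measurable_fun setT
  (fun p : R * R => kern (1 - 2 * s) p.1 * kern (2 * s - 1) (p.2 - p.1)).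
Proof.
apply: measurable_funM; apply: measurable_kern_comp => //.
exact: measurable_funB.
Qed.

Let phi0 t m : 0 <= kern (1 - 2 * s) t * kern (2 * s - 1) (m - t).
Proof. by rewrite mulr_ge0 ?kern_ge0. Qed.

Let iF : Int (fun m => b1 * kern (-1) m * g (x + m)).
Proof.
apply: eq_integrable (IntZ b1 (ig x N1)) => // m _ /=.
by rewrite mulrA.
Qed.

Let innerE t :
  \int[mu]_m (kern (1 - 2 * s) t * kern (2 * s - 1) (m - t) * g (x + m)) =
  kern (1 - 2 * s) t * \int[mu]_m (kern (2 * s - 1) m * g (x + t + m)).
Proof.
rewrite -(intS x t p1).
rewrite -(@RintegralZl _ (measurableTypeR R) _ mu setT _ _ measurableT (igS x t p1)).
by apply: eq_Rintegral => m _; rewrite mulrA.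
Qed.

Lemma integrable_abel : Int (fun t => kern (1 - 2 * s) t *
  \int[mu]_m (kern (2 * s - 1) m * g (x + t + m))).
Proof.
have := integrable_weighted_Fubini mphi phi0 bE (mgD x) iF.
by apply: eq_integrable => // t _ /=; rewrite innerE.
Qed.

Lemma abel : \int[mu]_t (kern (1 - 2 * s) t *
    \int[mu]_m (kern (2 * s - 1) m * g (x + t + m))) =
  b1 * second_primitive g x.
Proof.
rewrite /second_primitive.
rewrite -(@RintegralZl _ (measurableTypeR R) _ mu setT _ b1 measurableT (ig x N1)).
transitivity (\int[mu]_m (b1 * kern (-1) m * g (x + m))); last first.
  by apply: eq_Rintegral => m _; rewrite mulrA.
rewrite -(weighted_Fubini mphi phi0 bE (mgD x) iF).
by apply: eq_Rintegral => t _; rewrite innerE.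
Qed.

End abel.

End bounded_support.

(* With I^a the Weyl fractional integral, the inner integral is a multiple of
   I^(2 - 2 s) g (caputo), and the outer one applies I^(2 s) to it (abel). *)
Lemma fractional_inversion (s : R) : 0 < s -> s < 1 ->
  exists2 K : R, 0 < K & forall (g : R -> R) (C A x : R),
  measurable_fun setT g -> (forall m, `|g m| <= C) ->
  (forall m, A < m -> g m = 0) ->
  K * second_primitive g x = \int[mu]_t (kern (1 - 2 * s) t *
    \int[mu]_y (kern (1 + 2 * s) y *
      (second_primitive g (x + t) - 2 * second_primitive g (x + t + y) +
       second_primitive g (x + t + 2 * y)))).
Proof.
move=> s0 s1; have [h1 h10 hE] := tent_constant s0.
have [b1 b10 bE] := beta_constant s0 s1.
exists (h1 * b1); first exact: mulr_gt0.
move=> g C A x mg gC g0.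
rewrite -mulrA -(abel mg gC g0 s1 x bE).
have ia := integrable_abel mg gC g0 s1 x bE.
rewrite -(@RintegralZl _ (measurableTypeR R) _ mu setT _ h1 measurableT ia).
by apply: eq_Rintegral => t _; rewrite (caputo mg gC g0 s1 _ hE) mulrCA.
Qed.

End inversion.

Section mollify_primitive.
Context {R : realType}.
Local Notation mu := (@lebesgue_measure R).
Local Notation Int f := (mu.-integrable setT (EFin \o f)).

(** Two integrations by parts, packed into the explicit antiderivative F. The endpoint L = |c| + r
    is outside the support of the bump, so only the boundary term at 0 survives. *)
Lemma rbump_second_primitive (r c : R) : 0 < r ->
  \int[mu]_m (kern (-1) m * rbump r 2 (c - m)) = rbump r 0 c.
Proof.
move=> r0; pose L := `|c| + r.
have L0 : 0 < L by rewrite ltr_wpDl.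
have cL : r <= `|c - L|.
  by have := ler_norm c; rewrite /L distrC => ?; rewrite ger0_norm; lra.
pose F (m : R) := - (m * rbump r 1 (c - m)) - rbump r 0 (c - m).
have dF (m : R) : is_derive m 1 F (m * rbump r 2 (c - m)).
  have d1 := is_derive_rbump_oppr r c 1 m.
  have d0 := is_derive_rbump_oppr r c 0 m.
  have H := is_deriveB (is_deriveN (is_deriveM (is_derive_id m 1) d1)) d0.
  by apply: (is_derive_eq H); rewrite /GRing.scale/=; ring.
have cF (m : R) : {for m, continuous F}.
  apply/differentiable_continuous/derivable1_diffP.
  exact: (@ex_derive _ _ _ _ _ _ _ (dF m)).
have cf : {within `[0, L], continuous (fun m => m * rbump r 2 (c - m))}.
  apply: continuous_subspaceT => m; apply: cvgM; first exact: cvg_id.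
  have : {for m, continuous (fun m => rbump r 2 (c - m))}.
    apply/differentiable_continuous/derivable1_diffP.
    exact: (@ex_derive _ _ _ _ _ _ _ (is_derive_rbump_oppr r c 2 m)).
  exact.
have FTC := @continuous_FTC2 _ _ F 0 L L0 cf.
transitivity (\int[mu]_(m in `[0, L]) (m * rbump r 2 (c - m))).
  rewrite [RHS]Rintegral_mkcond; apply: eq_Rintegral => m _; rewrite patchE.
  case: ifPn => [|].
    by rewrite inE/= in_itv/= => /andP[m0 _]; rewrite kernN1.
  rewrite notin_setE/= in_itv/= => /negP; rewrite negb_and -!ltNge => /orP[m0|Lm].
    by rewrite kern_le0 ?mul0r// ltW.
  rewrite rbump_eq0 ?mulr0//; have := ler_norm c; move: Lm; rewrite /L => Lm cc.
  by rewrite distrC ger0_norm; lra.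
rewrite /Rintegral FTC.
- rewrite -EFinB /= /F subr0 mul0r !(rbump_eq0 _ r0 cL); ring.
- split.
  + by move=> m _; exact: (@ex_derive _ _ _ _ _ _ _ (dF m)).
  + by apply: cvg_at_right_filter; exact: cF.
  + by apply: cvg_at_left_filter; exact: cF.
- by move=> m _; rewrite derive1E; exact: (@derive_val _ _ _ _ _ _ _ (dF m)).
Qed.

Section bounded_right.
Variables (w : R -> R) (A r x : R).
Hypotheses (r0 : 0 < r) (mw : measurable_fun setT w).
Hypotheses (w2 : Int (fun z => w z ^+ 2)) (wA : forall z, A < z -> w z = 0).

Let G (p : measurableTypeR R * measurableTypeR R) : R :=
  w p.1 * (kern (-1) p.2 * rbump r 2 (p.1 - (x + p.2))).

Let mG : measurable_fun setT G.
Proof.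
apply: measurable_funM; first exact: measurableT_comp.
apply: measurable_funM; first exact: measurable_kern_comp.
apply: (measurableT_comp (@measurable_rbump R r 2)).
by apply: measurable_funB => //; exact: measurable_funD.
Qed.

Let iG : (mu \x mu)%E.-integrable setT (EFin \o G).
Proof.
have [M M0 bM] := bounded_rbump 2 r0.
have hr := r0.
(* The integrand is nonzero only for z in [x - r, A'] and m in [0, L]; the maximum keeps these
   intervals nonempty. On them the kernel and the bump are bounded, and w is integrable. *)
pose A' := Num.max A (x - r).
have A'1 : x - r <= A' by rewrite le_max lexx orbT.
have A'2 : A <= A' by rewrite le_max lexx.
pose L := A' - x + r.
have L0 : 0 <= L by rewrite /L; lra.
pose J1 : R -> R := \1_(`[x - r, A'] : set R).
pose J2 : R -> R := \1_(`[0, L] : set R).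
have J10 z : 0 <= J1 z by [].
have J20 z : 0 <= J2 z by [].
have mJ1 : measurable_fun setT J1 by exact: measurable_indic.
have mJ2 : measurable_fun setT J2 by exact: measurable_indic.
have iB : Int (fun z => w z * J1 z).
  apply: (@integrable_pairing _ _ _ 1 (x - r) A') => //.
  - by move=> z; rewrite ger0_norm// /J1 indicE; case: (_ \in _).
  - by move=> z hz; rewrite /J1 indicE memNset//= in_itv/=; exact/negP.
pose B z := M * L * `|w z * J1 z|.
have B0 z : 0 <= B z by rewrite !mulr_ge0// ltW.
have iB' : Int B by apply: IntZ; exact: integrable_norm.
pose G' (p : measurableTypeR R * measurableTypeR R) : R := B p.1 * J2 p.2.
have iJ2 : Int J2 by exact: integrable_indic_itv.
have iG' : (mu \x mu)%E.-integrable setT (EFin \o G').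
  apply/(integrable12ltyP mu mu).
    apply/measurable_EFinP; apply: measurable_funM; last exact: measurableT_comp.
    by apply: measurableT_comp => //; exact: measurable_of_integrable.
  have -> : (\int[mu]_z \int[mu]_m `|(B z * J2 m)%:E| =
      \int[mu]_z (B z * L)%:E)%E.
    apply: eq_integral => z _.
    transitivity (\int[mu]_m ((B z)%:E * (J2 m)%:E))%E.
      by apply: eq_integral => m _; rewrite /= (ger0_norm (mulr_ge0 (B0 z) (J20 m))).
    rewrite ge0_integralZl_EFin//; last exact/measurable_EFinP.
    2: by move=> m _; rewrite lee_fin.
    rewrite -(fineK (integrable_fin_num measurableT iJ2)).
    by rewrite -/(Rintegral _ _ _) Rintegral_itv_indic// subr0.
  have iLB : Int (fun z => L * B z) by exact: IntZ.
  have -> : (\int[mu]_z (B z * L)%:E = \int[mu]_z (EFin \o (fun z => L * B z)%R) z)%E.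
    by apply: eq_integral => z _; rewrite /= mulrC.
  exact: (integrable_lty measurableT iLB).
apply: (@le_Int R _ (measurableTypeR R * measurableTypeR R)%type (mu \x mu)%E G G' mG) => //.
move=> [z m]; rewrite /G /G'/=.
have [h|h] := boolP [&& 0 < m, `|z - (x + m)| < r & z <= A]; last first.
  suff -> : w z * (kern (-1) m * rbump r 2 (z - (x + m))) = 0.
    by rewrite normr0 mulr_ge0.
  move: h; rewrite !negb_and -!leNgt -ltNge => /or3P[m0|zr|zA].
  - by rewrite kern_le0// mul0r mulr0.
  - by rewrite rbump_eq0// !mulr0.
  - by rewrite wA// mul0r.
move: h => /and3P[m0 zr zA].
move: zr; rewrite ltr_distl => /andP[z1 z2].
have mL : m <= L by rewrite /L; lra.
have z3 : x - r <= z by lra.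
have z4 : z <= A' by lra.
have -> : J2 m = 1 by rewrite /J2 indicE mem_set//= in_itv/= (ltW m0).
rewrite mulr1 /B.
have -> : J1 z = 1 by rewrite /J1 indicE mem_set//= in_itv/= z3.
rewrite mulr1 kernN1 ?(ltW m0)// !normrM mulrC ler_wpM2r//.
by rewrite mulrC ler_pM// gtr0_norm.
Qed.

(** With W the mollification, this is W = I^2 W'', the identity being transferred by Fubini from the
    bump to W. It gives W the form required by [fractional_inversion], with a bounded second
    derivative as g. *)
Lemma mollify_second_primitive :
  mollify 0 r w x = second_primitive (mollify 2 r w) x.
Proof.
rewrite /second_primitive.
transitivity (\int[mu]_m \int[mu]_z G (z, m)); last first.
  apply: eq_Rintegral => m _.
  have im := integrable_mollify r0 mw w2 2 (x + m).
  rewrite -(@RintegralZl _ (measurableTypeR R) _ mu setT _ _ measurableT im).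
  by apply: eq_Rintegral => z _; rewrite /G/= mulrCA.
rewrite -(RFubini iG); apply: eq_Rintegral => z _.
have ip : Int (fun m => kern (-1) m * rbump r 2 (z - x - m)).
  have [M M0 bM] := bounded_rbump 2 r0.
  have N1 : -1 < 1 :> R by lra.
  apply: (@integrable_kern_bounded_support _ _ M (`|z - x| + r)) => //.
    by apply: (measurableT_comp (@measurable_rbump R r 2)); exact: measurable_funB.
  move=> y hy; rewrite rbump_eq0//; have h1 := ler_norm (z - x); have h2 := r0.
  by rewrite distrC ger0_norm; lra.
rewrite -(rbump_second_primitive (z - x) r0).
rewrite -(@RintegralZl _ (measurableTypeR R) _ mu setT _ (w z) measurableT ip).
by apply: eq_Rintegral => m _; rewrite /G/= opprD addrA.
Qed.

End bounded_right.
End mollify_primitive.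

(** * Unique continuation to the left *)

Section volterra.
Context {R : realType}.
Local Notation mu := (@lebesgue_measure R).
Local Notation Int f := (mu.-integrable setT (EFin \o f)).

Lemma integrable_sqr_le (f w : R -> R) (Q : R) : measurable_fun setT f ->
  (forall z, `|f z| <= Q * `|w z|) -> Int (fun z => w z ^+ 2) ->
  Int (fun z => f z ^+ 2).
Proof.
move=> mf fw w2; apply: (@le_Int1 _ _ (fun z => Q ^+ 2 * w z ^+ 2)).
- exact: measurable_funX.
- move=> z; rewrite normrX -[w z ^+ 2]real_normK ?num_real// -exprMn.
  by rewrite lerXn2r ?nnegrE//; exact: le_trans (fw z).
- exact: IntZ.
Qed.

Lemma le_norm_mollify (r Q x : R) (f w : R -> R) : 0 < r ->
  measurable_fun setT f -> measurable_fun setT w ->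
  Int (fun z => w z ^+ 2) -> (forall z, `|f z| <= Q * `|w z|) ->
  `|mollify 0 r f x| <= Q * mollify 0 r (fun z => `|w z|) x.
Proof.
move=> r0 mf mw w2 fw; have f2 := integrable_sqr_le mf fw w2.
have mw' : measurable_fun setT (fun z => `|w z|) by exact: measurableT_comp.
have w2' : Int (fun z => `|w z| ^+ 2).
  by apply: (@integrable_sqr_le _ w 1 mw' _ w2) => z; rewrite normr_id mul1r.
have i1 := integrable_mollify r0 mf f2 0 x.
have i2 := integrable_mollify r0 mw' w2' 0 x.
apply: (le_trans (@le_normr_Rintegral _ (measurableTypeR R) _ mu setT _ measurableT i1)).
rewrite /mollify -(@RintegralZl _ (measurableTypeR R) _ mu setT _ Q measurableT i2).
apply: (@le_Rintegral _ (measurableTypeR R) _ mu setT) => //.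
- exact: integrable_norm.
- exact: IntZ.
- move=> z _ /=; rewrite normrM (ger0_norm (rbump_ge0 _ r0)) mulrA.
  by rewrite ler_wpM2r// rbump_ge0.
Qed.

Lemma mollify_eq0_right (m : nat) (r A z : R) (w : R -> R) : 0 < r ->
  (forall z, A < z -> w z = 0) -> A + r < z -> mollify m r w z = 0.
Proof.
move=> r0 wA Az; rewrite /mollify; under eq_Rintegral => y _.
  have -> : w y * rbump r m (y - z) = 0.
    have [Ay|yA] := ltP A y; first by rewrite wA// mul0r.
    by rewrite rbump_eq0 ?mulr0// distrC ger0_norm; lra.
  over.
by rewrite Rintegral_cst// mul0r.
Qed.

(** Inversion with g = W'' expresses K W (x) as the order 2 s integral of the right hand side of the
    equation. Only points z > x enter, because the kernel kills t <= 0. Pointwise domination of f by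
    |w| survives mollification, whence |w|_r on the right. *)
Lemma volterra_bound (s : R) : 0 < s -> s < 1 -> exists2 K, 0 < K &
  forall (w f : R -> R) (A r x Q : R), 0 < r ->
  measurable_fun setT w -> Int (fun z => w z ^+ 2) ->
  (forall z, A < z -> w z = 0) ->
  measurable_fun setT f -> (forall z, `|f z| <= Q * `|w z|) ->
  (forall z, x < z -> \int[mu]_y (kern (1 + 2 * s) y *
     (mollify 0 r w z - 2 * mollify 0 r w (z + y) + mollify 0 r w (z + 2 * y))) =
     mollify 0 r f z) ->
  K * `|mollify 0 r w x| <=
  Q * \int[mu]_t (kern (1 - 2 * s) t * mollify 0 r (fun z => `|w z|) (x + t)).
Proof.
move=> s0 s1; have [K K0 HK] := fractional_inversion s0 s1.
exists K => // w f A r x Q r0 mw w2 wA mf fw eqn.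
have p1 : 1 - 2 * s < 1 by lra.
have wE : second_primitive (mollify 2 r w) = mollify 0 r w.
  by apply/funext => z; rewrite -(mollify_second_primitive z r0 mw w2 wA).
have [C C0 bC] := mollify_bounded r0 mw w2 2.
have := HK (mollify 2 r w) C (A + r) x (measurable_mollify r0 mw w2 2) bC
  (fun z => mollify_eq0_right 2 r0 wA).
rewrite wE => Kw.
have {}Kw : K * mollify 0 r w x =
    \int[mu]_t (kern (1 - 2 * s) t * mollify 0 r f (x + t)).
  rewrite Kw; apply: eq_Rintegral => t _.
  have [t0|t0] := leP t 0; first by rewrite kern_le0 ?mul0r.
  by rewrite eqn// ltrDl.
have f2 := integrable_sqr_le mf fw w2.
have mw' : measurable_fun setT (fun z => `|w z|) by exact: measurableT_comp.
have w2' : Int (fun z => `|w z| ^+ 2).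
  by apply: (@integrable_sqr_le _ w 1 mw' _ w2) => z; rewrite normr_id mul1r.
have fA z : A < z -> f z = 0.
  by move=> Az; apply/eqP; rewrite -normr_le0; have := fw z; rewrite wA// normr0 mulr0.
have wA' z : A < z -> `|w z| = 0 by move=> Az; rewrite wA ?normr0.
have kint (g : R -> R) : measurable_fun setT g -> Int (fun z => g z ^+ 2) ->
    (forall z, A < z -> g z = 0) ->
    Int (fun t => kern (1 - 2 * s) t * mollify 0 r g (x + t)).
  move=> mg g2 gA; have [D D0 bD] := mollify_bounded r0 mg g2 0.
  apply: (@integrable_kern_bounded_support _ _ D (A + r - x) _ p1 _ (fun y => bD (x + y))).
    by apply: (measurableT_comp (measurable_mollify r0 mg g2 0)); exact: measurable_funD.
  by move=> y hy; apply: (mollify_eq0_right _ r0 gA); lra.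
have i1 := kint _ mf f2 fA.
have i2 := kint _ mw' w2' wA'.
rewrite -(gtr0_norm K0) -normrM Kw.
apply: (le_trans (@le_normr_Rintegral _ (measurableTypeR R) _ mu setT _ measurableT i1)).
rewrite -(@RintegralZl _ (measurableTypeR R) _ mu setT _ Q measurableT i2).
apply: (@le_Rintegral _ (measurableTypeR R) _ mu setT) => //.
- exact: integrable_norm.
- exact: IntZ.
- move=> t _ /=; rewrite normrM (ger0_norm (kern_ge0 _ _)) mulrCA.
  by rewrite ler_wpM2l ?kern_ge0//; exact: le_norm_mollify.
Qed.

End volterra.

(** * Weighted L^1 estimates *)

Section gronwall.
Context {R : realType}.
Local Notation mu := (@lebesgue_measure R).
Local Notation Int f := (mu.-integrable setT (EFin \o f)).

Lemma ge0_Tonelli (G : R -> R -> R) :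
  measurable_fun setT (fun p : R * R => G p.1 p.2) ->
  (forall x y, 0 <= G x y) ->
  (\int[mu]_x \int[mu]_y (G x y)%:E = \int[mu]_y \int[mu]_x (G x y)%:E)%E.
Proof.
move=> mG G0.
apply: (@fubini_tonelli _ _ _ _ _ mu mu
  (fun p : measurableTypeR R * measurableTypeR R => (G p.1 p.2)%:E)).
- exact/measurable_EFinP.
- by move=> p; rewrite lee_fin.
Qed.

Lemma EFin_Rint (f : R -> R) : Int f -> (\int[mu]_x f x)%R%:E = (\int[mu]_x (f x)%:E)%E.
Proof. by move=> fi; rewrite fineK//; exact: integrable_fin_num. Qed.

Definition exp_weight (lam b x : R) : R := if b <= x then expR (lam * x) else 0.

Lemma exp_weight_ge0 lam b x : 0 <= exp_weight lam b x.
Proof. by rewrite /exp_weight; case: ifP => // _; exact: expR_ge0. Qed.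

Lemma measurable_exp_weight lam b : measurable_fun setT (exp_weight lam b).
Proof.
apply: measurable_fun_ifT => //; first by apply: measurable_fun_ler.
by apply: measurableT_comp => //; exact: measurable_funM.
Qed.

Definition exp_cutoff (lam L t : R) : R :=
  if 0 <= t <= L then expR (- (lam * t)) else 0.

Lemma exp_cutoff_ge0 lam L t : 0 <= exp_cutoff lam L t.
Proof. by rewrite /exp_cutoff; case: ifP => // _; exact: expR_ge0. Qed.

Lemma exp_cutoff_le1 lam L t : 0 <= lam -> `|exp_cutoff lam L t| <= 1.
Proof.
move=> l0; rewrite ger0_norm ?exp_cutoff_ge0// /exp_cutoff.
case: ifPn => // /andP[t0 _].
by rewrite -(expR0 R) ler_expR oppr_le0 mulr_ge0.
Qed.

Lemma measurable_exp_cutoff lam L : measurable_fun setT (exp_cutoff lam L).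
Proof.
apply: measurable_fun_ifT => //.
  apply: measurable_and; first by apply: measurable_fun_ler.
  by apply: measurable_fun_ler.
apply: measurableT_comp => //; apply: measurableT_comp => //.
Qed.

Lemma integrable_kern_cutoff (p lam L : R) : p < 1 -> 0 <= lam ->
  Int (fun t => kern p t * exp_cutoff lam L t).
Proof.
move=> p1 l0; apply: (@integrable_kern_bounded_support _ _ 1 L) => //.
- exact: measurable_exp_cutoff.
- by move=> t; exact: exp_cutoff_le1.
- by move=> t Lt; rewrite /exp_cutoff [t <= L]leNgt Lt andbF.
Qed.

Lemma rbumpN (r t : R) : 0 < r -> rbump r 0 (- t) = rbump r 0 t.
Proof.
move=> r0; have [h|h] := ltP `|t| r; last by rewrite !rbump_eq0 ?normrN.
by rewrite (rbumpE r0 h) rbumpE ?normrN// mulNr sqrrN.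
Qed.

Lemma rbump_mass_reflect (r y : R) : 0 < r ->
  (\int[mu]_x (rbump r 0 (y - x))%:E = (r * rbump_mass)%:E)%E.
Proof.
move=> r0; rewrite -(rbump_shift_mass y r0) EFin_Rint.
  apply: eq_integral => x _; congr EFin.
  by rewrite -(rbumpN _ r0) opprB.
exact: (integrable_shift (- y) (integrable_rbump r0)).
Qed.

Section weighted_estimates.
Variables (w : R -> R) (A : R).
Hypotheses (mw : measurable_fun setT w) (w2 : Int (fun z => w z ^+ 2)).
Hypothesis (wA : forall z, A < z -> w z = 0).

Local Notation V r := (mollify 0 r (fun z => `|w z|)).

Let mw' : measurable_fun setT (fun z => `|w z|).
Proof. exact: measurableT_comp. Qed.

Let w2' : Int (fun z => `|w z| ^+ 2).
Proof. by apply: (@integrable_sqr_le _ _ w 1 mw' _ w2) => z; rewrite normr_id mul1r. Qed.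

Let wA' z : A < z -> `|w z| = 0. Proof. by move=> Az; rewrite wA ?normr0. Qed.

Let V0 r x : 0 < r -> 0 <= V r x.
Proof. by move=> r0; apply: Rintegral_ge0 => z _; rewrite mulr_ge0// rbump_ge0. Qed.

Let mV r : 0 < r -> measurable_fun setT (V r).
Proof. by move=> r0; exact: measurable_mollify. Qed.

(** Tonelli moves the bump onto the weight. Displacement by at most r costs a factor e^(lam r) and
    enlarges the half-line to [b - r, +oo); both losses disappear as r tends to 0. *)
Lemma integral_mollify_weight (r lam b : R) : 0 < r -> 0 <= lam ->
  (\int[mu]_x (V r x * exp_weight lam b x)%:E <=
   (r * rbump_mass * expR (lam * r))%:E *
   \int[mu]_y (`|w y| * exp_weight lam (b - r) y)%:E)%E.
Proof.
move=> r0 l0.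
pose G (x y : R) := `|w y| * expR (lam * r) * exp_weight lam (b - r) y * rbump r 0 (y - x).
have mrb : measurable_fun setT (fun p : R * R => rbump r 0 (p.2 - p.1)).
  by apply: (measurableT_comp (@measurable_rbump R r 0)); exact: measurable_funB.
have mG : measurable_fun setT (fun p : R * R => G p.1 p.2).
  apply: measurable_funM => //; apply: measurable_funM.
    by apply: measurable_funM => //; exact: (measurableT_comp mw').
  exact: (measurableT_comp (measurable_exp_weight _ _)).
have G0 x y : 0 <= G x y.
  by rewrite !mulr_ge0 ?expR_ge0 ?exp_weight_ge0 ?rbump_ge0.
have key (x y : R) : `|w y| * rbump r 0 (y - x) * exp_weight lam b x <= G x y.
  rewrite /G -!mulrA ler_wpM2l//.
  have [h|h] := leP r `|y - x|; first by rewrite rbump_eq0// mul0r !mulr0.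
  rewrite mulrC mulrA ler_wpM2r ?rbump_ge0//.
  rewrite /exp_weight; case: ifPn => [bx|_]; last first.
    by rewrite mulr_ge0 ?expR_ge0//; case: ifP => // _; exact: expR_ge0.
  move: h; rewrite ltr_distl => /andP[h1 h2].
  have -> : b - r <= y by lra.
  by rewrite -expRD ler_expR -mulrDr ler_wpM2l//; lra.
have step : (\int[mu]_x (V r x * exp_weight lam b x)%:E <=
    \int[mu]_x \int[mu]_y (G x y)%:E)%E.
  apply: ge0_le_integralT.
  - apply/measurable_EFinP; apply: measurable_funM; first exact: mV.
    exact: measurable_exp_weight.
  - apply: (measurable_fun_fubini_tonelli_F
      (fun p : measurableTypeR R * measurableTypeR R => (G p.1 p.2)%:E)).
      exact/measurable_EFinP.
    by move=> p; rewrite lee_fin.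
  - by move=> x; rewrite lee_fin mulr_ge0 ?V0 ?exp_weight_ge0.
  - move=> x; have im := integrable_mollify r0 mw' w2' 0 x.
    rewrite /mollify -(@RintegralZr _ (measurableTypeR R) _ mu setT _
      (exp_weight lam b x) measurableT im).
    rewrite EFin_Rint; last first.
      by under [X in _.-integrable _ X]eq_fun do rewrite /= mulrC; exact: IntZ.
    apply: ge0_le_integralT.
    + apply/measurable_EFinP; apply: measurable_funM => //.
      exact: measurable_of_integrable im.
    + apply/measurable_EFinP; exact: (measurableT_comp mG (measurable_pair1 x)).
    + by move=> y; rewrite lee_fin !mulr_ge0 ?rbump_ge0 ?exp_weight_ge0.
    + by move=> y; rewrite lee_fin key.
apply: (le_trans step).
rewrite ge0_Tonelli// -ge0_integralZl_EFin//; last 3 first.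
- by move=> y _; rewrite lee_fin mulr_ge0 ?exp_weight_ge0.
- apply/measurable_EFinP; apply: measurable_funM => //.
  exact: measurable_exp_weight.
- by rewrite !mulr_ge0 ?expR_ge0 ?(ltW r0) ?(ltW rbump_mass_gt0).
rewrite le_eqVlt; apply/orP; left; apply/eqP; apply: eq_integral => y _.
under eq_integral do rewrite /G EFinM.
rewrite ge0_integralZl_EFin//; last 3 first.
- by move=> x _; rewrite lee_fin rbump_ge0.
- apply/measurable_EFinP; exact: (measurableT_comp mrb (measurable_pair2 y)).
- by rewrite !mulr_ge0 ?expR_ge0 ?exp_weight_ge0.
rewrite rbump_mass_reflect// -!EFinM; congr EFin; ring.
Qed.

(** Young's inequality for L^1 in weighted form: the weight is split as above between the kernel and
    |w|_r, and the x-integral is then translation invariant. *)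
Lemma integral_volterra_weight (r p C b lam : R) : 0 < r -> r <= 1 ->
  p < 1 -> 0 <= C -> 0 <= lam ->
  (forall x, b <= x -> `|mollify 0 r w x| <=
     C * \int[mu]_t (kern p t * V r (x + t))) ->
  (\int[mu]_x (`|mollify 0 r w x| * exp_weight lam b x)%:E <=
   (C * \int[mu]_t (kern p t * exp_cutoff lam (A + 1 - b) t))%:E *
   \int[mu]_x (V r x * exp_weight lam b x)%:E)%E.
Proof.
(* For x >= b and r <= 1, |w|_r (x + t) vanishes once x + t > A + 1, in particular for t > A + 1 -
   b. *)
move=> r0 r1 p1 C0 l0 H; set L := A + 1 - b.
pose e := exp_weight lam b.
have me : measurable_fun setT e by exact: measurable_exp_weight.
have e0 x : 0 <= e x by exact: exp_weight_ge0.
pose k t := kern p t * exp_cutoff lam L t.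
have mk : measurable_fun setT k.
  apply: measurable_funM; [exact: measurable_kern|exact: measurable_exp_cutoff].
have k0 t : 0 <= k t by rewrite mulr_ge0 ?kern_ge0 ?exp_cutoff_ge0.
have mVe : measurable_fun setT (fun x => V r x * e x).
  by apply: measurable_funM => //; exact: mV.
have Ve0 x : 0 <= V r x * e x by rewrite mulr_ge0 ?V0.
pose G (x t : R) := C * k t * (V r (x + t) * e (x + t)).
have mG : measurable_fun setT (fun p : R * R => G p.1 p.2).
  apply: measurable_funM; first by apply: measurable_funM => //; exact: (measurableT_comp mk).
  by apply: (measurableT_comp mVe); exact: measurable_funD.
have G0 x t : 0 <= G x t by rewrite /G; apply: mulr_ge0 => //; exact: mulr_ge0.
have key (x t : R) : b <= x -> C * (kern p t * V r (x + t)) * e x <= G x t.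
  move=> bx; rewrite /G /k -!mulrA ler_wpM2l//.
  have [t0|t0] := leP t 0; first by rewrite kern_le0// !mul0r.
  rewrite ler_wpM2l ?kern_ge0//.
  have [tL|Lt] := leP t L; last first.
    rewrite (mollify_eq0_right _ r0 wA'); first by rewrite !mul0r mulr0.
    by move: Lt; rewrite /L; lra.
  rewrite mulrCA ler_wpM2l ?V0// /e /exp_weight /exp_cutoff bx tL (ltW t0)/=.
  have -> : b <= x + t by lra.
  by rewrite -expRD ler_expR mulrDr; lra.
have step : (\int[mu]_x (`|mollify 0 r w x| * e x)%:E <=
    \int[mu]_x \int[mu]_t (G x t)%:E)%E.
  apply: ge0_le_integralT.
  - apply/measurable_EFinP; apply: measurable_funM => //.
    by apply: measurableT_comp => //; exact: measurable_mollify.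
  - apply: (measurable_fun_fubini_tonelli_F
      (fun p : measurableTypeR R * measurableTypeR R => (G p.1 p.2)%:E)).
      exact/measurable_EFinP.
    by move=> z; rewrite lee_fin.
  - by move=> x; rewrite lee_fin mulr_ge0.
  - move=> x; have [bx|xb] := leP b x; last first.
      rewrite /e /exp_weight (lt_geF xb) mulr0.
      by apply: integral_ge0 => t _; rewrite lee_fin.
    have [D D0 bD] := mollify_bounded r0 mw' w2' 0.
    have ik : Int (fun t => kern p t * V r (x + t)).
      apply: (@integrable_kern_bounded_support _ _ D (A + r - x) _ p1 _ (fun y => bD (x + y))).
        by apply: (measurableT_comp (mV r0)); exact: measurable_funD.
      by move=> y hy; apply: (mollify_eq0_right _ r0 wA'); lra.
    have ikC := IntZ C ik.
    have ikCe : Int (fun t => C * (kern p t * V r (x + t)) * e x).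
      by under [X in _.-integrable _ X]eq_fun do rewrite /= mulrC; exact: IntZ.
    apply: (@le_trans _ _ (\int[mu]_t (C * (kern p t * V r (x + t)) * e x))%R%:E).
      rewrite lee_fin.
      rewrite (@RintegralZr _ (measurableTypeR R) _ mu setT _ (e x) measurableT ikC).
      rewrite (@RintegralZl _ (measurableTypeR R) _ mu setT _ C measurableT ik).
      by rewrite ler_wpM2r// H.
    rewrite EFin_Rint//; apply: ge0_le_integralT.
    + by apply/measurable_EFinP; exact: measurable_of_integrable.
    + apply/measurable_EFinP; exact: (measurableT_comp mG (measurable_pair1 x)).
    + move=> t; rewrite lee_fin; apply: mulr_ge0 => //; apply: mulr_ge0 => //.
      by rewrite mulr_ge0 ?kern_ge0 ?V0.
    + by move=> t; rewrite lee_fin key.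
apply: (le_trans step); rewrite ge0_Tonelli//.
have ik : Int k by exact: integrable_kern_cutoff.
under eq_integral => t _.
  under eq_integral do rewrite /G EFinM.
  rewrite ge0_integralZl_EFin//; last 3 first.
  - by move=> x _; rewrite lee_fin.
  - apply/measurable_EFinP; apply: (measurableT_comp mVe).
    exact: measurable_funD.
  - exact: mulr_ge0.
  rewrite (@ge0_integral_shift _ t (fun x => (V r x * e x)%:E)); last 2 first.
  - exact/measurable_EFinP.
  - by move=> x; rewrite lee_fin.
  over.
rewrite ge0_integralZr//; last 3 first.
- by apply/measurable_EFinP; exact: measurable_funM.
- by move=> t _; rewrite lee_fin mulr_ge0.
- by apply: integral_ge0 => x _; rewrite lee_fin.
rewrite -EFin_Rint; last exact: IntZ.
by rewrite (@RintegralZl _ (measurableTypeR R) _ mu setT _ C measurableT ik).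
Qed.

End weighted_estimates.
End gronwall.

Section gronwall_limit.
Context {R : realType}.
Local Notation mu := (@lebesgue_measure R).
Local Notation Int f := (mu.-integrable setT (EFin \o f)).

(** Fatou's lemma asks for no common majorant of the normalised mollifications; a convergent
    sequence of bounds for their integrals, valid eventually, is enough. *)
Lemma Fatou_ae (f_ : (R -> R)^nat) (f : R -> R) (l : R^nat) (c : R) :
  (forall n, measurable_fun setT (f_ n)) -> measurable_fun setT f ->
  (forall n x, 0 <= f_ n x) ->
  {ae mu, forall x, f_ n x @[n --> \oo] --> f x} ->
  (\forall n \near \oo, (\int[mu]_x (f_ n x)%:E <= (l n)%:E)%E) ->
  l n @[n --> \oo] --> c -> (\int[mu]_x (f x)%:E <= c%:E)%E.
Proof.
move=> mf_ mf f0 f_f fl lc.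
pose F n (x : R) := (f_ n x)%:E.
have mF n : measurable_fun setT (F n) by exact/measurable_EFinP.
have mN : measurable_fun setT (fun x => limn_einf (F^~ x)).
  under eq_fun do rewrite -[limn_einf _]oppeK -limn_esupN.
  apply: measurableT_comp => //; apply: measurable_fun_limn_esup => // n.
  exact: measurableT_comp.
have -> : (\int[mu]_x (f x)%:E = \int[mu]_x limn_einf (F^~ x))%E.
  apply: (@ae_eq_integral _ (measurableTypeR R) _ mu setT) => //.
    exact/measurable_EFinP.
  apply: (aeS f_f) => x hx _; have hF : F n x @[n --> \oo] --> (f x)%:E.
    by apply: cvg_comp hx _; exact: cvg_id.
  by rewrite is_cvg_limn_einfE; [rewrite (cvg_lim _ hF)|apply/cvg_ex; exists (f x)%:E].
have F0 n x : setT x -> (0 <= F n x)%E by rewrite lee_fin.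
apply: (le_trans (@fatou _ (measurableTypeR R) _ mu setT measurableT F mF F0)).
have lc' : (l n)%:E @[n --> \oo] --> c%:E by apply: cvg_comp lc _; exact: cvg_id.
rewrite limn_einf_lim -(cvg_lim _ lc')//; apply: lee_lim.
- exact: is_cvg_einfs.
- by apply/cvg_ex; exists c%:E.
- apply: filterS fl => n; apply: le_trans.
  by apply: ereal_inf_lbound; exists n => //=.
Qed.

Lemma dominated_Rcvg (f_ : (R -> R)^nat) (f g : R -> R) :
  (forall n, measurable_fun setT (f_ n)) -> Int g ->
  (forall n x, `|f_ n x| <= g x) ->
  (forall x, f_ n x @[n --> \oo] --> f x) ->
  (\int[mu]_x f_ n x)%R @[n --> \oo] --> (\int[mu]_x f x)%R.
Proof.
move=> mf_ ig fg f_f.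
have mf : measurable_fun setT f.
  by apply: (@measurable_fun_cvg _ _ _ setT f_) => // x _; exact: f_f.
have fg' x : `|f x| <= g x.
  have h : `|f_ n x| @[n --> \oo] --> `|f x| by apply: cvg_norm; exact: f_f.
  apply: (ler_cvg_to h (cvg_cst (g x))); exact: nearW.
have i n : Int (f_ n) by exact: le_Int1 ig.
have i' : Int f by exact: le_Int1 ig.
have := @dominated_cvg _ (measurableTypeR R) _ mu setT measurableT
  (fun n x => (f_ n x)%:E) (fun x => (f x)%:E) (EFin \o g).
move=> H0; have {}H0 := H0 (fun n => (measurable_EFinP _ _).2 (mf_ n)).
have H : (\int[mu]_x (f_ n x)%:E)%E @[n --> \oo] --> (\int[mu]_x (f x)%:E)%E.
  apply: H0 => //.
  - by move=> x _; apply: cvg_comp (f_f x) _; exact: cvg_id.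
  - by move=> n x _ /=; rewrite lee_fin.
rewrite -EFin_Rint// in H.
exact: (fine_cvg H).
Qed.

(** Dominated convergence with the case lam = 0 as majorant: for t > 0 the factor (e^(-t))^n tends
    to 0, and for t <= 0 the kernel is 0. *)
Lemma cutoff_mass_cvg0 (p L : R) : p < 1 ->
  (\int[mu]_t (kern p t * exp_cutoff n%:R L t))%R @[n --> \oo] --> (0 : R).
Proof.
move=> p1; have i0 := integrable_kern_cutoff L p1 (lexx 0).
have h0 : (\int[mu]_t (0 : R))%R = 0 by rewrite Rintegral_cst// mul0r.
rewrite -[X in _ --> X]h0; apply: (dominated_Rcvg _ i0).
- move=> n; apply: measurable_funM; first exact: measurable_kern.
  exact: measurable_exp_cutoff.
- move=> n t; rewrite ger0_norm ?mulr_ge0 ?kern_ge0 ?exp_cutoff_ge0//.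
  rewrite ler_wpM2l ?kern_ge0// /exp_cutoff; case: ifPn => // /andP[t0 _].
  by rewrite ler_expR lerN2 mul0r mulr_ge0.
- move=> t; have [t0|t0] := leP t 0.
    by under eq_fun do rewrite kern_le0// mul0r; exact: cvg_cst.
  rewrite -[X in _ --> X](mulr0 (kern p t)); apply: cvgM; first exact: cvg_cst.
  have [tL|Lt] := leP t L; last first.
    by under eq_fun do rewrite /exp_cutoff (lt_geF Lt) andbF; exact: cvg_cst.
  under eq_fun do rewrite /exp_cutoff tL (ltW t0)/= -mulrN expRM_natl.
  by apply: cvg_expr; rewrite ger0_norm ?expR_ge0// -expR0 ltr_expR oppr_lt0.
Qed.

Lemma harmonic_lt_near (e : R) : 0 < e -> \forall n \near \oo, n.+1%:R^-1 < e.
Proof.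
move=> e0; have /cvgr0_norm_lt/(_ _ e0) := @cvg_harmonic R.
by apply: filterS => n; rewrite /harmonic gtr0_norm ?invr_gt0.
Qed.

(* Gronwall: in L^1 with weight e^(lam x) on [b, +oo), the limit r -> 0 of the
   hypothesis bounds the norm of w by a multiple of itself, and the factor tends
   to 0 as lam tends to infinity. The factor 2 absorbs e^(lam r). *)
Lemma Volterra_vanishing (w : R -> R) (A p C b r1 : R) :
  measurable_fun setT w -> Int (fun z => w z ^+ 2) ->
  (forall z, A < z -> w z = 0) -> p < 1 -> 0 <= C -> 0 < r1 ->
  (forall r x, 0 < r -> r < r1 -> b <= x -> `|mollify 0 r w x| <=
     C * \int[mu]_t (kern p t * mollify 0 r (fun z => `|w z|) (x + t))) ->
  ae_eq_on `[b, +oo[ w (cst 0).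
Proof.
move=> mw w2 wA p1 C0 r10 H.
have contr (c I : R) : I <= c * I -> c < 1 -> I <= 0 by move=> ? ?; nra.
have mw' : measurable_fun setT (fun z => `|w z|) by exact: measurableT_comp.
have w2' : Int (fun z => `|w z| ^+ 2).
  by apply: (@integrable_sqr_le _ _ w 1 mw' _ w2) => z; rewrite normr_id mul1r.
(* The contraction factor will be 2 C M. It is made smaller than 1 before r tends to 0, and lam = N
   then stays fixed. *)
have [N hN] : exists N : nat, 2 * C *
    \int[mu]_t (kern p t * exp_cutoff N%:R (A + 1 - b) t) < 1.
  have : (2 * C * \int[mu]_t (kern p t * exp_cutoff n%:R (A + 1 - b) t))
      @[n --> \oo] --> 2 * C * 0.
    by apply: cvgM; [exact: cvg_cst|exact: cutoff_mass_cvg0].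
  rewrite mulr0 => /cvgr_lt/(_ 1 ltr01) [N _ hN].
  by exists N; apply: (hN N) => /=.
move: hN; set M := (X in 2 * C * X) => hN.
pose lam : R := N%:R; have l0 : 0 <= lam by [].
pose rr (n : nat) : R := n.+1%:R^-1.
have rr0 n : 0 < rr n by rewrite invr_gt0.
pose f_ n y := `|w y| * exp_weight lam (b - rr n) y.
pose f y := `|w y| * exp_weight lam b y.
pose A' := Num.max A b.
(* A majorant common to all n: the radii are at most 1, so every half-line starts at or after b - 1,
   and w vanishes beyond A'. *)
pose g y := `|w y| * (expR (lam * A') * \1_(`[b - 1, A'] : set R) y).
have bA' : b <= A' by rewrite le_max lexx orbT.
have mf_ n : measurable_fun setT (f_ n).
  by apply: measurable_funM => //; exact: measurable_exp_weight.
have mf : measurable_fun setT f.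
  by apply: measurable_funM => //; exact: measurable_exp_weight.
have f0 y : 0 <= f y by rewrite mulr_ge0 ?exp_weight_ge0.
have ig : Int g.
  have b1A : b - 1 <= A' by lra.
  apply: (@integrable_pairing _ _ _ (expR (lam * A')) (b - 1) A') => //.
  - by apply: measurable_funM => //; exact: measurable_indic.
  - move=> z; rewrite ger0_norm ?mulr_ge0 ?expR_ge0//.
    by rewrite ler_piMr ?expR_ge0// indicE; case: (_ \in _).
  - by move=> z hz; rewrite indicE memNset ?mulr0//= in_itv/=; exact/negP.
have fg n y : `|f_ n y| <= g y.
  rewrite ger0_norm ?mulr_ge0 ?exp_weight_ge0// /f_ /g.
  have [Ay|yA] := ltP A y; first by rewrite wA// normr0 !mul0r.
  rewrite ler_wpM2l// /exp_weight; case: ifPn => [by_|_]; last first.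
    by rewrite mulr_ge0 ?expR_ge0.
  have rr1 : rr n <= 1 by rewrite invf_le1// ler1n.
  have yA' : y <= A' by rewrite le_max yA.
  rewrite indicE mem_set/= ?mulr1 ?ler_expR ?ler_wpM2l//.
  by rewrite in_itv/= yA' andbT; lra.
(* The closed half-lines [b - rr n, +oo) have intersection [b, +oo), so the convergence holds at
   every y, with eventually constant sequences. *)
have f_f y : f_ n y @[n --> \oo] --> f y.
  apply: cvg_near_cst; have [byy|yb] := leP b y.
    apply: nearW => n; rewrite /f_ /f /exp_weight byy.
    by have -> : b - rr n <= y by have := rr0 n; lra.
  have e0 : 0 < b - y by rewrite subr_gt0.
  have := harmonic_lt_near e0; apply: filterS => n; rewrite -/(rr n) => hn.
  rewrite /f_ /f /exp_weight (lt_geF yb).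
  by have /lt_geF -> : y < b - rr n by lra.
have if_ n : Int (f_ n) by exact: le_Int1 ig.
have fi : Int f.
  apply: le_Int1 ig => // y.
  have h : `|f_ n y| @[n --> \oo] --> `|f y| by apply: cvg_norm; exact: f_f.
  by apply: (ler_cvg_to h (cvg_cst (g y))); exact: nearW.
have I_I := dominated_Rcvg mf_ ig fg f_f.
set I := (\int[mu]_x f x)%R in I_I.
have M0 : 0 <= M.
  by apply: Rintegral_ge0 => t _; rewrite mulr_ge0 ?kern_ge0 ?exp_cutoff_ge0.
pose W n x := `|mollify 0 (rr n) w x / (rr n * rbump_mass)| * exp_weight lam b x.
have Wbound : \forall n \near \oo, (\int[mu]_x (W n x)%:E <=
    (2 * C * M * \int[mu]_x f_ n x)%:E)%E.
  (* Below ln 2 / (lam + 1) one has e^(lam r) <= 2; the added 1 covers lam = 0. The other two bounds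
     are those under which the hypothesis and the cutoff estimate hold. *)
  have ln2 : 0 < Num.min r1 (Num.min 1 (ln 2 / (lam + 1))).
    rewrite !lt_min r10 ltr01/= divr_gt0//; first by rewrite ln_gt0// ltr1n.
    exact: ltr_wpDl.
  have := harmonic_lt_near ln2; apply: filterS => n.
  rewrite -/(rr n) !lt_min => /and3P[nr1 n1 nl].
  have e2 : expR (lam * rr n) <= 2.
    rewrite -[leRHS]lnK ?posrE// ler_expR.
    move: nl; rewrite ltr_pdivlMr; last exact: ltr_wpDl.
    by have := rr0 n; nra.
  have h1 := integral_volterra_weight mw w2 wA (rr0 n) (ltW n1) p1 C0 l0
    (fun x => @H _ x (rr0 n) nr1).
  have h2 := integral_mollify_weight mw w2 b (rr0 n) l0.
  have k0 : 0 < rr n * rbump_mass by rewrite mulr_gt0 ?rbump_mass_gt0.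
  have -> : (\int[mu]_x (W n x)%:E = ((rr n * rbump_mass)^-1)%:E *
      \int[mu]_x (`|mollify 0 (rr n) w x| * exp_weight lam b x)%:E)%E.
    rewrite -ge0_integralZl_EFin//; last 3 first.
    - by move=> x _; rewrite lee_fin mulr_ge0 ?exp_weight_ge0.
    - apply/measurable_EFinP; apply: measurable_funM.
        by apply: measurableT_comp => //; exact: measurable_mollify.
      exact: measurable_exp_weight.
    - by rewrite invr_ge0 ltW.
    apply: eq_integral => x _; rewrite -EFinM /W normrM normfV (gtr0_norm k0).
    by congr EFin; ring.
  have CM0 : 0 <= C * M by rewrite mulr_ge0.
  apply: (@le_trans _ _ (((rr n * rbump_mass)^-1)%:E * ((C * M)%:E *
      ((rr n * rbump_mass * expR (lam * rr n))%:E * (\int[mu]_x f_ n x)%R%:E)))%E).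
    rewrite lee_pmul2l ?lte_fin ?invr_gt0//.
    apply: (le_trans h1); rewrite lee_wpmul2l ?lee_fin//.
    by rewrite EFin_Rint.
  rewrite -!EFinM lee_fin.
  have J0 : 0 <= \int[mu]_x f_ n x.
    by apply: Rintegral_ge0 => x _; rewrite mulr_ge0 ?exp_weight_ge0.
  move: (\int[mu]_x f_ n x) J0 => J J0.
  have -> : (rr n * rbump_mass)^-1 * (C * M * (rr n * rbump_mass * expR (lam * rr n) * J))
      = C * M * J * expR (lam * rr n) by field; rewrite !gt_eqF ?rbump_mass_gt0.
  rewrite (_ : 2 * C * M * J = C * M * J * 2); last by ring.
  by rewrite ler_wpM2l// mulr_ge0.
have W_f : {ae mu, forall x, W n x @[n --> \oo] --> f x}.
  apply: (aeS (mollify_cvg mw w2)) => x hx.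
  by apply: cvgM; [exact: cvg_norm|exact: cvg_cst].
have mW n : measurable_fun setT (W n).
  apply: measurable_funM; last exact: measurable_exp_weight.
  apply: measurableT_comp => //; apply: measurable_funM => //.
  exact: measurable_mollify.
have W0 n x : 0 <= W n x by rewrite mulr_ge0 ?exp_weight_ge0.
have := Fatou_ae mW mf W0 W_f Wbound (cvgM (cvg_cst (2 * C * M)) I_I).
rewrite -EFin_Rint// -/I lee_fin => hI.
have I0 : 0 <= I by exact: Rintegral_ge0.
(* I is a real number, f being integrable, so I <= 2 C M I with 2 C M < 1 leaves only I = 0. *)
have {}I0 : I = 0 by apply/eqP; rewrite eq_le I0 andbT; exact: contr (hI _ _) hN.
have : (\int[mu]_x `|(f x)%:E|)%E = 0%E.
  under eq_integral do rewrite /= ger0_norm//.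
  by rewrite -EFin_Rint// -/I I0.
have mfE : measurable_fun setT (EFin \o f) by exact/measurable_EFinP.
move=> /(ae_eq_integral_abs mu measurableT mfE) h.
apply: (aeS h) => x /= /(_ Logic.I) hx; rewrite in_itv/= andbT => bx.
case: hx; rewrite /f /exp_weight bx => /eqP; rewrite mulf_eq0.
by rewrite normr_eq0 (gt_eqF (expR_gt0 _)) orbF => /eqP.
Qed.

End gronwall_limit.

Section vanish_left.
Context {R : realType}.
Local Notation mu := (@lebesgue_measure R).
Local Notation Int f := (mu.-integrable setT (EFin \o f)).

Lemma ae_eq_mollify m r (f g : R -> R) x : measurable_fun setT f ->
  measurable_fun setT g -> {ae mu, forall z, f z = g z} ->
  mollify m r f x = mollify m r g x.
Proof.
move=> mf mg fg; apply: ae_eq_Rintegral.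
- by apply: measurable_funM => //; exact: measurable_rbump_shift.
- by apply: measurable_funM => //; exact: measurable_rbump_shift.
- by apply: (aeS fg) => z ->.
Qed.

Variables (s : R) (Om : set R) (q u w : R -> R) (Q : R).
Hypotheses (s0 : 0 < s) (s1 : s < 1) (s12 : s != 2^-1).
Hypotheses (mq : measurable_fun setT (q \_ Om)).
Hypothesis (qQ : {ae mu, forall x, `|(q \_ Om) x| <= Q}).
Hypotheses (wHs : Hs s w).
Hypotheses (wu : ae_eq_on (add_pos Om) w u) (u_sol : weak_solution s Om q u).

Let mw : measurable_fun setT w.
Proof. by case: wHs => /sub_Lfun_mfun + _; rewrite inE. Qed.

Let w2 : Int (fun z => w z ^+ 2).
Proof. by case: wHs => /Lfun2_integrable_sqr. Qed.

(** The Volterra bound needs the equation at every z > x. The overlap a < b provides it: for z < b -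
    r the bump at z fits into Om, and for z >= b - r, as soon as 2 r < b - a, every term vanishes
    because w = 0 beyond a. *)
Lemma vanish_left (alpha a b c : R) : a < b -> `]alpha, b[ `<=` Om ->
  ae_eq_on `]a, +oo[ w (cst 0) -> alpha < c -> ae_eq_on `[c, +oo[ w (cst 0).
Proof.
(* A representative that vanishes everywhere beyond a, as the Volterra estimates demand; its
   mollifications are those of w. In the same way q1 below is bounded at every point. *)
move=> ab abOm w0 ac; pose w1 z := if z <= a then w z else 0.
have w1E : {ae mu, forall z, w z = w1 z}.
  apply: (aeS w0) => z hz; rewrite /w1; case: leP => // az.
  by apply: hz; rewrite /= in_itv/= az.
have mw1 : measurable_fun setT w1.
  by apply: measurable_fun_ifT => //; apply: measurable_fun_ler.
have w12 : Int (fun z => w1 z ^+ 2).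
  apply: (@integrable_sqr_le _ _ w 1) => // z.
  by rewrite mul1r /w1; case: ifP => // _; rewrite normr0.
have w1a z : a < z -> w1 z = 0 by move=> az; rewrite /w1 (lt_geF az).
have mE r : mollify 0 r w1 = mollify 0 r w.
  by apply/funext => x; rewrite (ae_eq_mollify _ _ _ mw mw1 w1E).
pose Q' := Num.max Q 0.
have Q'0 : 0 <= Q' by rewrite le_max lexx orbT.
pose q1 z := if `|(q \_ Om) z| <= Q' then (q \_ Om) z else 0.
have q1E : {ae mu, forall z, (q \_ Om) z = q1 z}.
  by apply: (aeS qQ) => z hz; rewrite /q1 le_max hz.
have mq1 : measurable_fun setT q1.
  apply: measurable_fun_ifT => //; apply: measurable_fun_ler => //.
  exact: measurableT_comp.
have q1Q z : `|q1 z| <= Q' by rewrite /q1; case: ifP => // _; rewrite normr0.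
set k := 2 - 2 `^ (2 * s); have k0 : k != 0 by exact: powR2_neq2.
have cancel_k (I P : R) : k^-1 * I = - P -> I = - k * P.
  by move=> h; rewrite mulNr -mulrN -h mulrA divff// mul1r.
(* The tested equation reads k^-1 I + (q w)_r = 0, where I is the kernel integral; solving for I
   gives the factor -k. *)
pose f z := - k * (q1 z * w1 z).
have mf : measurable_fun setT f.
  by apply: measurable_funM => //; exact: measurable_funM.
have fw z : `|f z| <= `|k| * Q' * `|w1 z|.
  by rewrite /f normrM normrN -mulrA ler_wpM2l// normrM ler_wpM2r.
have fE r x : 0 < r -> mollify 0 r f x = - k * mollify 0 r (fun z => (q \_ Om) z * w z) x.
  move=> r0; have i1 : Int (fun z => q1 z * w1 z * rbump r 0 (z - x)).
    apply: integrable_mollify => //; first exact: measurable_funM.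
    apply: (@integrable_sqr_le _ _ w1 Q') => //; first exact: measurable_funM.
    by move=> z; rewrite normrM ler_wpM2r.
  rewrite (@ae_eq_mollify _ _ (fun z => (q \_ Om) z * w z) (fun z => q1 z * w1 z)).
  - rewrite /mollify -(@RintegralZl _ (measurableTypeR R) _ mu setT _ (- k) measurableT i1).
    by apply: eq_Rintegral => z _; rewrite /f !mulrA.
  - exact: measurable_funM.
  - exact: measurable_funM.
  - have h : {ae mu, forall z, (q \_ Om) z = q1 z /\ w z = w1 z}.
      exact: (aeI q1E w1E).
    by apply: (aeS h) => z [-> ->].
have [K K0 HK] := volterra_bound s0 s1.
(* The first bound makes the two regions for z overlap, the second keeps z - r > alpha for all z > x
   >= c. *)
pose r1 := Num.min ((b - a) / 2) (c - alpha).
have r10 : 0 < r1 by rewrite lt_min divr_gt0 ?subr_gt0.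
have C0 : 0 <= `|k| * Q' / K by rewrite divr_ge0 ?mulr_ge0 ?(ltW K0).
have p1 : 1 - 2 * s < 1 by move: s0; lra.
have vw1 : ae_eq_on `[c, +oo[ w1 (cst 0).
  apply: (@Volterra_vanishing _ w1 a _ (`|k| * Q' / K) c r1 mw1 w12 w1a p1 C0 r10).
  move=> r x r0; rewrite lt_min => /andP[rb rc] cx.
  have rb2 : r + r < b - a by move: rb; rewrite ltr_pdivlMr//; lra.
  rewrite mulrAC ler_pdivlMr// mulrC.
  apply: (HK w1 f a r x _ r0 mw1 w12 w1a mf fw) => z xz.
  have [zb|bz] := ltP z (b - r).
    have zrOm : `[z - r, z + r] `<=` Om.
      move=> y; rewrite /= in_itv/= => /andP[h1 h2]; apply: abOm.
      by rewrite /= in_itv/=; apply/andP; split; lra.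
    have := mollified_equation s0 s1 wHs wu u_sol r0 zrOm.
    rewrite fE// mE -/k => /eqP; rewrite addr_eq0 => /eqP h.
    exact: cancel_k.
  have fa y : a < y -> f y = 0 by move=> ay; rewrite /f w1a// !mulr0.
  have az : a + r < z by lra.
  rewrite (mollify_eq0_right _ r0 fa az).
  rewrite (_ : (fun y => _) = cst 0) ?Rintegral_cst ?mul0r//.
  apply/funext => y /=; have [y0|y0] := leP y 0; first by rewrite kern_le0// mul0r.
  rewrite !(mollify_eq0_right _ r0 w1a); [ring|lra|lra|lra].
have h := aeI vw1 w1E.
by apply: (aeS h) => z [h1 h2] cz; rewrite h2; exact: h1.
Qed.

End vanish_left.

(** * Essential bounds, half-lines and the assembly *)

Section essential_bound.
Context {R : realType}.
Local Notation mu := (@lebesgue_measure R).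

Lemma essentially_bounded_ae (Om : set R) (q : R -> R) :
  essentially_bounded_on Om q ->
  measurable_fun setT (q \_ Om) /\
  exists Q, {ae mu, forall x, `|(q \_ Om) x| <= Q}.
Proof.
move=> qb; split; first by move: qb => /sub_Lfun_mfun; rewrite inE.
move: qb => /sub_Lfun_finLfun; rewrite inE /finite_norm unlock /=.
have -> : (0 < mu [set: R])%E.
  apply: (@lt_le_trans _ _ (mu `[0%R, 1%R]%classic)).
    by rewrite lebesgue_measure_itv/= lte_fin ltr01 oppr0 adde0 lte_fin.
  by apply: le_measure => //; rewrite inE.
exact: ess_supr_bounded.
Qed.
End essential_bound.

Section set_facts.
Context {R : realType}.
Local Notation mu := (@lebesgue_measure R).

Lemma bounded_set_lbound (A : set R) : bounded_set A -> has_lbound A.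
Proof.
move=> [M [_ hM]]; exists (- (M + 1)) => x Ax.
have := hM (M + 1) _ x Ax; rewrite ltrDl ltr01 => /(_ isT).
by rewrite /= ler_norml => /andP[].
Qed.

Lemma open_itv_nbhs (A : set R) (x : R) : open A -> A x ->
  exists2 e, 0 < e & `]x - e, x + e[ `<=` A.
Proof.
move=> oA Ax; have [e e0 he] := (nbhs_ballP _ _).1 (open_nbhs_nbhs (conj oA Ax)).
exists e => // y; rewrite /= in_itv/= => hy; apply: he.
by rewrite /ball/= distrC ltr_distl.
Qed.

Lemma ae_eq_on_sub (V W : set R) (f g : R -> R) : W `<=` V ->
  ae_eq_on V f g -> ae_eq_on W f g.
Proof. by move=> WV; move=> h; apply: (aeS h) => x hx /WV. Qed.

(* add_pos Om = (inf Om, +oo) is a countable union of such half-lines. *)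
Lemma ae_eq_on_add_pos (Om : set R) (f g : R -> R) : has_inf Om ->
  (forall c, add_pos Om c -> ae_eq_on `[c, +oo[ f g) ->
  ae_eq_on (add_pos Om) f g.
Proof.
move=> [Om0 lbOm] H; pose m := inf Om.
have hn (n : nat) : ae_eq_on `[m + n.+1%:R^-1, +oo[ f g.
  apply: H; have : m < m + n.+1%:R^-1 by rewrite ltrDl invr_gt0.
  move=> /(inf_lt Om0) [y Oy ym]; exists y => //.
  by exists (m + n.+1%:R^-1 - y) => /=; [rewrite subr_gt0|rewrite addrC subrK].
have h := @ae_foralln _ (measurableTypeR R) _ mu _ hn.
apply: (aeS h) => x hx [y Oy [t /= t0 yx]].
have mx : 0 < x - m.
  by have := ge_inf lbOm Oy; rewrite -/m subr_gt0 -yx => ?; lra.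
have [n _ nx] := harmonic_lt_near mx.
apply: (hx n); rewrite /= in_itv/= andbT.
by have := nx n (leqnn n); rewrite /= ltrBrDl => /ltW.
Qed.

End set_facts.

Theorem lemma5p24 (R : realType) (s : R) (hs0 : 0 < s) (hs1 : s < 1)
    (hs12 : s != 2^-1)
    (Om : set R) (Om_bounded : bounded_set Om) (Om_open : open Om)
    (Om_lipschitz : lipschitz_set Om)
    (q : R -> R) (q_bounded : essentially_bounded_on Om q)
    (q_spectrum : zero_not_in_spectrum s Om q)
    (u : R -> R) (u_Hs : Hs_on s (add_pos Om) u)
    (u_sol : weak_solution s Om q u)
    (U : set R) (U_open : open U) (U_nonempty : U !=set0) (U_Om : U `<=` Om)
    (U_no_gap : no_gap Om U)
    (u_zero : ae_eq_on U u (cst 0)) :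
  ae_eq_on (add_pos Om) u (cst 0).
Proof.
have [w wHs wu] := u_Hs.
have [mq [Q qQ]] := essentially_bounded_ae q_bounded.
have lbOm := bounded_set_lbound Om_bounded.
have Om0 : Om !=set0 by case: U_nonempty => x /U_Om; exists x.
have add_posW x y : Om x -> x < y -> add_pos Om y.
  move=> Ox xy; exists x => //; exists (y - x) => /=; first by rewrite subr_gt0.
  by rewrite addrC subrK.
have Om_add : Om `<=` add_pos Om.
  move=> x Ox; have [e e0 he] := open_itv_nbhs Om_open Ox.
  by apply: (add_posW (x - e / 2)); [apply: he; rewrite /= in_itv/=; lra|lra].
(* The interval of vanishing is taken to the left of x, so that the conclusion starts at x
   itself. *)
have right_of (x : R) : U x -> ae_eq_on `]x, +oo[ w (cst 0).
  move=> Ux; have [e e0 he] := open_itv_nbhs U_open Ux.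
  have xe : x - e < x by lra.
  have hU : `]x - e, x[ `<=` U.
    move=> y; rewrite /= in_itv/= => /andP[h1 h2]; apply: he.
    by rewrite /= in_itv/= h1/=; lra.
  apply: (vanish_right hs0 hs1 hs12 mq wHs wu u_sol xe (subset_trans hU U_Om)).
  have h := aeI wu u_zero.
  apply: (aeS h) => z [h1 h2] /hU Uz.
  by rewrite h1 ?h2//; exact/Om_add/U_Om.
have w0 : ae_eq_on (add_pos Om) w (cst 0).
  apply: ae_eq_on_add_pos => // c [y Oy [t /= t0 yc]].
  have yltc : y < c by rewrite -yc ltrDl.
  (* If U has a point to the left of c, continuation to the right already covers [c, +oo). Otherwise
     U lies entirely at or beyond c, and w must be followed leftwards from U to c. *)
  have [[x Ux xc]|noU] := pselect (exists2 x, U x & x < c).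
    apply: ae_eq_on_sub (right_of x Ux) => z; rewrite /= !in_itv/= !andbT.
    exact: lt_le_trans.
  have Uc x : U x -> c <= x.
    by move=> Ux; rewrite leNgt; apply/negP => xc; apply: noU; exists x.
  (* No point of U lies to the left of its infimum m, so (y, m] is in Om. *)
  pose m := inf U; have lbU : has_lbound U by exists c.
  have Om_m z : y < z -> z <= m -> Om z.
    move=> yz zm; have [//|[x Ux [t' /= t'0 xz]]] := U_no_gap z (add_posW _ _ Oy yz).
    have := ge_inf lbU Ux; rewrite -/m => mx.
    by exfalso; move: (le_lt_trans mx (ltr_pwDr t'0 (lexx x))); rewrite xz ltNge zm.
  have cm : c <= m by apply: lb_le_inf.
  (* Since Om is open, it contains ]y, m + e[, and U has a point x < m + e. Vanishing on ]x, +oo[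
     thus overlaps the interval of Om on which the equation is used. *)
  have [e e0 he] := open_itv_nbhs Om_open (Om_m m (lt_le_trans yltc cm) (lexx m)).
  have [x Ux xm] : exists2 x, U x & x < m + e by apply: inf_lt => //; rewrite ltrDl.
  apply: (vanish_left hs0 hs1 hs12 mq qQ wHs wu u_sol xm _ (right_of x Ux) yltc).
  move=> z; rewrite /= in_itv/= => /andP[yz zm].
  have [zlm|mz] := leP z m; first exact: Om_m.
  by apply: he; rewrite /= in_itv/= zm andbT; lra.
have h := aeI wu w0.
by apply: (aeS h) => z [h1 h2] Oz; rewrite -h1 ?h2.
Qed.
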